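(* Let $(R,\mathfrak n)$ be a Noetherian local ring with infinite residue field, let $I_1,\ldots,I_d$ be ideals of $R$, let $J$ be an $\mathfrak n$-primary ideal, and let $N$ be a finitely generated $R$-module such that $I=I_1\cdots I_d\not\subseteq\sqrt{\mathrm{Ann}\,N}$. Set $\overline N=N/(0_N:I^\infty)$ and $q=\dim\overline N$. Let $\Pi$ be the set of prime ideals $\mathfrak p$ of $R$ with $\mathfrak p\in\mathrm{Min}(R/\mathrm{Ann}\,\overline N)$ and $\dim R/\mathfrak p=\dim\overline N$. Then for all non-negative integers $k_0,k_1,\ldots,k_d$ with $k_0+k_1+\cdots+k_d=q-1$, $$e(J^{[k_0+1]},I_1^{[k_1]},\ldots,I_d^{[k_d]};N)=\sum_{\mathfrak p\in\Pi}\ell(N_{\mathfrak p})\,e(J^{[k_0+1]},I_1^{[k_1]},\ldots,I_d^{[k_d]};R/\mathfrak p).$$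
   Context: $0_N:I^\infty=\bigcup_{m\ge0}(0_N:I^m)$. For $\mathbf n=(n_1,\ldots,n_d)$ write $\mathbf I^{\mathbf n}=I_1^{n_1}\cdots I_d^{n_d}$. For a finitely generated $R$-module $L$ with $I\not\subseteq\sqrt{\mathrm{Ann}\,L}$, let $q_L=\dim L/(0_L:I^\infty)$; the function $(n_0,\mathbf n)\mapsto\ell\big(J^{n_0}\mathbf I^{\mathbf n}L/J^{n_0+1}\mathbf I^{\mathbf n}L\big)$ agrees, for all sufficiently large $n_0,n_1,\ldots,n_d$, with a polynomial of total degree $q_L-1$ whose terms of total degree $q_L-1$ are $\sum_{k_0+k_1+\cdots+k_d=q_L-1}e(J^{[k_0+1]},I_1^{[k_1]},\ldots,I_d^{[k_d]};L)\frac{n_0^{k_0}n_1^{k_1}\cdots n_d^{k_d}}{k_0!k_1!\cdots k_d!}$. These coefficients are the mixed multiplicities of $L$ with respect to $J,I_1,\ldots,I_d$ (equivalently, the mixed multiplicities of the $\mathbb N^{d+1}$-graded module $\bigoplus J^{n_0}\mathbf I^{\mathbf n}L/J^{n_0+1}\mathbf I^{\mathbf n}L$). $\ell(N_{\mathfrak p})$ is the length of $N_{\mathfrak p}$ over $R_{\mathfrak p}$. *)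

(* Defs.v *)
From HB Require Import structures.
From mathcomp Require Import all_boot all_order all_algebra.
From mathcomp Require Import mpoly.
From Stdlib Require Import ClassicalEpsilon.

Set Implicit Arguments.
Unset Strict Implicit.
Unset Printing Implicit Defensive.

Import Order.TTheory GRing.Theory.
Local Open Scope ring_scope.

Definition incl (X : Type) (A B : X -> Prop) := forall x, A x -> B x.
Definition seteq (X : Type) (A B : X -> Prop) := forall x, A x <-> B x.
Definition strict (X : Type) (A B : X -> Prop) :=
  incl A B /\ exists x, B x /\ ~ A x.

Definition ideal (R : comUnitRingType) (A : R -> Prop) :=
  [/\ A 0, (forall x y, A x -> A y -> A (x + y)) & (forall r x, A x -> A (r * x))].

Definition submod (R : comUnitRingType) (N : lmodType R) (S : N -> Prop) :=
  [/\ S 0, (forall x y, S x -> S y -> S (x + y)) & (forall r x, S x -> S (r *: x))].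

Definition prime_ideal (R : comUnitRingType) (P : R -> Prop) :=
  [/\ ideal P, ~ P 1 & forall a b, P (a * b) -> P a \/ P b].

Definition span_ideal (R : comUnitRingType) (G : R -> Prop) : R -> Prop :=
  fun x => forall A, ideal A -> incl G A -> A x.
Definition span_mod (R : comUnitRingType) (N : lmodType R) (G : N -> Prop) : N -> Prop :=
  fun x => forall S, submod S -> incl G S -> S x.

Definition idfull (R : comUnitRingType) : R -> Prop := fun _ => True.
Definition modfull (R : comUnitRingType) (N : lmodType R) : N -> Prop := fun _ => True.
Definition modzero (R : comUnitRingType) (N : lmodType R) : N -> Prop := fun x => x = 0.

Definition idmul (R : comUnitRingType) (A B : R -> Prop) : R -> Prop :=
  span_ideal (fun x => exists a b, [/\ A a, B b & x = a * b]).
Definition idpow (R : comUnitRingType) (A : R -> Prop) (n : nat) : R -> Prop :=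
  iter n (idmul A) (@idfull R).
Definition idprod (R : comUnitRingType) (d : nat) (Is : 'I_d -> R -> Prop)
    (n : 'I_d -> nat) : R -> Prop :=
  foldr (fun i acc => idmul (idpow (Is i) (n i)) acc) (@idfull R) (enum 'I_d).

Definition modmul (R : comUnitRingType) (N : lmodType R) (A : R -> Prop)
    (S : N -> Prop) : N -> Prop :=
  span_mod (fun x => exists a y, [/\ A a, S y & x = a *: y]).
Definition modadd (R : comUnitRingType) (N : lmodType R) (S T : N -> Prop) : N -> Prop :=
  fun x => exists y z, [/\ S y, T z & x = y + z].

Definition radical (R : comUnitRingType) (A : R -> Prop) : R -> Prop :=
  fun x => exists m, A (x ^+ m).

(* For the module L = N/S (S a submodule of N):
   Ann L = { r | r N ⊆ S }  and  (0_L : I^oo) = colon_inf I S / S  *)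
Definition annq (R : comUnitRingType) (N : lmodType R) (S : N -> Prop) : R -> Prop :=
  fun r => forall x, S (r *: x).
Definition colon_inf (R : comUnitRingType) (N : lmodType R) (I : R -> Prop)
    (S : N -> Prop) : N -> Prop :=
  fun x => exists m, forall a, idpow I m a -> S (a *: x).

Definition prime_chain (R : comUnitRingType) (A : R -> Prop) (k : nat) :=
  exists P : nat -> R -> Prop,
    (forall i, (i <= k)%N -> prime_ideal (P i) /\ incl A (P i)) /\
    (forall i, (i < k)%N -> strict (P i) (P i.+1)).
Definition is_dim (R : comUnitRingType) (A : R -> Prop) (q : nat) :=
  prime_chain A q /\ forall k, prime_chain A k -> (k <= q)%N.
Definition krull_dim (R : comUnitRingType) (A : R -> Prop) : nat :=
  epsilon (inhabits 0%N) (is_dim A).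
Definition mdim (R : comUnitRingType) (N : lmodType R) (S : N -> Prop) : nat :=
  krull_dim (annq S).

Definition minimal_prime_over (R : comUnitRingType) (A P : R -> Prop) :=
  [/\ prime_ideal P, incl A P &
      forall P', prime_ideal P' -> incl A P' -> incl P' P -> incl P P'].

Definition chain_between (X : Type) (Sub : (X -> Prop) -> Prop) (A B : X -> Prop)
    (n : nat) :=
  exists C : nat -> X -> Prop,
    [/\ (forall i, (i <= n)%N -> Sub (C i)), seteq (C 0%N) A, seteq (C n) B &
        (forall i, (i < n)%N -> strict (C i) (C i.+1))].
Definition is_length (X : Type) (Sub : (X -> Prop) -> Prop) (A B : X -> Prop) (l : nat) :=
  chain_between Sub A B l /\ forall m, chain_between Sub A B m -> (m <= l)%N.
Definition len (X : Type) (Sub : (X -> Prop) -> Prop) (A B : X -> Prop) : nat :=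
  epsilon (inhabits 0%N) (is_length Sub A B).

(* Localization N_p, modelled on fractions x/s (pairs (x,s), s ∉ p) up to
   the usual equivalence; its R_p-submodules are the equivalence-closed sets
   of fractions stable under the R_p-module operations.                 *)
Definition loc_equiv (R : comUnitRingType) (N : lmodType R) (p : R -> Prop)
    (z w : N * R) :=
  exists u, ~ p u /\ u *: (w.2 *: z.1 - z.2 *: w.1) = 0.
Definition loc_submod (R : comUnitRingType) (N : lmodType R) (p : R -> Prop)
    (S : N * R -> Prop) :=
  [/\ (forall z, S z -> ~ p z.2),
      (forall z w, S z -> ~ p w.2 -> loc_equiv p z w -> S w),
      S (0, 1),
      (forall z w, S z -> S w -> S (w.2 *: z.1 + z.2 *: w.1, z.2 * w.2)) &
      (forall r u z, ~ p u -> S z -> S (r *: z.1, u * z.2))].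
Definition loc_length (R : comUnitRingType) (N : lmodType R) (p : R -> Prop) : nat :=
  len (loc_submod (N := N) p)
      (fun z => ~ p z.2 /\ loc_equiv p z (0, 1)) (fun z => ~ p z.2).

(* ℓ(J^{n0} I^n L / J^{n0+1} I^n L)                                     *)
Definition hilb_fun (R : comUnitRingType) (N : lmodType R) (S : N -> Prop)
    (J : R -> Prop) (d : nat) (Is : 'I_d -> R -> Prop) (n0 : nat) (n : 'I_d -> nat) : nat :=
  len (@submod R N)
      (modadd (modmul (idmul (idpow J n0.+1) (idprod Is n)) (@modfull R N)) S)
      (modadd (modmul (idmul (idpow J n0) (idprod Is n)) (@modfull R N)) S).

Definition Iall (R : comUnitRingType) (d : nat) (Is : 'I_d -> R -> Prop) : R -> Prop :=
  idprod Is (fun _ => 1%N).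

Definition qL (R : comUnitRingType) (N : lmodType R) (S : N -> Prop)
    (d : nat) (Is : 'I_d -> R -> Prop) : nat :=
  mdim (colon_inf (Iall Is) S).

(* point (n0, n_1, ..., n_d) of Q^{d+1}; variable 0 is for J *)
Definition ptvec (d : nat) (n0 : nat) (n : 'I_d -> nat) : 'I_d.+1 -> rat :=
  fun i => (if unlift ord0 i is Some j then n j else n0)%:R.

Definition is_hilb_poly (R : comUnitRingType) (N : lmodType R) (S : N -> Prop)
    (J : R -> Prop) (d : nat) (Is : 'I_d -> R -> Prop) (P : {mpoly rat[d.+1]}) :=
  (msize P <= qL S Is)%N /\
  exists B : nat, forall n0 (n : 'I_d -> nat),
    (B <= n0)%N -> (forall i, (B <= n i)%N) ->
    (hilb_fun S J Is n0 n)%:R = meval (ptvec n0 n) P.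

Definition hilb_poly (R : comUnitRingType) (N : lmodType R) (S : N -> Prop)
    (J : R -> Prop) (d : nat) (Is : 'I_d -> R -> Prop) : {mpoly rat[d.+1]} :=
  epsilon (inhabits 0) (is_hilb_poly S J Is).

Definition expvec (d : nat) (k0 : nat) (k : 'I_d -> nat) : 'X_{1..d.+1} :=
  [multinom (if unlift ord0 i is Some j then k j else k0) | i < d.+1].

(* e(J^[k0+1], I_1^[k1], ..., I_d^[kd]; N/S) : coefficient of
   n0^k0 n1^k1 ... nd^kd times k0! k1! ... kd!                          *)
Definition mixed_mult (R : comUnitRingType) (N : lmodType R) (S : N -> Prop)
    (J : R -> Prop) (d : nat) (Is : 'I_d -> R -> Prop) (k0 : nat) (k : 'I_d -> nat) : rat :=
  (hilb_poly S J Is)@_(expvec k0 k) * (k0`! * \prod_(i < d) (k i)`!)%:R.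

Definition noetherian (R : comUnitRingType) :=
  forall f : nat -> R -> Prop, (forall i, ideal (f i)) ->
    (forall i, incl (f i) (f i.+1)) ->
    exists n, forall m, (n <= m)%N -> incl (f m) (f n).

Definition local_with (R : comUnitRingType) (mm : R -> Prop) :=
  [/\ ideal mm, ~ mm 1 & forall x, ~ mm x -> x \is a GRing.unit].

Definition infinite_residue (R : comUnitRingType) (mm : R -> Prop) :=
  exists f : nat -> R, forall i j, mm (f i - f j) -> i = j.

Definition primary_to (R : comUnitRingType) (mm J : R -> Prop) :=
  ideal J /\ seteq (radical J) mm.

Definition fin_gen (R : comUnitRingType) (N : lmodType R) :=
  exists s : seq N, forall x, exists c : nat -> R,
    x = \sum_(i < size s) c i *: s`_i.

(* Main.v *)
Require Import Defs.
From HB Require Import structures.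
From mathcomp Require Import all_boot all_order all_algebra.
From mathcomp Require Import mpoly.
From mathcomp Require Import zify ring lra.
From Stdlib Require Import ClassicalEpsilon FunctionalExtensionality PropExtensionality.

Set Implicit Arguments.
Unset Strict Implicit.
Unset Printing Implicit Defensive.
Import Order.TTheory GRing.Theory Num.Theory.
Local Open Scope ring_scope.

(** For a prime filtration of [N / W], [W = (0 : I^oo)], the Hilbert function
    [h_N] of the multi-Rees module is, for large arguments, the sum over the
    factors [R / p_i] of the Hilbert functions of the filtrations
    [col_i n = {r | r y_i \in J^n0 I^n N + T_i}] of [R], which Artin-Rees makes
    close to [J^n0 I^n + p_i].  Call an error small if it has degree less than
    [q - 1].

    If [dim R / p_i < q] the whole contribution is small: a linear Artin-Rees
    bound [J^(k + c|n|) N \cap I^n N <= J^k I^n N] compares the sum of [h] over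
    [n0] with the Hilbert-Samuel function of [R / p_i], which grows like a
    polynomial of degree [dim R / p_i].  Otherwise [p_i] lies in [Pi], no ideal
    involved is contained in [p_i], and some [x] outside [p_i] satisfies
    [x col_i <= J^n0 I^n + p_i <= col_i]; multiplication by [x] shifts the
    filtrations by at most a constant, so replacing [col_i n] by
    [J^n0 I^n + p_i] changes [h] by a small error.  Finally, localizing the
    prime filtration shows that [p] occurs [loc_length N p] times.

    Polynomiality is proved by the Hilbert-Serre induction on generators, in a
    class of functions closed under summation; degrees are controlled by growth. *)

(** * Lengths of modules *)

(** Lengths, dimensions and Hilbert polynomials are all [epsilon] choices, so each means something
    only once an object with its defining property is exhibited. Finiteness of lengths, finiteness
    of Krull dimension and a polynomial of degree below [qL] therefore have to be proved before
    anything can be compared. Quotient modules are never formed: a quotient is a pair of nested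
    submodule predicates, and an isomorphism is a transport of chains.

    Filtrations are compared through the sums [Hf] of h over n0. These increase along the J
    direction, so two inequalities up to a shift already determine the top-degree part; for h itself
    no such monotonicity is at hand. Summation costs one degree, and a final difference recovers it.

    Degrees are never computed from a theory of multigraded modules. Once a function is known to be
    a polynomial for large arguments, any bound on its values bounds its total degree. Errors of
    degree below q - 1 are harmless because the mixed multiplicities are coefficients of total
    degree exactly q - 1. *)

Section Predicates.
Variable X : Type.
Implicit Types A B C : X -> Prop.

Lemma pred_ext A B : incl A B -> incl B A -> A = B.
Proof.
move=> sAB sBA; apply: functional_extensionality => x.
by apply: propositional_extensionality; split; [apply: sAB | apply: sBA].
Qed.

Lemma seteq_eq A B : seteq A B -> A = B.
Proof. by move=> h; apply: pred_ext => x /h. Qed.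

Lemma incl_refl A : incl A A. Proof. by []. Qed.

Lemma incl_trans A B C : incl A B -> incl B C -> incl A C.
Proof. by move=> sAB sBC x /sAB /sBC. Qed.

Lemma eq_or_strict A B : incl A B -> A = B \/ strict A B.
Proof.
move=> sAB; case: (classic (incl B A)) => [sBA|nsBA]; first by left; apply: pred_ext.
right; split=> //; apply: NNPP => h; apply: nsBA => x Bx.
by apply: NNPP => nAx; apply: h; exists x.
Qed.

Lemma strictP A B : incl A B -> ~ incl B A -> strict A B.
Proof. by move=> sAB nsBA; case: (eq_or_strict sAB) => // eAB; case: nsBA; rewrite eAB. Qed.

Lemma strict_nincl A B : strict A B -> ~ incl B A.
Proof. by case=> _ [x [Bx nAx]] /(_ x Bx). Qed.

Definition meet A B : X -> Prop := fun x => A x /\ B x.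

Lemma meet_idl A B : incl A B -> meet A B = A.
Proof. by move=> sAB; apply: pred_ext => x; [case | move=> Ax; split=> //; apply: sAB]. Qed.

Lemma meet_idr A B : incl B A -> meet A B = B.
Proof. by move=> sBA; apply: pred_ext => x; [case | move=> Bx; split=> //; apply: sBA]. Qed.

Variable Sub : (X -> Prop) -> Prop.

Lemma chain_nil A : Sub A -> chain_between Sub A A 0.
Proof. by move=> sA; exists (fun _ => A); split. Qed.

Lemma chain_rcons A B C n :
  chain_between Sub A B n -> Sub C -> strict B C -> chain_between Sub A C n.+1.
Proof.
case=> D [sD eA eB sCh] sC sBC.
exists (fun i => if (i <= n)%N then D i else C); split => //.
- by move=> i; case: ifP => // le_in _; apply: sD.
- by rewrite ltnn => x.
- move=> i; rewrite ltnS => le_in; rewrite le_in.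
  case: ifP => [lt_in|/negbT]; first exact: sCh.
  rewrite -leqNgt => le_ni; have -> : i = n by apply/eqP; rewrite eqn_leq le_in -ltnS.
  by rewrite (seteq_eq eB).
Qed.

Lemma chain0 A B : chain_between Sub A B 0 -> Sub A /\ B = A.
Proof.
by case=> D [sD eA eB _]; rewrite -(seteq_eq eA) -(seteq_eq eB); split=> //; apply: sD.
Qed.

Lemma chainS A C n : chain_between Sub A C n.+1 ->
  exists B, [/\ chain_between Sub A B n, Sub C & strict B C].
Proof.
case=> D [sD eA eC sCh]; exists (D n); split.
- by exists D; split=> // i h; [apply: sD; apply: leqW | apply: sCh; apply: ltnW].
- by rewrite -(seteq_eq eC); apply: sD.
- by rewrite -(seteq_eq eC); apply: sCh.
Qed.

Lemma chain_Subl A B n : chain_between Sub A B n -> Sub A.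
Proof. by case=> D [sD eA _ _]; rewrite -(seteq_eq eA); apply: sD. Qed.

Lemma chain_Subr A B n : chain_between Sub A B n -> Sub B.
Proof. by case=> D [sD _ eB _]; rewrite -(seteq_eq eB); apply: sD. Qed.

Lemma chain_incl A B n : chain_between Sub A B n -> incl A B.
Proof.
elim: n B => [|n IH] B; first by case/chain0=> _ ->.
by case/chainS=> C [/IH sAC _ [sCB _]]; apply: incl_trans sCB.
Qed.

Lemma chain_cat A B C n m : chain_between Sub A B n -> chain_between Sub B C m ->
  chain_between Sub A C (n + m).
Proof.
move=> cAB; elim: m C => [|m IH] C; first by case/chain0=> _ ->; rewrite addn0.
by case/chainS=> D [/IH cAD sC sDC]; rewrite addnS; apply: chain_rcons sDC.
Qed.

Lemma chain_weak A B C n : chain_between Sub A B n -> Sub C -> incl B C ->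
  exists2 m, (n <= m)%N & chain_between Sub A C m.
Proof.
move=> cAB sC /eq_or_strict [<-|sBC]; first by exists n.
by exists n.+1 => //; apply: chain_rcons sBC.
Qed.

(** [len] is an [epsilon] value, and only the existence of a longest chain makes it the maximum;
    hence this predicate accompanies every computation of a length. *)
Definition finlen A B := exists l, is_length Sub A B l.

Lemma lenP A B : finlen A B -> is_length Sub A B (len Sub A B).
Proof. by move=> h; apply: (epsilon_spec (inhabits 0%N) (is_length Sub A B)). Qed.

Lemma lenE A B l : is_length Sub A B l -> len Sub A B = l.
Proof.
move=> h; have [c1 m1] := lenP (ex_intro _ l h); case: h => c2 m2.
by apply/eqP; rewrite eqn_leq m1 // m2.
Qed.

Lemma finlen_bounded A B l : Sub A -> Sub B -> incl A B ->
  (forall m, chain_between Sub A B m -> (m <= l)%N) -> finlen A B.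
Proof.
move=> sA sB sAB; have [m0 _ c0] := chain_weak (chain_nil sA) sB sAB.
move=> hl; apply: NNPP => nfin.
suff H k : exists2 m, (k <= m)%N & chain_between Sub A B m.
  by have [m lt_lm /hl] := H l.+1; rewrite leqNgt lt_lm.
elim: k => [|k [m le_km cm]]; first by exists m0.
apply: NNPP => h; apply: nfin; exists m; split=> // m' cm'.
rewrite leqNgt; apply/negP => lt_mm'; apply: h; exists m' => //.
exact: leq_trans lt_mm'.
Qed.

Lemma finlen_Subl A B : finlen A B -> Sub A.
Proof. by case=> l [/chain_Subl]. Qed.

Lemma finlen_Subr A B : finlen A B -> Sub B.
Proof. by case=> l [/chain_Subr]. Qed.

Lemma finlen_incl A B : finlen A B -> incl A B.
Proof. by case=> l [/chain_incl]. Qed.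

Lemma chain_le_len A B m : finlen A B -> chain_between Sub A B m -> (m <= len Sub A B)%N.
Proof. by move=> /lenP [_ h] /h. Qed.

Lemma is_length_refl A : Sub A -> is_length Sub A A 0.
Proof.
move=> sA; split; first exact: chain_nil.
by case=> // m /chainS [B [/chain_incl sAB _ /strict_nincl]].
Qed.

Lemma len_gt0 A B : finlen A B -> strict A B -> (0 < len Sub A B)%N.
Proof.
move=> fAB sAB; apply: chain_le_len => //.
apply: chain_rcons (chain_nil (finlen_Subl fAB)) (finlen_Subr fAB) sAB.
Qed.

Lemma finlen_sub A B A' B' : finlen A B -> Sub A' -> Sub B' -> incl A A' -> incl A' B' ->
  incl B' B -> finlen A' B' /\ (len Sub A' B' <= len Sub A B)%N.
Proof.
move=> fAB sA' sB' sAA' sA'B' sB'B.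
have bnd m : chain_between Sub A' B' m -> (m <= len Sub A B)%N.
  move=> cm; have [m0 _ c0] := chain_weak (chain_nil (finlen_Subl fAB)) sA' sAA'.
  have [m1 le1 c1] := chain_weak (chain_cat c0 cm) (finlen_Subr fAB) sB'B.
  by apply: leq_trans (leq_addl m0 m) (leq_trans le1 (chain_le_len fAB c1)).
have f' : finlen A' B' by apply: finlen_bounded bnd.
by split=> //; apply: bnd; case: (lenP f').
Qed.

End Predicates.

Lemma chain_map X Y (Sub : (X -> Prop) -> Prop) (Sub' : (Y -> Prop) -> Prop)
    (g : (X -> Prop) -> (Y -> Prop)) A B n :
  (forall C, Sub C -> incl A C -> incl C B -> Sub' (g C)) ->
  (forall C D, Sub C -> Sub D -> incl A C -> strict C D -> incl D B -> strict (g C) (g D)) ->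
  chain_between Sub A B n -> chain_between Sub' (g A) (g B) n.
Proof.
move=> gS gs c; elim: n B c gS gs => [|n IH] B.
  by move=> /[dup] c0 /chain0 [sA ->] gS gs; apply: chain_nil; apply: gS.
move=> /[dup] c /chainS [C [cC sB ltCB]] gS gs.
have sAC := chain_incl cC; have [sCB _] := ltCB.
apply: (@chain_rcons _ _ _ (g C)).
- apply: IH => // D; first by move=> sD sAD sDC; apply: gS => //; apply: incl_trans sCB.
  by move=> E sD sE sAD sDE sEC; apply: gs => //; apply: incl_trans sCB.
- by apply: gS => //; apply: incl_trans sCB.
- by apply: gs => //; apply: chain_Subr cC.
Qed.

Section Submodules.
Variables (R : comUnitRingType) (N : lmodType R).
Implicit Types A B C S T : N -> Prop.
Local Notation submod := (@submod R N).

Lemma submod0 S : submod S -> S 0. Proof. by case. Qed.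
Lemma submodD S : submod S -> forall x y, S x -> S y -> S (x + y). Proof. by case. Qed.
Lemma submodZ S : submod S -> forall r x, S x -> S (r *: x). Proof. by case. Qed.
Lemma submodN S : submod S -> forall x, S x -> S (- x).
Proof. by move=> sS x Sx; rewrite -scaleN1r; apply: submodZ. Qed.
Lemma submodB S : submod S -> forall x y, S x -> S y -> S (x - y).
Proof. by move=> sS x y Sx Sy; apply: submodD => //; apply: submodN. Qed.

Lemma submod_full : submod (@modfull R N). Proof. by []. Qed.
Lemma submod_zero : submod (@modzero R N).
Proof.
split=> // [x y -> ->|r x ->]; rewrite /modzero; first by rewrite addr0.
exact: scaler0.
Qed.

Lemma submod_meet A B : submod A -> submod B -> submod (meet A B).
Proof.
move=> sA sB; split; first by split; apply: submod0.
  by move=> x y [Ax Bx] [Ay By]; split; apply: submodD.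
by move=> r x [Ax Bx]; split; apply: submodZ.
Qed.

Lemma submod_add A B : submod A -> submod B -> submod (modadd A B).
Proof.
move=> sA sB; split.
- by exists 0, 0; rewrite addr0; split=> //; apply: submod0.
- move=> _ _ [a [b [Aa Bb ->]]] [a' [b' [Aa' Bb' ->]]]; exists (a + a'), (b + b').
  by rewrite addrACA; split=> //; apply: submodD.
- move=> r _ [a [b [Aa Bb ->]]]; exists (r *: a), (r *: b).
  by rewrite scalerDr; split=> //; apply: submodZ.
Qed.

Lemma incl_addl A B : submod B -> incl A (modadd A B).
Proof. by move=> sB x Ax; exists x, 0; rewrite addr0; split=> //; apply: submod0. Qed.

Lemma incl_addr A B : submod A -> incl B (modadd A B).
Proof. by move=> sA x Bx; exists 0, x; rewrite add0r; split=> //; apply: submod0. Qed.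

Lemma incl_add A B C : submod C -> incl A C -> incl B C -> incl (modadd A B) C.
Proof. by move=> sC sA sB _ [a [b [/sA Aa /sB Bb ->]]]; apply: submodD. Qed.

Lemma modadd_mono A B A' B' : incl A A' -> incl B B' -> incl (modadd A B) (modadd A' B').
Proof. by move=> sA sB _ [a [b [/sA Aa /sB Bb ->]]]; exists a, b. Qed.

Lemma modaddC A B : modadd A B = modadd B A.
Proof. by apply: pred_ext => _ [a [b [Aa Bb ->]]]; exists b, a; rewrite addrC. Qed.

Lemma modadd_idr A B : submod A -> submod B -> incl A B -> modadd A B = B.
Proof.
by move=> sA sB sAB; apply: pred_ext; [apply: incl_add | apply: incl_addr].
Qed.

Lemma submod_span (G : N -> Prop) : submod (span_mod G).
Proof.
split=> [S sS _|x y Gx Gy S sS GS|r x Gx S sS GS]; first exact: submod0.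
  by apply: submodD => //; [apply: Gx | apply: Gy].
by apply: submodZ => //; apply: Gx.
Qed.

Lemma span_incl (G : N -> Prop) : incl G (span_mod G).
Proof. by move=> x Gx S _; apply. Qed.

Lemma span_sub (G S : N -> Prop) : submod S -> incl G S -> incl (span_mod G) S.
Proof. by move=> sS sGS x; apply. Qed.

Lemma span_mono (G H : N -> Prop) : incl G H -> incl (span_mod G) (span_mod H).
Proof.
move=> sGH; apply: span_sub (submod_span _) _.
by apply: incl_trans sGH _; apply: span_incl.
Qed.

(** By the modular law a strict inclusion cannot become an equality both after intersecting with [B]
    and after adding [B], so each step of the chain survives in one of the two image chains. This is
    the hard half of additivity of length. *)
Lemma chain_meet_add A B C n : submod B -> chain_between submod A C n ->
  exists n1 n2, [/\ (n <= n1 + n2)%N, chain_between submod (meet A B) (meet C B) n1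
    & chain_between submod (modadd A B) (modadd C B) n2].
Proof.
move=> sB; elim: n C => [|n IH] C.
  move=> /chain0 [sA ->]; exists 0%N, 0%N; split=> //.
    by apply: chain_nil; apply: submod_meet.
  by apply: chain_nil; apply: submod_add.
move=> /chainS [D [/[dup] /IH [n1 [n2 [le_n c1 c2]]] cD sC ltDC]].
have sDC : incl D C by case: ltDC.
have sm : incl (meet D B) (meet C B) by move=> x [Dx Bx]; split=> //; apply: sDC.
have sa : incl (modadd D B) (modadd C B) by apply: modadd_mono.
case: (eq_or_strict sm) => [em|stm]; last first.
  have [m le_m cm] := chain_weak c2 (submod_add sC sB) sa.
  exists n1.+1, m; split=> //; last by apply: chain_rcons c1 _ stm; apply: submod_meet.
  by rewrite addSn ltnS; apply: leq_trans le_n _; rewrite leq_add2l.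
exists n1, n2.+1; split; rewrite ?addnS ?ltnS -?em //.
apply: chain_rcons c2 (submod_add sC sB) _; apply: strictP => // sCD.
apply: (strict_nincl ltDC) => c Cc.
have [d [b [Dd Bb e]]] := sCD _ (incl_addl sB Cc).
have : meet C B b.
  split=> //; have -> : b = c - d by rewrite e addrC addKr.
  by apply: submodB => //; apply: sDC.
by rewrite -em => -[Db _]; rewrite e; apply: submodD => //; apply: chain_Subr cD.
Qed.

Lemma finlen_trans A B C : finlen submod A B -> finlen submod B C -> finlen submod A C.
Proof.
move=> fAB fBC; have sAB := finlen_incl fAB; have sBC := finlen_incl fBC.
apply: (@finlen_bounded _ _ _ _ (len submod A B + len submod B C)).
- exact: finlen_Subl fAB.
- exact: finlen_Subr fBC.
- exact: incl_trans sBC.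
have sA := finlen_Subl fAB; have sB := finlen_Subr fAB; have sC := finlen_Subr fBC.
move=> m /(chain_meet_add sB) [n1 [n2 [le_m]]].
rewrite meet_idl // meet_idr // modadd_idr // (modaddC C) modadd_idr // => c1 c2.
by apply: leq_trans le_m _; apply: leq_add; apply: chain_le_len.
Qed.

Lemma len_add A B C : finlen submod A B -> finlen submod B C ->
  len submod A C = (len submod A B + len submod B C)%N.
Proof.
move=> fAB fBC; have fAC := finlen_trans fAB fBC.
have sAB := finlen_incl fAB; have sBC := finlen_incl fBC.
have sA := finlen_Subl fAB; have sB := finlen_Subr fAB; have sC := finlen_Subr fBC.
apply/eqP; rewrite eqn_leq; apply/andP; split; last first.
  exact: chain_le_len fAC (chain_cat (proj1 (lenP fAB)) (proj1 (lenP fBC))).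
have [n1 [n2 [le_m]]] := chain_meet_add sB (proj1 (lenP fAC)).
rewrite meet_idl // meet_idr // modadd_idr // (modaddC C) modadd_idr // => c1 c2.
by apply: leq_trans le_m _; apply: leq_add; apply: chain_le_len.
Qed.

Lemma len_add_le A B C : finlen submod A C -> submod B -> incl A B -> incl B C ->
  [/\ finlen submod A B, finlen submod B C &
    len submod A C = (len submod A B + len submod B C)%N].
Proof.
move=> fAC sB sAB sBC.
have [fAB _] := finlen_sub fAC (finlen_Subl fAC) sB (@incl_refl _ _) sAB sBC.
have [fBC _] := finlen_sub fAC sB (finlen_Subr fAC) sAB sBC (@incl_refl _ _).
by split=> //; apply: len_add.
Qed.

End Submodules.

(** * Lengths along linear maps *)

Section Transport.
Variables (R : comUnitRingType) (N M : lmodType R) (f : {linear N -> M}).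

Definition preimage (B : M -> Prop) : N -> Prop := fun x => B (f x).
Definition image (A : N -> Prop) : M -> Prop := fun y => exists2 x, A x & y = f x.

Lemma submod_preimage B : submod B -> submod (preimage B).
Proof.
move=> sB; split; rewrite /preimage ?linear0; first exact: submod0.
  by move=> x y Bx By; rewrite linearD; apply: submodD.
by move=> r x Bx; rewrite linearZ; apply: submodZ.
Qed.

Lemma submod_image A : submod A -> submod (image A).
Proof.
move=> sA; split.
- by exists 0; rewrite ?linear0 //; apply: submod0.
- by move=> _ _ [x Ax ->] [y Ay ->]; exists (x + y); rewrite ?linearD //; apply: submodD.
- by move=> r _ [x Ax ->]; exists (r *: x); rewrite ?linearZ //; apply: submodZ.
Qed.

Variables (A : N -> Prop) (B : M -> Prop).
Hypotheses (sA : submod A) (sB : submod B).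

(** The isomorphism of A / (A meet f^-1 B) with (f(A) + B) / B, on the level of chains: C goes to
    f(C) + B, and C goes back to A meet f^-1 C. *)
Lemma chain_transport m :
  chain_between (@submod R N) (meet A (preimage B)) A m <->
  chain_between (@submod R M) B (modadd (image A) B) m.
Proof.
have sAB : submod (meet A (preimage B)) by apply/submod_meet/submod_preimage.
have sIB : submod (modadd (image A) B) by apply/submod_add/sB/submod_image.
split=> c.
- have e1 : modadd (image (meet A (preimage B))) B = B.
    apply: pred_ext; last by apply/incl_addr/submod_image.
    by apply: incl_add => // _ [x [_ Bx] ->].
  rewrite -{1}e1.
  apply: (@chain_map _ _ _ _ (fun C => modadd (image C) B)) c => [C sC _ _|C D sC sD sAC ltCD sDA].
    by apply/submod_add/sB/submod_image.
  apply: strictP.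
    apply: modadd_mono => // _ [x Cx ->]; exists x => //.
    by case: ltCD => sCD _; apply: sCD.
  move=> sDC; apply: (strict_nincl ltCD) => d Dd.
  have [|_ [b [[c' Cc ->] Bb e]]] := sDC (f d); first by apply: incl_addl => //; exists d.
  rewrite -(subrK c' d); apply: submodD => //; apply: sAC; split.
    apply: submodB => //; apply: sDA => //; case: ltCD => sCD _; exact: sCD.
  by rewrite /preimage linearB e addrAC subrr add0r.
- have e2 : meet A (preimage (modadd (image A) B)) = A.
    apply: pred_ext => x; first by case.
    by move=> Ax; split=> //; apply: incl_addl => //; exists x.
  rewrite -{2}e2.
  apply: (@chain_map _ _ _ _ (fun C => meet A (preimage C))) c => [C sC _ _|C D sC sD sBC ltCD sDI].
    by apply/submod_meet/submod_preimage.
  case: ltCD => sCD [d [Dd nCd]]; split; first by move=> x [Ax Cx]; split=> //; apply: sCD.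
  have [_ [b [[a Aa ->] Bb e]]] := sDI _ Dd; have Cb := sBC _ Bb.
  exists a; split; last first.
    by case=> _; rewrite /preimage => Cfa; apply: nCd; rewrite e; apply: submodD.
  split=> //; rewrite /preimage; have -> : f a = d - b by rewrite e addrK.
  by apply: submodB => //; apply: sCD.
Qed.

Lemma is_length_transport l :
  is_length (@submod R N) (meet A (preimage B)) A l <->
  is_length (@submod R M) B (modadd (image A) B) l.
Proof.
split=> -[/chain_transport c h]; split=> // m; first by move/chain_transport/h.
by move/chain_transport/h.
Qed.

Lemma len_transport :
  len (@submod R N) (meet A (preimage B)) A = len (@submod R M) B (modadd (image A) B).
Proof.
rewrite /len; congr epsilon; apply: functional_extensionality => l.
by apply: propositional_extensionality; apply: is_length_transport.
Qed.

Lemma finlen_transport :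
  finlen (@submod R N) (meet A (preimage B)) A <->
  finlen (@submod R M) B (modadd (image A) B).
Proof. by split=> -[l /is_length_transport h]; exists l. Qed.

End Transport.

(** * Ideals and Noetherian modules *)

Section Products.
Variables (R : comUnitRingType) (N : lmodType R).
Implicit Types (A B : R -> Prop) (S T : N -> Prop).

Lemma submod_modmul A S : submod (modmul A S).
Proof. exact: submod_span. Qed.

Lemma modmul_in A S a y : A a -> S y -> modmul A S (a *: y).
Proof. by move=> Aa Sy; apply: span_incl; exists a, y. Qed.

Lemma modmul_sub A S T : submod T -> (forall a y, A a -> S y -> T (a *: y)) ->
  incl (modmul A S) T.
Proof. by move=> sT h; apply: span_sub => // _ [a [y [Aa Sy ->]]]; apply: h. Qed.

Lemma ideal_colon S y : submod S -> ideal (fun r => S (r *: y)).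
Proof.
move=> sS; split; first by rewrite scale0r; apply: submod0.
  by move=> a b Sa Sb; rewrite scalerDl; apply: submodD.
by move=> r a Sa; rewrite -scalerA; apply: submodZ.
Qed.

Lemma submod_colon S a : submod S -> submod (fun y => S (a *: y)).
Proof.
move=> sS; split; first by rewrite scaler0; apply: submod0.
  by move=> x y Sx Sy; rewrite scalerDr; apply: submodD.
by move=> r x Sx; rewrite scalerA mulrC -scalerA; apply: submodZ.
Qed.

Lemma ideal_span (G : R -> Prop) : ideal (span_ideal G).
Proof. exact: (@submod_span R R^o). Qed.

Lemma ideal_idmul A B : ideal (idmul A B).
Proof. exact: ideal_span. Qed.

End Products.

Section Ideals.
Variable R : comUnitRingType.
Implicit Types A B C : R -> Prop.

Lemma idmul_sub A B C : ideal C -> (forall a b, A a -> B b -> C (a * b)) ->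
  incl (idmul A B) C.
Proof. exact: (@modmul_sub R R^o). Qed.

Lemma idmul_in A B a b : A a -> B b -> idmul A B (a * b).
Proof. exact: (@modmul_in R R^o). Qed.

Lemma modmulA (N : lmodType R) A B (S : N -> Prop) :
  modmul (idmul A B) S = modmul A (modmul B S).
Proof.
apply: pred_ext.
  apply: modmul_sub; first exact: submod_modmul.
  move=> c y + Sy; move: c; apply: idmul_sub.
    by apply: ideal_colon; apply: submod_modmul.
  by move=> a b Aa Bb; rewrite -scalerA; apply: modmul_in => //; apply: modmul_in.
apply: modmul_sub; first exact: submod_modmul.
move=> a z Aa; move: z; apply: modmul_sub.
  by apply: submod_colon; apply: submod_modmul.
by move=> b y Bb Sy; rewrite scalerA; apply: modmul_in => //; apply: idmul_in.
Qed.

Lemma idmulA A B C : idmul (idmul A B) C = idmul A (idmul B C).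
Proof. exact: (@modmulA R^o). Qed.

Lemma idmulC A B : idmul A B = idmul B A.
Proof.
apply: pred_ext; apply: idmul_sub; try exact: ideal_idmul;
by move=> a b Aa Bb; rewrite mulrC; apply: idmul_in.
Qed.

Lemma modmul1 (N : lmodType R) (S : N -> Prop) : submod S -> modmul (@idfull R) S = S.
Proof.
move=> sS; apply: pred_ext; last by move=> y Sy; rewrite -[y]scale1r; apply: modmul_in.
by apply: modmul_sub => // a y _ Sy; apply: submodZ.
Qed.

Lemma idmul1 A : ideal A -> idmul (@idfull R) A = A.
Proof. exact: (@modmul1 R^o). Qed.

Lemma idmulACA A B C D : idmul (idmul A B) (idmul C D) = idmul (idmul A C) (idmul B D).
Proof. by rewrite (idmulA A B) -(idmulA B C D) (idmulC B C) (idmulA C B D) (idmulA A C). Qed.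

Lemma ideal_full : ideal (@idfull R). Proof. by []. Qed.

Lemma ideal_idpow A n : ideal (idpow A n).
Proof. by case: n => [|n]; [apply: ideal_full | apply: ideal_idmul]. Qed.

Lemma idpowS A n : idpow A n.+1 = idmul A (idpow A n).
Proof. by []. Qed.

Lemma idpowD A m n : idpow A (m + n) = idmul (idpow A m) (idpow A n).
Proof.
elim: m => [|m IH]; first by rewrite idmul1 //; apply: ideal_idpow.
by rewrite addSn !idpowS IH idmulA.
Qed.

Lemma idpow1 A : ideal A -> idpow A 1 = A.
Proof. by move=> iA; rewrite /idpow /= idmulC idmul1. Qed.

Lemma idpow_le A m n : (m <= n)%N -> incl (idpow A n) (idpow A m).
Proof.
move=> le_mn; rewrite -(subnK le_mn) idpowD.
by apply: idmul_sub => [|a b _ Ab]; [apply: ideal_idpow | case: (ideal_idpow A m) => _ _; apply].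
Qed.

Section Idprod.
Variables (e : nat) (Js : 'I_e -> R -> Prop).

(** [idprod] folds over the full enumeration; an arbitrary list of indices is what an induction can
    work on. *)
Definition idprods (s : seq 'I_e) (n : 'I_e -> nat) : R -> Prop :=
  foldr (fun i acc => idmul (idpow (Js i) (n i)) acc) (@idfull R) s.

Lemma idprods_ideal s n : ideal (idprods s n).
Proof. by case: s => [|i s]; [apply: ideal_full | apply: ideal_idmul]. Qed.

Lemma idprodsD s m n :
  idprods s (fun i => m i + n i)%N = idmul (idprods s m) (idprods s n).
Proof.
elim: s => [|i s IH] /=; first by rewrite idmul1 //; apply: ideal_full.
by rewrite IH idpowD idmulACA.
Qed.

Lemma idprods0 s n : (forall i, i \in s -> n i = 0%N) -> idprods s n = @idfull R.
Proof.
elim: s => //= i s IH h; rewrite h ?mem_head // IH; first by rewrite idmul1 //; apply: ideal_full.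
by move=> j js; apply: h; rewrite in_cons js orbT.
Qed.

Lemma idprods_single s n i : uniq s -> i \in s -> (forall j, j != i -> n j = 0%N) ->
  idprods s n = idpow (Js i) (n i).
Proof.
elim: s => //= j s IH /andP [njs us] + hn; rewrite in_cons; case: (eqVneq i j) => [eij _|nij /= is_].
  rewrite -eij idprods0; first by rewrite idmulC idmul1 //; apply: ideal_idpow.
  by move=> k ks; apply: hn; apply: contraNneq njs => eki; rewrite -eij -eki.
by rewrite IH // hn 1?eq_sym // idmul1 //; apply: ideal_idpow.
Qed.

Definition pw (n : 'X_{1..e}) : R -> Prop := idprod Js n.

Lemma ideal_pw n : ideal (pw n).
Proof. exact: idprods_ideal. Qed.

Lemma pwD m n : pw (m + n)%MM = idmul (pw m) (pw n).
Proof.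
rewrite -[RHS]idprodsD /pw /idprod /idprods.
by congr foldr; apply: functional_extensionality => i; rewrite mnmDE.
Qed.

Lemma pw0 : pw 0%MM = @idfull R.
Proof. by apply: idprods0 => i _; rewrite mnm0E. Qed.

Lemma pwUn i k : pw (U_(i) *+ k)%MM = idpow (Js i) k.
Proof.
rewrite /pw -[LHS]/(idprods _ _) (@idprods_single _ _ i) ?enum_uniq ?mem_enum //.
  by rewrite mulmnE mnm1E eqxx mul1n.
by move=> j nji; rewrite mulmnE mnm1E eq_sym (negPf nji).
Qed.

Lemma pwU i : ideal (Js i) -> pw U_(i)%MM = Js i.
Proof. by move=> iJ; rewrite -[U_(i)%MM]mulm1n pwUn idpow1. Qed.

End Idprod.
End Ideals.

(** * Chain conditions, generators and prime filtrations *)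

Section Noetherian.

Definition acc X (Sub : (X -> Prop) -> Prop) :=
  forall F : nat -> X -> Prop, (forall i, Sub (F i)) -> (forall i, incl (F i) (F i.+1)) ->
  exists n, forall m, (n <= m)%N -> incl (F m) (F n).

Lemma incl_mono X (F : nat -> X -> Prop) : (forall i, incl (F i) (F i.+1)) ->
  forall m n, (m <= n)%N -> incl (F m) (F n).
Proof.
move=> h m n le_mn; rewrite -(subnK le_mn).
elim: (n - m)%N => [|k IH] //; apply: incl_trans IH _; exact: h.
Qed.

(** Without a maximal element, dependent choice would build a strictly increasing sequence inside
    [P]. *)
Lemma acc_max X (Sub : (X -> Prop) -> Prop) (P : (X -> Prop) -> Prop) A0 :
  acc Sub -> Sub A0 -> P A0 ->
  exists A, [/\ Sub A, P A & forall B, Sub B -> P B -> incl A B -> B = A].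
Proof.
move=> hacc sA0 pA0; apply: NNPP => nmax.
have nxt (A : {A | Sub A /\ P A}) :
    exists B : {A | Sub A /\ P A}, strict (sval A) (sval B).
  case: A => A [sA pA] /=; apply: NNPP => nB; apply: nmax; exists A; split=> // B sB pB sAB.
  by case: (eq_or_strict sAB) => // ltAB; case: nB; exists (exist _ B (conj sB pB)).
pose g A := proj1_sig (constructive_indefinite_description _ (nxt A)).
have gP A : strict (sval A) (sval (g A)).
  by rewrite /g; case: constructive_indefinite_description.
pose F n := sval (iter n g (exist _ A0 (conj sA0 pA0))).
have [n hn] : exists n, forall m, (n <= m)%N -> incl (F m) (F n).
  apply: hacc => i; first by have [] := proj2_sig (iter i g (exist _ A0 (conj sA0 pA0))).
  by rewrite /F /=; case: (gP (iter i g (exist _ A0 (conj sA0 pA0)))).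
apply: (strict_nincl (gP (iter n g (exist _ A0 (conj sA0 pA0))))).
exact: (hn n.+1).
Qed.

Variables (R : comUnitRingType) (N : lmodType R).
Implicit Types (S T X : N -> Prop) (s : seq N).

Fixpoint spn s : N -> Prop :=
  if s is y :: s' then fun x => exists r z, spn s' z /\ x = r *: y + z else @modzero R N.

Lemma submod_spn s : submod (spn s).
Proof.
elim: s => [|y s IH] /=; first exact: submod_zero.
split.
- by exists 0, 0; rewrite scale0r addr0; split=> //; apply: submod0.
- move=> _ _ [r [z [sz ->]]] [r' [z' [sz' ->]]]; exists (r + r'), (z + z').
  by rewrite scalerDl addrACA; split=> //; apply: submodD.
- move=> c _ [r [z [sz ->]]]; exists (c * r), (c *: z).
  by rewrite scalerDr scalerA; split=> //; apply: submodZ.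
Qed.

Lemma spn_mem s x : x \in s -> spn s x.
Proof.
elim: s => //= y s IH; rewrite in_cons => /orP [/eqP ->|/IH sx].
  by exists 1, 0; rewrite scale1r addr0; split=> //; apply: submod0 (submod_spn s).
by exists 0, x; rewrite scale0r add0r.
Qed.

Lemma spn_sub s S : submod S -> (forall x, x \in s -> S x) -> incl (spn s) S.
Proof.
move=> sS; elim: s => [|y s IH] h x /=; first by move=> ->; apply: submod0.
move=> [r [z [/IH Sz ->]]]; apply: submodD => //.
  by apply: submodZ => //; apply: h; rewrite mem_head.
by apply: Sz => w ws; apply: h; rewrite in_cons ws orbT.
Qed.

Lemma fin_gen_spn : fin_gen N -> exists s, forall x, spn s x.
Proof.
case=> s hs; exists s => x; have [c ->] := hs x.
elim: s c {hs} => [|y s IH] c /=; first by rewrite big_ord0.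
rewrite big_ord_recl; exists (c 0%N), (\sum_(i < size s) c i.+1 *: s`_i).
by split; [exact: (IH (fun n => c n.+1)) | ].
Qed.

Hypothesis Rnoeth : noetherian R.

(** Induction on the generators: a chain stabilizes as soon as its intersections with the span of
    the tail and its ideals of coefficients at [y] both do. *)
Lemma acc_spn s : acc (fun S : N -> Prop => submod S /\ incl S (spn s)).
Proof.
elim: s => [|y s IH] F FS Fm.
  exists 0%N => m _ x Fx; have [_ /(_ x Fx) ->] := FS m.
  by have [sF _] := FS 0%N; apply: submod0.
have FM := incl_mono Fm.
have [n1 h1] : exists n, forall m, (n <= m)%N -> incl (meet (F m) (spn s)) (meet (F n) (spn s)).
  apply: IH => i; first by split; [apply: submod_meet; [case: (FS i)|apply: submod_spn] | move=> x []].
  by move=> x [Fx sx]; split=> //; apply: Fm.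
pose a i r := exists z, spn s z /\ F i (r *: y + z).
have [n2 h2] : exists n, forall m, (n <= m)%N -> incl (a m) (a n).
  apply: Rnoeth => i; last by move=> r [z [sz Fz]]; exists z; split=> //; apply: Fm.
  have [sF _] := FS i; have ss := submod_spn s; split.
  - by exists 0; rewrite scale0r addr0; split; apply: submod0.
  - move=> r r' [z [sz Fz]] [z' [sz' Fz']]; exists (z + z').
    by rewrite scalerDl addrACA; split; apply: submodD.
  - move=> c r [z [sz Fz]]; exists (c *: z).
    by rewrite -scalerA -scalerDr; split; apply: submodZ.
exists (maxn n1 n2) => m; rewrite geq_max => /andP [le1 le2] x Fx.
have [sFm /(_ x Fx) /= [r [z [sz ex]]]] := FS m.
have [z' [sz' Fz']] : a n2 r by apply: (h2 m) => //; exists z; rewrite -ex.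
have Fz : F (maxn n1 n2) (r *: y + z') by apply: FM Fz'; apply: leq_maxr.
have [sFn _] := FS (maxn n1 n2).
have -> : x = (r *: y + z') + (z - z') by rewrite ex addrACA subrr addr0.
apply: submodD => //; apply: (FM n1); first exact: leq_maxl.
have [] // : meet (F n1) (spn s) (z - z').
apply: (h1 m le1); split; last by apply: submodB => //; apply: submod_spn.
have -> : z - z' = x - (r *: y + z') by rewrite ex opprD addrACA subrr add0r.
by apply: submodB => //; apply: FM Fz'.
Qed.

Hypothesis Nfg : fin_gen N.

Lemma acc_mod : acc (@submod R N).
Proof.
have [s hs] := fin_gen_spn Nfg => F FS Fm.
by apply: (@acc_spn s) => // i; split.
Qed.

Lemma submod_fg S : submod S -> exists2 s, (forall x, x \in s -> S x) & S = spn s.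
Proof.
move=> sS.
have [//|B [sB [s sS' eB] Bmax]] := @acc_max _ (@submod R N)
    (fun B => exists2 s, (forall x, x \in s -> S x) & B = spn s) _ acc_mod (@submod_zero R N).
  by exists [::].
exists s => //; rewrite -eB; apply: pred_ext; last by rewrite eB; apply: spn_sub.
move=> x Sx; rewrite -(Bmax (spn (x :: s))).
- by apply: spn_mem; rewrite mem_head.
- exact: submod_spn.
- by exists (x :: s) => // z; rewrite in_cons => /orP [/eqP ->|/sS'].
- by rewrite eB => z sz; exists 0, z; rewrite scale0r add0r.
Qed.

Definition colon S y : R -> Prop := fun r => S (r *: y).

(** A colon ideal (S : y) that is maximal among those with [y] in [X] outside [S] is prime: if [a]
    is not in it, then (S : a y) contains it and so equals it. *)
Lemma assoc_prime S X : submod S -> submod X -> strict S X ->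
  exists y, [/\ X y, ~ S y & prime_ideal (colon S y)].
Proof.
move=> sS sX [sSX [x [Xx nSx]]].
have [||A [iA [y [Xy nSy eA]] Amax]] := @acc_max _ (@ideal R)
    (fun A => exists y, [/\ X y, ~ S y & A = colon S y]) (colon S x) Rnoeth.
- exact: ideal_colon.
- by exists x.
exists y; split=> //; split; first exact: ideal_colon.
  by rewrite /colon scale1r.
move=> a b pab; case: (classic (colon S y a)) => [|npa]; [by left|right].
have eB : colon S (a *: y) = A.
  apply: Amax; [exact: ideal_colon | by exists (a *: y); split=> //; apply: submodZ |].
  by rewrite eA /colon => r Sr; rewrite scalerA mulrC -scalerA; apply: submodZ.
by rewrite -eA -eB /colon scalerA mulrC.
Qed.

Definition line (y : N) (r : R^o) : N := r *: y.

Lemma line_is_linear y : linear (line y).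
Proof. by move=> a r s; rewrite /line scalerDl scalerA. Qed.

HB.instance Definition _ (y : N) := GRing.isLinear.Build R R^o N _ (line y) (line_is_linear y).

Definition adj S y : N -> Prop := modadd (image (line y) (@modfull R R^o)) S.

Lemma submod_adj S y : submod S -> submod (adj S y).
Proof. by move=> sS; apply: submod_add => //; apply: submod_image. Qed.

Lemma adj_incl S y : incl S (adj S y).
Proof. by apply: incl_addr; apply: submod_image. Qed.

Lemma adj_mem S y : submod S -> adj S y y.
Proof. by move=> sS; apply: incl_addl => //; exists 1 => //; apply: (esym (scale1r y)). Qed.

Lemma adj_sub S y X : submod X -> incl S X -> X y -> incl (adj S y) X.
Proof. by move=> sX sSX Xy; apply: incl_add => // _ [r _ ->]; apply: submodZ. Qed.

(** The map [line y] identifies [adj S y] / S with R / (S : y), so this is a prime filtration of N /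
    S recorded by its successive generators. *)
Fixpoint pfilt S (ys : seq N) : Prop :=
  if ys is y :: ys' then prime_ideal (colon S y) /\ pfilt (adj S y) ys' else S = @modfull R N.

Lemma pfilt_exists S : submod S -> exists ys, pfilt S ys.
Proof.
move=> sS; apply: NNPP => nS.
have [A [sA nA Amax]] := @acc_max _ (@submod R N) (fun S => ~ exists ys, pfilt S ys) S acc_mod sS nS.
have [e|ltA] := @eq_or_strict _ A (@modfull R N) (fun _ _ => I).
  by apply: nA; exists [::].
have [y [_ nAy py]] := assoc_prime sA (@submod_full R N) ltA.
have [[ys hys]|nadj] := classic (exists ys, pfilt (adj A y) ys).
  by apply: nA; exists (y :: ys).
by apply: nAy; rewrite -(Amax _ _ nadj (@adj_incl A y)); [apply: adj_mem | apply: submod_adj].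
Qed.

End Noetherian.

(** * Finite length over the local ring *)

Section Local.
Variables (R : comUnitRingType) (mm J : R -> Prop).
Hypotheses (Rnoeth : noetherian R) (Hloc : local_with mm) (HJ : primary_to mm J).

Lemma prime_pow (p : R -> Prop) x n : prime_ideal p -> p (x ^+ n) -> p x.
Proof.
case=> [_ np1 pM]; elim: n => [|n IH]; first by rewrite expr0.
by rewrite exprS => /pM [].
Qed.

Lemma proper_sub_mm A : ideal A -> ~ A 1 -> incl A mm.
Proof.
case: Hloc => _ _ hu [_ _ AZ] nA1 x Ax; apply: NNPP => /hu ux; apply: nA1.
by rewrite -(mulVr ux); apply: AZ.
Qed.

Lemma prime_mm : prime_ideal mm.
Proof.
case: Hloc => im nm1 hu; split=> // a b mab.
case: (classic (mm a)) => [|/hu ua]; [by left|right].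
by rewrite -(mulKr ua b); case: im => _ _; apply.
Qed.

Lemma prime_over_J p : prime_ideal p -> incl J p -> p = mm.
Proof.
move=> pp sJp; apply: pred_ext; first by case: (pp) => ip np1 _; apply: proper_sub_mm.
move=> x mx; case: HJ => _ /(_ x) [_ /(_ mx) [n /sJp]].
exact: prime_pow.
Qed.

Lemma prime_idmul (p A B : R -> Prop) : prime_ideal p -> incl (idmul A B) p -> incl A p \/ incl B p.
Proof.
case=> ip _ pM sAB; case: (classic (incl A p)) => [|nA]; [by left|right] => b Bb.
apply: NNPP => npb; apply: nA => a Aa.
by case: (pM a b) => //; apply: sAB; apply: idmul_in.
Qed.

Lemma prime_idpow (p A : R -> Prop) n : prime_ideal p -> incl (idpow A n) p -> incl A p.
Proof.
move=> pp; elim: n => [/(_ 1 I)|n IH]; first by case: pp => _ np1 _ /np1.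
by move=> /(prime_idmul pp) [].
Qed.

Lemma finlen_mm : finlen (@submod R R^o) mm (@modfull R R^o).
Proof.
case: Hloc => im nm1 hu; apply: (@finlen_bounded _ _ _ _ 1) => //.
case=> [|[|m]] // /chainS [B [/chainS [C [cC sB [_ [x [Bx nCx]]]]] _ ltB]].
case: (strict_nincl ltB) => y _.
have /hu ux : ~ mm x by move=> mx; apply: nCx; apply: (chain_incl cC).
by rewrite -[y]mulr1 -(mulVr ux) mulrA; apply: (submodZ sB (y * x^-1)).
Qed.

Variable (N : lmodType R).
Hypothesis Nfg : fin_gen N.

(** Noetherian induction: for a maximal counterexample A, an associated prime of X / A contains a
    power of J, so it is [mm], and adjoining the corresponding element adds a copy of the residue
    field. *)
Lemma finlen_killed (S X : N -> Prop) k : submod S -> submod X -> incl S X ->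
  (forall a x, idpow J k a -> X x -> S (a *: x)) -> finlen (@submod R N) S X.
Proof.
move=> sS sX sSX hk; apply: NNPP => nfin.
pose P S := [/\ incl S X, forall a x, idpow J k a -> X x -> S (a *: x) & ~ finlen (@submod R N) S X].
have [//|A [sA [sAX hA nA] Amax]] := @acc_max _ (@submod R N) P S (acc_mod Rnoeth Nfg) sS.
have [e|ltA] := eq_or_strict sAX; first by apply: nA; rewrite -e; exists 0%N; apply: is_length_refl.
have [y [Xy nAy py]] := assoc_prime Rnoeth sA sX ltA.
have ey : colon A y = mm.
  apply: prime_over_J => //; apply: (@prime_idpow _ _ k py) => a Ja; exact: hA.
have f1 : finlen (@submod R N) A (adj A y).
  apply/finlen_transport => //.
  rewrite meet_idr // -[preimage _ _]/(colon A y) ey; exact: finlen_mm.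
have [f2|nf2] := classic (finlen (@submod R N) (adj A y) X).
  by apply: nA; apply: finlen_trans f2.
apply: nAy; rewrite -(Amax (adj A y)); [exact: adj_mem | exact: submod_adj | | exact: adj_incl].
split=> //; first exact: adj_sub.
by move=> a x Ja Xx; apply: adj_incl; apply: hA.
Qed.

End Local.

(** * Artin-Rees for multi-Rees modules *)

Lemma fin_gen_regular (R : comUnitRingType) : fin_gen R^o.
Proof. by exists [:: 1] => y; exists (fun _ => y); rewrite big_ord1 /=; rewrite -[LHS]mulr1. Qed.

Lemma addmAC e (u v w : 'X_{1..e}) : (u + v + w = u + w + v)%MM.
Proof. by rewrite -!addmA (addmC v). Qed.

Section Graded.
Variables (R : comUnitRingType) (N : lmodType R) (e : nat).
Local Notation idx := 'X_{1..e}.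
Local Notation fam := (idx -> N -> Prop).
Implicit Types (A B F M : fam) (S : N -> Prop) (n m u v : idx) (xs : seq ('I_e * R)).
Local Notation submod := (@submod R N).

Definition subfam F := forall n, submod (F n).
Definition lef A B := forall n, incl (A n) (B n).
Definition stable xs F :=
  forall ix, ix \in xs -> forall n y, F n y -> F (n + U_(ix.1))%MM (ix.2 *: y).
Definition gfam xs B A F := [/\ subfam F, stable xs F, lef B F & lef F A].
(** With one variable for each pair (i, x) of [xs], acting as multiplication by x in degree [U_(i)],
    this says that A / B is a Noetherian graded module. The lower family is a parameter because the
    Hilbert-Serre induction replaces it by one that defines a cokernel. *)
Definition gacc xs B A := forall F : nat -> fam, (forall k, gfam xs B A (F k)) ->
  (forall k, lef (F k) (F k.+1)) -> exists k0, forall k, (k0 <= k)%N -> lef (F k) (F k0).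

Lemma lef_mono (F : nat -> fam) : (forall k, lef (F k) (F k.+1)) ->
  forall k l, (k <= l)%N -> lef (F k) (F l).
Proof. by move=> h j l le_jl k; apply: (incl_mono (F := fun j => F j k)) => // t; apply: h. Qed.

Section HilbertBasis.
Variables (S : N -> Prop) (i : 'I_e) (x : R) (xs : seq ('I_e * R)) (A : fam).
Hypotheses (sS : submod S) (sA : subfam A) (stA : stable xs A).
Hypothesis (SA : forall n, incl S (A n)).
Hypothesis (accA : gacc xs (fun _ => S) A).

(* The part of A[X] of X-degree j; its degree n component is zero unless [n i >= j]. *)
Definition Tm (j : nat) n (z : N) :=
  exists2 a, z = x ^+ j *: a & a = 0 \/ exists2 m, n = (m + U_(i) *+ j)%MM & A m a.

(** Values at X = x of polynomials over [A] of X-degree below j, together with S. *)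
Fixpoint Low (j : nat) n : N -> Prop :=
  if j is j'.+1 then modadd (Low j' n) (Tm j' n) else S.

Lemma submod_Tm j n : submod (Tm j n).
Proof.
split.
- by exists 0; [rewrite scaler0 | left].
- move=> _ _ [a -> ha] [b -> hb]; exists (a + b); first by rewrite scalerDr.
  case: ha => [->|[m en Aa]]; first by rewrite add0r.
  case: hb => [->|[m' em Ab]]; first by rewrite addr0; right; exists m.
  rewrite en in em; rewrite -(@addIm _ _ _ _ em) in Ab.
  by right; exists m => //; apply: submodD.
- move=> r _ [a -> ha]; exists (r *: a); first by rewrite !scalerA mulrC.
  case: ha => [->|[m -> Aa]]; [by left; rewrite scaler0 | right; exists m => //].
  by apply: submodZ.
Qed.

Lemma submod_Low j n : submod (Low j n).
Proof. by elim: j => //= j IH; apply: submod_add => //; apply: submod_Tm. Qed.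

Lemma Low_incl j n : incl S (Low j n).
Proof.
elim: j => //= j IH; apply: incl_trans IH _; apply: incl_addl; exact: submod_Tm.
Qed.

Lemma Low_step j n : incl (Low j n) (Low j.+1 n).
Proof. by apply: incl_addl; apply: submod_Tm. Qed.

Lemma Low_le j k n : (j <= k)%N -> incl (Low j n) (Low k n).
Proof. by apply: (incl_mono (F := fun j => Low j n)) => // l; apply: Low_step. Qed.

Lemma Low_shift j n b : Low j n b -> Low j.+1 (n + U_(i))%MM (x *: b).
Proof.
elim: j n b => [|j IH] n b; first by move=> Sb; apply: Low_incl; apply: submodZ.
case=> b' [_ [/IH Lb' [a -> ha] ->]]; rewrite scalerDr.
exists (x *: b'), (x *: (x ^+ j *: a)); split=> //.
exists a; first by rewrite scalerA exprS.
case: ha => [->|[m -> Aa]]; [by left | right; exists m => //].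
by rewrite mulmSr addmA.
Qed.

Lemma stable_Low j : stable xs (fun n => Low j n).
Proof.
move=> kt kt_xs; elim: j => [|j IH] n y; first by move=> Sy; apply: submodZ.
case=> b [_ [/IH Lb [a -> ha] ->]]; rewrite scalerDr.
exists (kt.2 *: b), (kt.2 *: (x ^+ j *: a)); split=> //.
exists (kt.2 *: a); first by rewrite !scalerA mulrC.
case: ha => [->|[m -> Aa]]; [by left; rewrite scaler0 | right].
exists (m + U_(kt.1))%MM; last exact: stA.
by rewrite -!addmA (addmC U_(kt.1)%MM).
Qed.

Definition adjoin n y := exists j, Low j n y.

Lemma subfam_adjoin : subfam adjoin.
Proof.
move=> n; split; first by exists 0%N; apply: submod0.
  move=> y z [j Ly] [k Lz]; exists (maxn j k); apply: submodD; first exact: submod_Low.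
    by apply: Low_le Ly; apply: leq_maxl.
  by apply: Low_le Lz; apply: leq_maxr.
by move=> r y [j Ly]; exists j; apply: submodZ => //; apply: submod_Low.
Qed.

Lemma stable_adjoin : stable ((i, x) :: xs) adjoin.
Proof.
move=> kt; rewrite in_cons => /orP [/eqP -> |kt_xs] n y [j Ly].
  by exists j.+1; apply: Low_shift.
by exists j; apply: stable_Low.
Qed.

Lemma adjoin_incl n : incl S (adjoin n).
Proof. by move=> y Sy; exists 0%N. Qed.

Lemma adjoin_base n : incl (A n) (adjoin n).
Proof.
move=> y Ay; exists 1%N => /=; apply: incl_addr => //.
by exists y; [rewrite expr0 scale1r | right; exists n; rewrite // mulm0n addm0].
Qed.

(** Leading coefficients in X-degree j, as in Hilbert's basis theorem. Values at x do not determine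
    a polynomial, so the lower terms are only required to exist in [Low]. *)
Definition lead (j : nat) F n y :=
  A n y /\ exists2 b, Low j (n + U_(i) *+ j)%MM b & F (n + U_(i) *+ j)%MM (x ^+ j *: y + b).

Lemma gfam_lead j F : gfam ((i, x) :: xs) (fun _ => S) adjoin F ->
  gfam xs (fun _ => S) A (lead j F).
Proof.
case=> sF stF SF FA; split.
- move=> n; split.
  + split; first exact: submod0; exists 0; first by apply: submod0; apply: submod_Low.
    by rewrite scaler0 addr0; apply: submod0.
  + move=> y z [Ay [b Lb Fb]] [Az [c Lc Fc]]; split; first exact: submodD.
    exists (b + c); first by apply: submodD => //; apply: submod_Low.
    by rewrite scalerDr addrACA; apply: submodD.
  + move=> r y [Ay [b Lb Fb]]; split; first exact: submodZ.
    exists (r *: b); first by apply: submodZ => //; apply: submod_Low.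
    by rewrite scalerA mulrC -scalerA -scalerDr; apply: submodZ.
- move=> kt kt_xs n y [Ay [b Lb Fb]]; split; first exact: stA.
  have -> : (n + U_(kt.1) + U_(i) *+ j = n + U_(i) *+ j + U_(kt.1))%MM.
    by rewrite -!addmA (addmC U_(kt.1)%MM).
  exists (kt.2 *: b); first exact: stable_Low.
  rewrite scalerA mulrC -scalerA -scalerDr; apply: stF => //.
  by rewrite in_cons kt_xs orbT.
- move=> n y Sy; split; first exact: SA.
  exists 0; first by apply: submod0; apply: submod_Low.
  by rewrite addr0; apply: SF; apply: submodZ.
- by move=> n y [].
Qed.

Lemma lead_step j F : stable ((i, x) :: xs) F -> lef (lead j F) (lead j.+1 F).
Proof.
move=> stF n y [Ay [b Lb Fb]]; split=> //; rewrite mulmSr addmA.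
exists (x *: b); first exact: Low_shift.
by rewrite exprS -scalerA -scalerDr; apply: (stF (i, x)); rewrite ?mem_head.
Qed.

Lemma lead_mono j F G : lef F G -> lef (lead j F) (lead j G).
Proof. by move=> sFG n y [Ay [b Lb Fb]]; split=> //; exists b => //; apply: sFG. Qed.

(** Induction on the X-degree: an element of G shares its leading coefficient with an element of F,
    and the difference of the two lies in G with smaller degree. *)
Lemma lead_inj F G : gfam ((i, x) :: xs) (fun _ => S) adjoin F ->
  gfam ((i, x) :: xs) (fun _ => S) adjoin G ->
  lef F G -> (forall j, lef (lead j G) (lead j F)) -> lef G F.
Proof.
move=> [sF stF SF FA] [sG stG SG GA] sFG hl n y Gy.
have [j Ly] := GA n y Gy; elim: j y Gy Ly => [|j IH] y Gy; first exact: SF.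
case=> b [_ [Lb [a -> ha] ey]].
case: ha => [a0|[m em Aa]].
  by apply: IH => //; rewrite ey a0 scaler0 addr0.
have [|_ [c Lc Fc]] := hl j m a.
  by split=> //; exists b; rewrite -em // addrC -ey.
rewrite -em in Lc Fc.
have -> : y = (x ^+ j *: a + c) + (b - c) by rewrite ey addrACA subrr addr0 addrC.
apply: submodD => //; apply: IH; last by apply: submodB => //; apply: submod_Low.
have -> : b - c = y - (x ^+ j *: a + c) by rewrite ey (addrC b (x ^+ j *: a)) opprD addrACA subrr add0r.
by apply: submodB => //; apply: sFG.
Qed.

Lemma gacc_adjoin : gacc ((i, x) :: xs) (fun _ => S) adjoin.
Proof.
move=> F gF Fm; have FM := lef_mono Fm.
have stF k : stable ((i, x) :: xs) (F k) by case: (gF k).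
(* Diagonal sequence: raising the X-degree together with the index settles all large degrees at once
   and leaves only finitely many degrees below [k0], which [K] takes care of. *)
have [k0 h0] : exists k0, forall k, (k0 <= k)%N -> lef (lead k (F k)) (lead k0 (F k0)).
  apply: accA => k; first exact: gfam_lead.
  by move=> n; apply: incl_trans (lead_step (stF k) (n := n)) _; apply: lead_mono.
have [K hK] : exists K, forall j, (j < k0)%N -> forall k, (K <= k)%N ->
    lef (lead j (F k)) (lead j (F K)).
  elim: {h0} k0 => [|j [K hK]]; first by exists 0%N.
  have [K' hK'] : exists K, forall k, (K <= k)%N -> lef (lead j (F k)) (lead j (F K)).
    by apply: accA => k; [apply: gfam_lead | apply: lead_mono].
  exists (maxn K K') => l; rewrite ltnS leq_eqVlt => lj k.
  rewrite geq_max => /andP [leK leK'] n; case/orP: lj => [/eqP ->|lj].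
    apply: incl_trans (hK' k leK' n) _; apply: lead_mono; apply: FM; exact: leq_maxr.
  apply: incl_trans (hK l lj k leK n) _; apply: lead_mono; apply: FM; exact: leq_maxl.
exists (maxn k0 K) => k; rewrite geq_max => /andP [le0 leK].
apply: lead_inj => //; first by apply: FM; rewrite geq_max le0 leK.
move=> j; case: (ltnP j k0) => hj n.
  by apply: incl_trans (hK j hj k leK n) _; apply: lead_mono; apply: FM; apply: leq_maxr.
have lead_le l l' G : stable ((i, x) :: xs) G -> (l <= l')%N -> incl (lead l G n) (lead l' G n).
  by move=> stG; apply: (incl_mono (F := fun j => lead j G n)) => // t; apply: lead_step.
(* For j >= k0: climb to the diagonal index max(j, k), fall back to [k0] by stability of the
   diagonal, then climb to j. *)
apply: (@incl_trans _ _ (lead (maxn j k) (F (maxn j k)) n)).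
  apply: incl_trans (lead_le j (maxn j k) _ (stF k) (leq_maxl _ _)) _.
  by apply: lead_mono; apply: FM; apply: leq_maxr.
apply: incl_trans (h0 _ _ n) _; first by apply: leq_trans (leq_maxl _ _).
apply: incl_trans (lead_le k0 j _ (stF k0) hj) _.
by apply: lead_mono; apply: FM; apply: leq_maxl.
Qed.

End HilbertBasis.

Section Ambient.
Variable S : N -> Prop.
Hypothesis sS : submod S.

(** Starts from N in degree 0 and S elsewhere, then adjoins the elements of [xs] one by one. When
    [xs] generates the ideals, the result contains every [PN S n], so its chain condition passes to
    the families of interest. *)
Fixpoint ambient xs : fam :=
  if xs is (i, x) :: xs' then adjoin S i x (ambient xs')
  else fun n y => n = 0%MM \/ S y.

Lemma ambientP xs : [/\ subfam (ambient xs), stable xs (ambient xs),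
  forall n, incl S (ambient xs n) & forall y, ambient xs 0%MM y].
Proof.
elim: xs => [|[i x] xs [sA stA SA A0]] /=.
  split=> // [n|n y Sy|y]; [|by right|by left].
  split; first by right; apply: submod0.
    by move=> y z [->|Sy] [e0|Sz]; try (by left); right; apply: submodD.
  by move=> r y [->|Sy]; [left | right; apply: submodZ].
split.
- exact: subfam_adjoin.
- exact: stable_adjoin.
- exact: adjoin_incl.
- by move=> y; apply: adjoin_base.
Qed.

Hypothesis accN : acc submod.

Lemma gacc_ambient xs : gacc xs (fun _ => S) (ambient xs).
Proof.
elim: xs => [|[i x] xs IH] /=.
  move=> F gF Fm; have [k0 h0] : exists k0, forall k, (k0 <= k)%N -> incl (F k 0%MM) (F k0 0%MM).
    by apply: accN => k; [case: (gF k) | apply: Fm].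
  exists k0 => k le_k n y Fy; have [_ _ SF _] := gF k0.
  have [_ _ _ /(_ n y Fy) [e0|Sy]] := gF k; last exact: SF.
  by rewrite e0; apply: (h0 k le_k); rewrite -e0.
have [sA stA SA A0] := ambientP xs; exact: gacc_adjoin.
Qed.

End Ambient.

Section ArtinRees.
Variables (Js : 'I_e -> R -> Prop).
Hypothesis iJs : forall i, ideal (Js i).

Definition jstable F := forall i r n y, Js i r -> F n y -> F (n + U_(i))%MM (r *: y).
Definition generates xs := (forall i r, (i, r) \in xs -> Js i r) /\
  forall i, incl (Js i) (span_ideal (fun r => (i, r) \in xs)).

Lemma jstable_gens xs F : generates xs -> subfam F -> (jstable F <-> stable xs F).
Proof.
move=> [gJ Jg] sF; split=> [jF [i r] ir n y /= Fy|stF i r n y Jr Fy]; first by apply: jF => //; apply: gJ.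
apply: (Jg i r Jr (fun t => F (n + U_(i))%MM (t *: y))).
  by apply: ideal_colon; apply: sF.
by move=> {Jr}r ir; apply: (stF (i, r)).
Qed.

Lemma pw_jstable F u v r y : subfam F -> jstable F -> pw Js u r -> F v y -> F (u + v)%MM (r *: y).
Proof.
move=> sF jF; have idF n z : ideal (fun r => F n (r *: z)) by apply: ideal_colon; apply: sF.
have pwF i k : forall v y r, F v y -> idpow (Js i) k r -> F (U_(i) *+ k + v)%MM (r *: y).
  elim: k => [|k IH] v' y' r' Fy; first by move=> _; rewrite mulm0n add0m; apply: submodZ.
  rewrite idpowS; move: r'; apply: idmul_sub => // a b Ja Jb.
  rewrite -scalerA mulmSr addmAC; apply: jF => //; exact: IH.
suff H s : forall v y r, F v y -> idprods Js s u r ->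
    F ((\sum_(i <- s) U_(i) *+ u i) + v)%MM (r *: y).
  by move=> pr Fy; rewrite {1}(multinomUE_id u) -big_enum; apply: H.
elim: s => [|i s IH] v' y' r' Fy /=.
  by move=> _; rewrite big_nil add0m; apply: submodZ.
move: r'; apply: idmul_sub => // a b Ja Jb.
rewrite -scalerA big_cons -addmA; apply: pwF Ja; exact: IH.
Qed.

(** The degree n component of the multi-Rees module of N / S, represented by its preimage in N. *)
Definition PN S n := modadd (modmul (pw Js n) (@modfull R N)) S.

Lemma submod_PN S n : submod S -> submod (PN S n).
Proof. by move=> sS; apply: submod_add => //; apply: submod_modmul. Qed.

Lemma PN_incl S n : incl S (PN S n).
Proof. by apply: incl_addr; apply: submod_modmul. Qed.

Lemma PN_in S n r y : submod S -> pw Js n r -> PN S n (r *: y).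
Proof. by move=> sS pr; apply: incl_addl => //; apply: modmul_in. Qed.

Lemma PN_sub S n X : submod X -> incl S X -> (forall r y, pw Js n r -> X (r *: y)) ->
  incl (PN S n) X.
Proof. by move=> sX sSX h; apply: incl_add => //; apply: modmul_sub => // r y pr _; apply: h. Qed.

Lemma jstable_PN S : submod S -> jstable (PN S).
Proof.
move=> sS i r n y Jr; move: y; apply: PN_sub.
- by apply: submod_colon; apply: submod_PN.
- by move=> y Sy; apply: PN_incl; apply: submodZ.
- move=> a y pa; rewrite scalerA; apply: PN_in => //.
  by rewrite addmC pwD; apply: idmul_in => //; rewrite pwU.
Qed.

Lemma pw_le m n : (m <= n)%MM -> incl (pw Js n) (pw Js m).
Proof.
move=> le_mn; rewrite -(submK le_mn) pwD; apply: idmul_sub; first exact: ideal_pw.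
by move=> a b _ pb; case: (ideal_pw Js m) => _ _; apply.
Qed.

Lemma PN_le S m n : submod S -> (m <= n)%MM -> incl (PN S n) (PN S m).
Proof.
move=> sS le_mn; apply: PN_sub; [exact: submod_PN | exact: PN_incl |].
by move=> r y /(pw_le le_mn) pr; apply: PN_in.
Qed.

Lemma gens_exists : noetherian R -> exists xs, generates xs.
Proof.
move=> Rn; have fgR := fin_gen_regular R.
have h i : exists s : seq R, (forall y, y \in s -> Js i y) /\ Js i = @spn R R^o s.
  by have [|s hs e1] := @submod_fg R R^o Rn fgR (Js i); [apply: iJs | exists s].
pose s i := proj1_sig (constructive_indefinite_description _ (h i)).
have sP i : (forall y, y \in s i -> Js i y) /\ Js i = @spn R R^o (s i).
  by rewrite /s; case: constructive_indefinite_description.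
exists (flatten [seq [seq (i, r) | r <- s i] | i <- enum 'I_e]); split.
  by move=> i r /flatten_mapP [j _ /mapP [t ts [-> ->]]]; apply: (sP j).1.
move=> i r; have [_ ->] := sP i; apply: (@spn_sub R R^o); first exact: ideal_span.
move=> y ys; apply: (@span_incl R R^o) => /=.
by apply/flatten_mapP; exists i; [rewrite mem_enum | apply/mapP; exists y].
Qed.

Section Gen.
Variables (S : N -> Prop) (M : fam).
Hypotheses (sS : submod S) (sM : subfam M) (jM : jstable M).
Hypotheses (SM : forall n, incl S (M n)) (MP : lef M (PN S)).

(** The subfamily generated by the components of M of total degree at most k. These increase and
    exhaust M, so their stabilization bounds the degrees of generators. *)
Definition truncated_gen (k : nat) n := modadd (span_mod (fun z => exists u m a r,
  [/\ n = (u + m)%MM, (mdeg m <= k)%N, pw Js u r, M m a & z = r *: a])) S.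

Lemma subfam_gen k : subfam (truncated_gen k).
Proof. by move=> n; apply: submod_add => //; apply: submod_span. Qed.

Lemma jstable_gen k : jstable (truncated_gen k).
Proof.
move=> i r n y Jr; move: y; apply: incl_add.
- by apply: submod_colon; apply: subfam_gen.
- apply: span_sub; first by apply: submod_colon; apply: subfam_gen.
  move=> _ [u [m [a [t [-> dm pt Ma ->]]]]]; apply: incl_addl => //; apply: span_incl.
  exists (u + U_(i))%MM, m, a, (r * t); rewrite scalerA addmAC; split=> //.
  by rewrite addmC pwD; apply: idmul_in => //; rewrite pwU.
- move=> y Sy; apply: incl_addr; [exact: submod_span | exact: submodZ].
Qed.

Lemma gen_incl k : lef (truncated_gen k) M.
Proof.
move=> n; apply: incl_add => //; apply: span_sub => //.
by move=> _ [u [m [a [r [-> _ pr Ma ->]]]]]; apply: pw_jstable.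
Qed.

(** The constant is a degree bound for generators of M. A generator of degree m has m i <= c <= v i
    wherever u i is nonzero, so its ideal coefficient has exponent at least u, and I^u splits off.
    Leaving v i free when u i = 0 lets a single direction be treated alone. *)
Lemma artin_rees : noetherian R -> fin_gen N ->
  exists c, forall u v, (forall i, u i = 0%N \/ (c <= v i)%N) ->
    incl (M (u + v)%MM) (modadd (modmul (pw Js u) (M v)) S).
Proof.
move=> Rn Nfg; have [xs gxs] := gens_exists Rn.
have [sA stA SA A0] := ambientP sS xs.
have jA : jstable (ambient S xs) by apply/(jstable_gens gxs).
have PA : lef (PN S) (ambient S xs).
  by move=> n; apply: PN_sub => // r y pr; rewrite -[n]addm0; apply: pw_jstable.
have [k0 h0] : exists k0, forall k, (k0 <= k)%N -> lef (truncated_gen k) (truncated_gen k0).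
  apply: (gacc_ambient sS (acc_mod Rn Nfg) (xs := xs)) => k.
    split; [exact: subfam_gen | | |].
    - by apply/(jstable_gens gxs); [apply: subfam_gen | apply: jstable_gen].
    - by move=> n; apply: incl_addr; apply: submod_span.
    - by move=> n; apply: incl_trans (@gen_incl k n) (incl_trans (@MP n) (@PA n)).
  move=> n; apply: modadd_mono => //; apply: span_mono.
  by move=> _ [u [m [a [r [-> dm pr Ma ->]]]]]; exists u, m, a, r; split=> //; apply: leqW.
exists k0 => u v huv; apply: (@incl_trans _ _ (truncated_gen k0 (u + v)%MM)).
  move=> y My; apply: (h0 (maxn k0 (mdeg (u + v)%MM))); first exact: leq_maxl.
  apply: incl_addl => //; apply: span_incl; exists 0%MM, (u + v)%MM, y, 1.
  by rewrite add0m scale1r leq_maxr pw0.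
have sX : submod (modadd (modmul (pw Js u) (M v)) S) by apply/submod_add/sS/submod_modmul.
apply: incl_add => //; last by apply: incl_addr; apply: submod_modmul.
apply: span_sub => // _ [u' [m [a [r [e1 dm pr Ma ->]]]]].
have le_uu' : (u <= u')%MM.
  apply/mnm_lepP => i; have /mnmP /(_ i) := e1; rewrite !mnmDE.
  case: (huv i) => [->|cv] //; have : (m i <= k0)%N.
    by apply: leq_trans dm; rewrite mdegE (bigD1 i) //= leq_addr.
  by lia.
have ev : v = (u' - u + m)%MM.
  apply: (@addmI _ u); rewrite e1 addmA; congr (_ + _)%MM.
  by rewrite addmC submK.
move: pr; rewrite -(submK le_uu') addmC pwD; move: r; apply: idmul_sub.
  by apply: ideal_colon.
move=> b b' pb pb'; rewrite -scalerA; apply: incl_addl => //; apply: modmul_in => //.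
by rewrite ev; apply: pw_jstable.
Qed.

End Gen.
End ArtinRees.
End Graded.

(** * Functions that are polynomial for large arguments *)

Section EventuallyPolynomial.
Implicit Types (p : {poly rat}) (g h : nat -> rat).

Definition evpoly g := exists p B, forall k, (B <= k)%N -> g k = p.[k%:R].

Lemma evpoly_shift g : evpoly g -> evpoly (fun k => g k.+1).
Proof.
move=> [p [B hp]]; exists (p \Po ('X + 1)), B => k hB.
by rewrite hp ?(leqW hB) // horner_comp !hornerE natr1.
Qed.

Lemma evpoly_const c : evpoly (fun _ => c).
Proof. by exists c%:P, 0%N => k _; rewrite hornerC. Qed.

Lemma evpoly_delta j : evpoly (fun k => (k == j)%:R).
Proof.
exists 0, j.+1 => k hk; rewrite horner0.
by case: eqP => // ekj; rewrite ekj ltnn in hk.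
Qed.

Definition succ_exp_rest k : {poly rat} := ('X + 1) ^+ k.+1 - 'X^(k.+1) - (k.+1)%:R *: 'X^k.

Lemma size_succ_exp k : (size (succ_exp_rest k) <= k)%N.
Proof.
rewrite /succ_exp_rest; elim: k => [|k IH].
  by rewrite !expr1 expr0 scale1r addrAC addrK subrr size_poly0.
have -> : ('X + 1) ^+ k.+2 - 'X^(k.+2) - (k.+2)%:R *: 'X^(k.+1) =
   (('X + 1 : {poly rat}) * (('X + 1) ^+ k.+1 - 'X^(k.+1) - (k.+1)%:R *: 'X^k)
   + (k.+1)%:R *: 'X^k : {poly rat}).
  by rewrite -!mul_polyC !polyC_natr !exprS -[k.+2%:R]natr1; ring.
apply: leq_trans (size_polyD _ _) _; rewrite geq_max; apply/andP; split.
  apply: leq_trans (size_polyMleq _ _) _; rewrite (size_XaddC 1) /=.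
  exact: IH.
by apply: leq_trans (size_scale_leq _ _) _; rewrite size_polyXn.
Qed.

(** The difference of c X^(k+1), with c chosen to match the coefficient of X^k, reduces p to smaller
    size. *)
Lemma poly_antidifference p : exists s : {poly rat}, forall x, s.[x + 1] - s.[x] = p.[x].
Proof.
have [k] := ubnP (size p); elim: k p => // k IH p; rewrite ltnS => szp.
case: k IH szp => [|k] IH szp.
  by move: szp; rewrite leqn0 size_poly_eq0 => /eqP ->; exists 0 => x; rewrite !horner0 subrr.
set c := p`_k / k.+1%:R.
pose d : {poly rat} := c *: (('X + 1) ^+ k.+1 - 'X^(k.+1)).
have ec : p`_k = c * k.+1%:R by rewrite divfK // pnatr_eq0.
have [|s hs] := IH (p - d).
  rewrite ltnS; have -> : p - d = (p - p`_k *: 'X^k)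
     - c *: (('X + 1) ^+ k.+1 - 'X^(k.+1) - k.+1%:R *: 'X^k).
    by rewrite /d ec -!mul_polyC polyCM; ring.
  apply: leq_trans (size_polyD _ _) _; rewrite geq_max size_polyN; apply/andP; split.
    apply/leq_sizeP => j hj; rewrite coefB coefZ coefXn.
    case: eqP => [->|/eqP ne]; first by rewrite mulr1 subrr.
    rewrite mulr0 subr0; move/leq_sizeP: szp; apply.
    by rewrite ltn_neqAle eq_sym ne.
  by apply: leq_trans (size_scale_leq _ _) _; apply: size_succ_exp.
exists (s + c *: 'X^(k.+1)) => x.
have := hs x; rewrite /d !hornerE => e; rewrite -[RHS](subrK (c * ((x + 1) ^+ k.+1 - x ^+ k.+1))) -e.
by ring.
Qed.

Lemma evpoly_sum g : evpoly g -> evpoly (fun k => \sum_(j < k) g j).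
Proof.
move=> [p [B hp]]; have [s hs] := poly_antidifference p.
exists (s + (\sum_(j < B) g j - s.[B%:R])%:P), B => k hk.
rewrite hornerD hornerC -(subnK hk); elim: (k - B)%N => [|l IH].
  by rewrite add0n addrC subrK.
rewrite addSn big_ord_recr /= IH hp ?leq_addl // -hs -natr1; ring.
Qed.

End EventuallyPolynomial.

Section QuasiPoly.
Variable e : nat.
Local Notation idx := 'X_{1..e}.
Implicit Types (f h : idx -> rat) (n m : idx).

Definition setc n (i : 'I_e) (j : nat) : idx := [multinom if l == i then j else n l | l < e].

Lemma setcE n i j l : setc n i j l = if l == i then j else n l.
Proof. by rewrite mnmE. Qed.

Lemma setc_id n i : setc n i (n i) = n.
Proof. by apply/mnmP => l; rewrite setcE; case: eqP => // ->. Qed.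

Lemma setc_setc n i j k : setc (setc n i j) i k = setc n i k.
Proof. by apply/mnmP => l; rewrite !setcE; case: eqP. Qed.

Lemma setc_succ n i j : setc n i j.+1 = (setc n i j + U_(i))%MM.
Proof.
apply/mnmP => l; rewrite mnmDE !setcE mnm1E eq_sym.
by case: eqP; rewrite ?addn1 ?addn0.
Qed.

Lemma setc_add n i : n = (setc n i 0 + U_(i) *+ n i)%MM.
Proof.
apply/mnmP => l; rewrite mnmDE mulmnE setcE mnm1E eq_sym.
by case: eqP => [->|_]; rewrite ?mul1n ?addn0.
Qed.

(* Unlike eventual polynomiality, this class is stable under restriction to a coordinate hyperplane, hence under summation. *)
Inductive qpoly : (idx -> rat) -> Prop :=
| qpoly_prod (c : rat) (g : 'I_e -> nat -> rat) :
    (forall i, evpoly (g i)) -> qpoly (fun n => c * \prod_i g i (n i))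
| qpolyD f h : qpoly f -> qpoly h -> qpoly (fun n => f n + h n).

Lemma qpoly_ext f h : f =1 h -> qpoly f -> qpoly h.
Proof. by move=> /functional_extensionality ->. Qed.

Lemma qpoly_const c : qpoly (fun _ => c).
Proof.
apply: qpoly_ext (@qpoly_prod c (fun _ _ => 1) (fun _ => evpoly_const 1)).
by move=> n; rewrite big1 ?mulr1.
Qed.

Lemma qpolyZ c f : qpoly f -> qpoly (fun n => c * f n).
Proof.
elim=> [d g eg|f1 f2 _ q1 _ q2].
  by apply: qpoly_ext (@qpoly_prod (c * d) g eg) => n; rewrite mulrA.
by apply: qpoly_ext (qpolyD q1 q2) => n; rewrite mulrDr.
Qed.

Lemma qpolyB f h : qpoly f -> qpoly h -> qpoly (fun n => f n - h n).
Proof.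
move=> qf /(qpolyZ (-1)) qh; apply: qpoly_ext (qpolyD qf qh) => n.
by rewrite mulN1r.
Qed.

Lemma qpoly_sum (T : Type) (s : seq T) (F : T -> idx -> rat) :
  (forall t, qpoly (F t)) -> qpoly (fun n => \sum_(t <- s) F t n).
Proof.
move=> qF; elim: s => [|t s IH].
  by apply: qpoly_ext (qpoly_const 0) => n; rewrite big_nil.
by apply: qpoly_ext (qpolyD (qF t) IH) => n; rewrite big_cons.
Qed.

Lemma qpoly_shift f i : qpoly f -> qpoly (fun n => f (n + U_(i))%MM).
Proof.
elim=> [c g eg|f1 f2 _ q1 _ q2]; last exact: qpolyD.
pose g' l := if l == i then (fun k => g l k.+1) else g l.
have eg' l : evpoly (g' l).
  by rewrite /g'; case: eqP => // _; apply: evpoly_shift.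
apply: qpoly_ext (@qpoly_prod c g' eg') => n; congr (_ * _); apply: eq_bigr => l _.
by rewrite /g' mnmDE mnm1E eq_sym; case: eqP; rewrite ?addn1 ?addn0.
Qed.

Lemma qpoly_restr f i j : qpoly f -> qpoly (fun n => f (setc n i j)).
Proof.
elim=> [c g eg|f1 f2 _ q1 _ q2]; last exact: qpolyD.
pose g' l := if l == i then (fun k => g l j) else g l.
have eg' l : evpoly (g' l).
  by rewrite /g'; case: eqP => // _; apply: evpoly_const.
apply: qpoly_ext (@qpoly_prod c g' eg') => n; congr (_ * _); apply: eq_bigr => l _.
by rewrite /g' setcE; case: eqP.
Qed.

Lemma qpoly_sumto f i : qpoly f -> qpoly (fun n => \sum_(j < n i) f (setc n i j)).
Proof.
elim=> [c g eg|f1 f2 _ q1 _ q2]; last first.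
  by apply: qpoly_ext (qpolyD q1 q2) => n; rewrite -big_split.
pose g' l := if l == i then (fun k => \sum_(j < k) g l j) else g l.
have eg' l : evpoly (g' l).
  by rewrite /g'; case: eqP => // _; apply: evpoly_sum.
apply: qpoly_ext (@qpoly_prod c g' eg') => n; rewrite -mulr_sumr; congr (_ * _).
rewrite (bigD1 i) //= {1}/g' eqxx mulr_suml; apply: eq_bigr => j _.
rewrite [RHS](bigD1 i) //= setcE eqxx; congr (_ * _); apply: eq_bigr => l nl.
by rewrite /g' setcE (negPf nl).
Qed.

Lemma qpoly_antidiff f h i : qpoly (fun n => f (setc n i 0)) -> qpoly h ->
  (forall n, f (n + U_(i))%MM - f n = h n) -> qpoly f.
Proof.
move=> q0 qh hf; apply: qpoly_ext (qpolyD q0 (qpoly_sumto i qh)) => n.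
rewrite -[in RHS](setc_id n i); elim: (n i) => [|j IH]; first by rewrite big_ord0 addr0.
by rewrite big_ord_recr /= addrA IH setc_succ -hf addrC subrK.
Qed.

(** A finite combination of products of delta functions, each eventually the zero polynomial. *)
Lemma qpoly_finsupp f k : (forall n, (k < mdeg n)%N -> f n = 0) -> qpoly f.
Proof.
move=> hf; pose F (m : 'X_{1..e < k.+1}) n := f m * \prod_i (n i == m i)%:R.
have qF (m : 'X_{1..e < k.+1}) : qpoly (F m) by apply: (@qpoly_prod _ (fun i l => (l == m i)%:R)) => i; apply: evpoly_delta.
apply: qpoly_ext (qpoly_sum (index_enum _) qF) => n.
have delta m : \prod_i (n i == m i)%:R = (n == m)%:R :> rat.
  case: (eqVneq n m) => [->|nm]; first by rewrite big1 // => i _; rewrite eqxx.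
  have /existsP [i hi] : [exists i, n i != m i].
    by apply: contraNT nm; rewrite negb_exists => /forallP h; apply/eqP/mnmP => i; apply/eqP/negPn.
  by rewrite (bigD1 i) //= (negPf hi) mul0r.
case: (ltnP k (mdeg n)) => hn.
  rewrite hf // big1 // => m _; rewrite /F delta; case: eqP => [e1|_]; last by rewrite mulr0.
  by have := bmdeg m; rewrite -e1 ltnS leqNgt hn.
rewrite (bigD1 (BMultinom (hn : (mdeg n < k.+1)%N))) //= /F delta eqxx mulr1 big1 ?addr0 // => m.
rewrite delta eq_sym bmeqP /= => /negPf ->; exact: mulr0.
Qed.

Lemma qpoly_mpoly f : qpoly f -> exists (P : {mpoly rat[e]}) B,
  forall n, (forall i, (B <= n i)%N) -> f n = P.@[fun i => (n i)%:R].
Proof.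
elim=> [c g eg|f1 f2 _ [P1 [B1 h1]] _ [P2 [B2 h2]]]; last first.
  exists (P1 + P2), (maxn B1 B2) => n hn; rewrite mevalD h1 ?h2 // => i.
    by apply: leq_trans (hn i); apply: leq_maxr.
  by apply: leq_trans (hn i); apply: leq_maxl.
have h i : exists pB : {poly rat} * nat, forall k, (pB.2 <= k)%N -> g i k = pB.1.[k%:R].
  by have [p [B hp]] := eg i; exists (p, B).
pose w i := proj1_sig (constructive_indefinite_description _ (h i)).
have wP i k : ((w i).2 <= k)%N -> g i k = (w i).1.[k%:R].
  by rewrite /w; case: constructive_indefinite_description => ? /=; apply.
exists (c *: \prod_i \sum_(j < size (w i).1) (w i).1`_j *: 'X_i ^+ j), (\max_i (w i).2).
move=> n hn; rewrite mevalZ rmorph_prod /=; congr (_ * _); apply: eq_bigr => i _.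
rewrite wP; last by apply: leq_trans (hn i); apply: leq_bigmax.
rewrite horner_coef raddf_sum /=; apply: eq_bigr => j _.
by rewrite mevalZ rmorphXn /= mevalXU.
Qed.

End QuasiPoly.

(** * Hilbert functions *)

Section HilbertFunction.
Variables (R : comUnitRingType) (N : lmodType R) (e : nat).
Local Notation idx := 'X_{1..e}.
Local Notation fam := (idx -> N -> Prop).
Local Notation submod := (@submod R N).
Implicit Types (A B F : fam) (n m : idx) (xs : seq ('I_e * R)).

Definition homothety (x : R) (y : N) : N := x *: y.

Lemma homothety_is_linear x : linear (homothety x).
Proof. by move=> a y z; rewrite /homothety scalerDr !scalerA mulrC. Qed.

HB.instance Definition _ x := GRing.isLinear.Build R N N _ (homothety x) (homothety_is_linear x).

Section Step.
Variables (i : 'I_e) (x : R) (xs : seq ('I_e * R)) (A B : fam).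
Hypotheses (sA : subfam A) (sB : subfam B) (BA : lef B A).
Hypotheses (stA : stable ((i, x) :: xs) A) (stB : stable ((i, x) :: xs) B).

Let stA' : stable xs A.
Proof. by move=> kt kt_xs; apply: stA; rewrite in_cons kt_xs orbT. Qed.

Let stB' : stable xs B.
Proof. by move=> kt kt_xs; apply: stB; rewrite in_cons kt_xs orbT. Qed.

(** [mker] / B and A / [mcoker] are the kernel and cokernel of x from A / B to its shift by [U_(i)].
    [mtrans n] is x A(n - U_i), and it is 0 when n i = 0; asking for an index m avoids truncated
    subtraction of multinomials. *)
Definition mker n y := A n y /\ B (n + U_(i))%MM (x *: y).
Definition mtrans n z := exists2 a, z = x *: a & a = 0 \/ exists2 m, n = (m + U_(i))%MM & A m a.
Definition mcoker n := modadd (mtrans n) (B n).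

Lemma mtrans_succ n : mtrans (n + U_(i))%MM = image (homothety x) (A n).
Proof.
apply: pred_ext => z [a]; last by move=> Aa ->; exists a => //; right; exists n.
move=> -> [->|[m /eqP]]; first by exists 0 => //; apply: submod0.
by rewrite eqm_add2r => /eqP <- Aa; exists a.
Qed.

Lemma mtrans0 n : n i = 0%N -> mtrans n = @modzero R N.
Proof.
move=> n0; apply: pred_ext => [_ [a -> [->|[m em]]]|_ ->]; first exact: scaler0.
  by have := n0; rewrite em mnmDE mnm1E eqxx addn1.
by exists 0; [rewrite scaler0 | left].
Qed.

Lemma submod_mtrans n : submod (mtrans n).
Proof.
have [n0|] := posnP (n i); first by rewrite mtrans0 //; apply: submod_zero.
rewrite lt0n -lep1mP => /submK e1; rewrite -e1 mtrans_succ.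
by apply: submod_image.
Qed.

Lemma subfam_mker : subfam mker.
Proof. by move=> n; apply: submod_meet => //; apply: submod_colon. Qed.

Lemma subfam_mcoker : subfam mcoker.
Proof. by move=> n; apply: submod_add => //; apply: submod_mtrans. Qed.

Lemma stable_mker : stable xs mker.
Proof.
move=> kt kt_xs n y [Ay By]; split; first exact: stA'.
by rewrite scalerA mulrC -scalerA addmAC; apply: stB'.
Qed.

Lemma stable_mcoker : stable xs mcoker.
Proof.
move=> kt kt_xs n _ [_ [b [[a -> ha] Bb ->]]]; rewrite scalerDr.
exists (kt.2 *: (x *: a)), (kt.2 *: b); split=> //; last exact: stB'.
exists (kt.2 *: a); first by rewrite !scalerA mulrC.
case: ha => [->|[m -> Aa]]; [by left; rewrite scaler0 | right].
by exists (m + U_(kt.1))%MM; [rewrite addmAC | apply: stA'].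
Qed.

Lemma mker_ge : lef B mker.
Proof. by move=> n y By; split; [apply: BA | apply: (stB (ix := (i, x))); rewrite ?mem_head]. Qed.

Lemma mker_le : lef mker A. Proof. by move=> n y []. Qed.

Lemma mcoker_ge : lef B mcoker.
Proof. by move=> n; apply: incl_addr; apply: submod_mtrans. Qed.

Lemma mcoker_le : lef mcoker A.
Proof.
move=> n; apply: incl_add => // _ [a -> [->|[m -> Aa]]].
  by rewrite scaler0; apply: submod0.
by apply: (stA (ix := (i, x))); rewrite ?mem_head.
Qed.

Lemma gacc_mker : gacc ((i, x) :: xs) B A -> gacc xs B mker.
Proof.
move=> acc F gF; apply: acc => k; have [sF stF BF FK] := gF k; split=> //.
  move=> kt; rewrite in_cons => /orP [/eqP ->|/stF //] n y /FK [_ By]; exact: BF.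
by move=> n y /FK [].
Qed.

Lemma gacc_mcoker : gacc ((i, x) :: xs) B A -> gacc xs mcoker A.
Proof.
move=> acc F gF; apply: acc => k; have [sF stF CF FA] := gF k; split=> //.
  move=> kt; rewrite in_cons => /orP [/eqP ->|/stF //] n y /FA Ay; apply: CF.
  apply: incl_addl => //; rewrite mtrans_succ; by exists y.
by move=> n y By; apply: CF; apply: mcoker_ge.
Qed.

Hypothesis fBA : forall n, finlen submod (B n) (A n).

Lemma finlen_mker n : finlen submod (B n) (mker n).
Proof. by case: (len_add_le (fBA n) (subfam_mker n) (@mker_ge n) (@mker_le n)). Qed.

Lemma finlen_mcoker n : finlen submod (mcoker n) (A n).
Proof. by case: (len_add_le (fBA n) (subfam_mcoker n) (@mcoker_ge n) (@mcoker_le n)). Qed.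

(** The four-term exact sequence of multiplication by x, arranged so that no subtraction of naturals
    occurs. *)
Lemma len_step n :
  (len submod (B (n + U_(i))%MM) (A (n + U_(i))%MM) + len submod (B n) (mker n) =
   len submod (mcoker (n + U_(i))%MM) (A (n + U_(i))%MM) + len submod (B n) (A n))%N.
Proof.
have [_ _ ->] := len_add_le (fBA n) (subfam_mker n) (@mker_ge n) (@mker_le n).
have [_ _ ->] := len_add_le (fBA (n + U_(i))%MM) (@subfam_mcoker _) (@mcoker_ge _) (@mcoker_le _).
have := len_transport (homothety x) (sA n) (sB (n + U_(i))%MM).
rewrite -mtrans_succ -[modadd _ _]/(mcoker _) -[meet _ _]/(mker n) => ->.
by lia.
Qed.

End Step.

Lemma hilbert_qpoly xs A B : subfam A -> subfam B -> lef B A ->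
  stable xs A -> stable xs B -> gacc xs B A -> (forall n, finlen submod (B n) (A n)) ->
  qpoly (fun n => (len submod (B n) (A n))%:R).
Proof.
elim: xs A B => [|[i x] xs IH] A B sA sB BA stA stB acc fBA.
  (* No variable is left, so the truncations of A (replaced by B in large degree) are admissible
     families; the chain condition makes A / B vanish in large total degree. *)
  pose F k n := if (mdeg n <= k)%N then A n else B n.
  have [k0 h0] : exists k0, forall k, (k0 <= k)%N -> lef (F k) (F k0).
    apply: acc => k; last first.
      move=> n; rewrite /F; case: ifP => [le_nk|_]; first by rewrite leqW.
      by case: ifP => _; [apply: BA | ].
    split=> // n; rewrite /F; case: ifP => _ //; exact: BA.
  apply: (@qpoly_finsupp _ _ k0) => n lt_kn.
  have -> : A n = B n.
    apply: pred_ext (BA n) => y Ay.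
    have := h0 (mdeg n) (ltnW lt_kn) n y; rewrite /F leqnn leqNgt lt_kn; exact.
  by rewrite (lenE (is_length_refl (sB n))).
have qk := IH _ _ (subfam_mker i x sA sB) sB (mker_ge BA stB) (stable_mker stA stB)
  (fun kt h => stB kt (introT orP (or_intror h))) (gacc_mker acc) (finlen_mker sA sB BA stB fBA).
have qc := IH _ _ sA (subfam_mcoker i x sA sB) (mcoker_le sA BA stA)
  (fun kt h => stA kt (introT orP (or_intror h))) (stable_mcoker stA stB)
  (gacc_mcoker sA sB acc) (finlen_mcoker sA sB BA stA fBA).
apply: (@qpoly_antidiff _ _ (fun n =>
   (len submod (mcoker i x A B (n + U_(i))%MM) (A (n + U_(i))%MM))%:R
   - (len submod (B n) (mker i x A B n))%:R) i).
(* On the hyperplane n i = 0 the cokernel is A / B itself, so the induction hypothesis also supplies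
   the initial values. *)
- apply: qpoly_ext (qpoly_restr i 0 qc) => n.
  rewrite /mcoker mtrans0 ?setcE ?eqxx // modadd_idr //; first exact: submod_zero.
  by move=> y ->; apply: submod0.
- apply: qpolyB qk; exact: (qpoly_shift i qc).
- move=> n; have /(congr1 (fun k => k%:R : rat)) := len_step sA sB BA stA stB fBA n.
  by rewrite !natrD => h; apply/eqP; rewrite subr_eq addrAC eq_sym subr_eq h.
Qed.

End HilbertFunction.

(** * Growth and degree *)

Section PolyGrowth.

Lemma poly_lower_bound (p : {poly rat}) : 0 < lead_coef p ->
  exists b, forall x, b <= x -> lead_coef p <= p.[x].
Proof.
elim/poly_ind: p => [|p c IH]; first by rewrite lead_coef0 ltxx.
have [->|p0] := eqVneq p 0.
  by rewrite mul0r add0r lead_coefC => _; exists 0 => x _; rewrite hornerC.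
have -> : lead_coef (p * 'X + c%:P) = lead_coef p.
  rewrite lead_coefDl ?lead_coefMX // size_mulX // size_polyC.
  by case: eqP => // _; rewrite ltnS lt0n size_poly_eq0.
move=> /[dup] lc_gt0 /IH [b hb]; exists (Num.max b (1 + `|c| / lead_coef p)) => x.
rewrite ge_max => /andP [/hb hx hx2]; rewrite !hornerE.
have x_gt0 : 0 < x.
  by apply: lt_le_trans hx2; rewrite ltr_wpDr // divr_ge0 // ltW.
have h1 : lead_coef p * x <= p.[x] * x by rewrite ler_pM2r.
have h2 : lead_coef p * (1 + `|c| / lead_coef p) <= lead_coef p * x by rewrite ler_pM2l.
have h3 : lead_coef p * (1 + `|c| / lead_coef p) = lead_coef p + `|c|.
  by rewrite mulrDr mulr1 mulrC divfK // gt_eqF.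
have h4 : - c <= `|c| by rewrite -normrN ler_norm.
lra.
Qed.

(** Squaring removes the absolute value: if p were larger, p^2 - C^2 X^(2b) would have a positive
    leading coefficient and be positive at large integers. *)
Lemma size_growth (p : {poly rat}) C B b :
  (forall t : nat, (B <= t)%N -> `|p.[t%:R]| <= C * t%:R ^+ b) -> (size p <= b.+1)%N.
Proof.
move=> hp; rewrite leqNgt; apply/negP => szp.
have p0 : p != 0 by rewrite -size_poly_gt0; apply: leq_trans szp.
pose G := p ^+ 2 - C ^+ 2 *: 'X^(b.*2).
have szp2 : size (p ^+ 2) = (size p).-1.*2.+1 by rewrite expr2 size_mul // -addnn; move: szp; case: (size p) => // k _; rewrite addnS.
have lG : lead_coef G = lead_coef p ^+ 2.
  rewrite /G lead_coefDl ?lead_coef_exp // size_polyN szp2.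
  apply: leq_ltn_trans (size_scale_leq _ _) _; rewrite size_polyXn ltnS.
  by rewrite ltn_double; move: szp; case: (size p).
have [|y hy] := @poly_lower_bound G.
  by rewrite lG lt_neqAle sqr_ge0 andbT eq_sym sqrf_eq0 lead_coef_eq0.
pose t := maxn B (Num.bound `|y|).
have ht : y <= t%:R.
  apply: le_trans (ler_norm y) _; apply: ltW; apply: lt_le_trans (archi_boundP (normr_ge0 y)) _.
  by rewrite ler_nat leq_maxr.
have := hy _ ht; rewrite lG leNgt => /negP; apply.
apply: (@le_lt_trans _ _ 0); last by rewrite lt_neqAle sqr_ge0 andbT eq_sym sqrf_eq0 lead_coef_eq0.
rewrite /G hornerD hornerN hornerZ horner_exp hornerXn subr_le0.
rewrite -muln2 exprM -exprMn -(real_normK (num_real p.[_])).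
have hB : (B <= t)%N by apply: leq_maxl.
by rewrite lerXn2r ?nnegrE ?normr_ge0 ?hp // (le_trans (normr_ge0 _) (hp t hB)).
Qed.

Lemma base_expansion e M (a b : 'I_e -> nat) :
  (forall i, a i < M)%N -> (forall i, b i < M)%N ->
  (\sum_i a i * M ^ i = \sum_i b i * M ^ i)%N -> a =1 b.
Proof.
elim: e a b => [|e IH] a b ha hb; first by move=> _ [].
rewrite !big_ord_recl !expn0 !muln1.
have shift (c : 'I_e.+1 -> nat) :
    (\sum_(i < e) c (lift ord0 i) * M ^ lift ord0 i = (\sum_(i < e) c (lift ord0 i) * M ^ i) * M)%N.
  by rewrite big_distrl /=; apply: eq_bigr => i _; rewrite -mulnA -expnSr.
rewrite !shift => h.
have M_gt0 : (0 < M)%N by apply: leq_ltn_trans (ha ord0).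
have h0 : a ord0 = b ord0.
  by have /= := congr1 (modn^~ M) h; rewrite [(a ord0 + _)%N]addnC [(b ord0 + _)%N]addnC !modnMDl !modn_small.
have h1 : (\sum_(i < e) a (lift ord0 i) * M ^ i = \sum_(i < e) b (lift ord0 i) * M ^ i)%N.
  by apply/eqP; rewrite -(eqn_pmul2r M_gt0) -(eqn_add2l (a ord0)) {2}h0 h.
move=> i; have [j ->|-> //] := unliftP ord0 i.
by apply: (IH (fun i => a (lift ord0 i)) (fun i => b (lift ord0 i))).
Qed.

Lemma base_expansion_lt e M (a : 'I_e -> nat) :
  (forall i, a i < M)%N -> (\sum_i a i * M ^ i < M ^ e)%N.
Proof.
elim: e a => [|e IH] a ha; first by rewrite big_ord0 expn0.
rewrite big_ord_recr /= expnS.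
have := IH (fun i => a (widen_ord (leqnSn e) i)) (fun i => ha _) => /= h.
apply: (@leq_trans (M ^ e + a ord_max * M ^ e)); first by rewrite ltn_add2r.
by rewrite -mulSn leq_mul2r ha orbT.
Qed.

Variable e : nat.
Local Notation idx := 'X_{1..e.+1}.
Implicit Types (f g : idx -> rat) (P : {mpoly rat[e.+1]}) (n m v : idx).

Definition pt n : 'I_e.+1 -> rat := fun i => (n i)%:R.

(** The factor 1 + mdeg n on the left stands for an exponent D - 1 on the right. It gives D = 0 a
    meaning and lets D be compared with [msize], which is the total degree plus one. *)
Definition growth D f := exists C B, forall n, (forall i, (B <= n i)%N) ->
  `|f n| * (1 + mdeg n)%:R <= C * (1 + mdeg n)%:R ^+ D.

(* Kronecker substitution: [X_i] is replaced by [t ^ (K + M ^ i)] with [M] above all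
   exponents and [K] so large that the resulting degree determines the total degree. *)
Lemma msize_growth P D : growth D (fun n => P.@[pt n]) -> (msize P <= D)%N.
Proof.
case=> C [B hP]; rewrite leqNgt; apply/negP => szP.
have [m0 m0P dm0] : exists2 m, m \in msupp P & (D <= mdeg m)%N.
  apply: NNPP => h; move: szP; rewrite ltnNge => /negP; apply.
  rewrite msizeE; apply/bigmax_leqP_seq => m mP _; rewrite ltnNge.
  by apply/negP => hm; apply: h; exists m.
pose M := (msize P).+1; pose W := (M ^ e.+1)%N; pose K := (W * D.+1)%N.
have mM m i : m \in msupp P -> (m i < M)%N.
  move=> /msize_mdeg_lt /ltnW; rewrite ltnS; apply: leq_trans.
  by rewrite mdegE (bigD1 i) //= leq_addr.
pose phi0 m := (\sum_i m i * M ^ i)%N; pose phi m := (K * mdeg m + phi0 m)%N.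
have phi0_lt m : m \in msupp P -> (phi0 m < K)%N.
  move=> mP; apply: (@leq_trans W); last by rewrite leq_pmulr.
  by apply: base_expansion_lt => i; apply: mM.
have phi_inj m m' : m \in msupp P -> m' \in msupp P -> phi m = phi m' -> m = m'.
  move=> mP m'P /(congr1 (modn^~ K)); rewrite /phi ![(K * _)%N]mulnC !modnMDl.
  rewrite !modn_small ?phi0_lt // => /base_expansion h.
  by apply/mnmP; apply: h => i; apply: mM.
pose p : {poly rat} := \sum_(m <- msupp P) P@_m *: 'X^(phi m).
have p_phi : p`_(phi m0) = P@_m0.
  rewrite /p coef_sum (bigD1_seq m0) ?msupp_uniq //= coefZ coefXn eqxx mulr1.
  rewrite big_seq_cond big1 ?addr0 // => m /andP [mP nm]; rewrite coefZ coefXn.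
  by case: eqP => [/phi_inj e1|_]; rewrite ?mulr0 //; rewrite e1 ?eqxx in nm.
have szp : (K * D < size p)%N.
  rewrite ltnNge; apply/negP => h; move: m0P; rewrite mcoeff_msupp -p_phi nth_default ?eqxx //.
  apply: leq_trans h _; apply: leq_trans (leq_addr _ _); rewrite leq_mul2l dm0 orbT //.
pose N t : idx := [multinom (t ^ (K + M ^ i))%N | i < e.+1].
have NE t i : N t i = (t ^ (K + M ^ i))%N by rewrite mnmE.
have p_eval t : p.[t%:R] = P.@[pt (N t)].
  rewrite horner_sum mevalE; apply: eq_bigr => m _; rewrite hornerZ hornerXn; congr (_ * _).
  rewrite -natrX; under [RHS]eq_bigr do rewrite /pt NE -natrX -expnM.
  rewrite -natr_prod -expn_sum; congr ((_ ^ _)%N%:R).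
  rewrite /phi /phi0 mdegE big_distrr -big_split /=; apply: eq_bigr => i _.
  by rewrite mulnDl [(M ^ i * _)%N]mulnC.
have M_gt0 : (0 < M)%N by [].
have K_gt0 : (0 < K)%N by rewrite muln_gt0 expn_gt0.
have N_ge t : (t ^ K <= mdeg (N t))%N.
  case: t => [|t]; first by rewrite exp0n.
  by rewrite mdegE (bigD1 ord0) //= NE; apply: leq_trans (leq_addr _ _); rewrite leq_pexp2l // leq_addr.
have N_le t : (0 < t)%N -> (1 + mdeg (N t) <= e.+2 * t ^ (K + W))%N.
  move=> t_gt0; rewrite mulSn leq_add ?expn_gt0 ?t_gt0 // mdegE -[X in (X * _)%N]card_ord -sum_nat_const.
  apply: leq_sum => i _; rewrite NE leq_pexp2l // leq_add2l leq_pexp2l //; exact: ltnW.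
(* The factor X^K accounts for 1 + mdeg in [growth], as mdeg (N t) >= t^K. Combined with size p > K
   D, the bound gives K <= W D, against K = W (D + 1). *)
have szX : (size (p * 'X^K)%R <= ((K + W) * D).+1)%N.
  apply: (@size_growth _ (`|C| * e.+2%:R ^+ D) (maxn 1 B)) => t; rewrite geq_max => /andP [t1 tB].
  have hB i : (B <= N t i)%N.
    rewrite NE; apply: leq_trans tB _; rewrite -{1}[t]expn1 leq_pexp2l //.
    by apply: leq_trans (leq_addr _ _).
  rewrite hornerM hornerXn normrM p_eval normrX normr_nat.
  apply: (@le_trans _ _ (`|P.@[pt (N t)]| * (1 + mdeg (N t))%:R)).
    by apply: ler_wpM2l => //; rewrite -natrX ler_nat; apply: leq_trans (N_ge t) (leq_addl _ _).
  apply: le_trans (hP _ hB) _; apply: (@le_trans _ _ (`|C| * (1 + mdeg (N t))%:R ^+ D)).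
    by apply: ler_wpM2r (ler_norm C); apply: exprn_ge0.
  rewrite -mulrA; apply: ler_wpM2l => //.
  by rewrite exprM -exprMn -(natrX _ t (K + W)) -natrM lerXn2r ?nnegrE // ler_nat N_le.
have p_neq0 : p != 0 by rewrite -size_poly_gt0; apply: leq_trans szp.
move: szX; rewrite size_mulXn // mulnDl; have : (K = W * D.+1)%N by []; rewrite mulnS.
have : (0 < W)%N by rewrite expn_gt0.
by lia.
Qed.

Lemma growth_mpoly P : growth (msize P) (fun n => P.@[pt n]).
Proof.
exists (\sum_(m <- msupp P) `|P@_m|), 0%N => n _; rewrite mevalE.
rewrite mulr_suml; apply: (@le_trans _ _ (\sum_(m <- msupp P) `|P@_m| * (1 + mdeg n)%:R ^+ mdeg m * (1 + mdeg n)%:R)).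
  rewrite -mulr_suml; apply: ler_wpM2r => //; apply: le_trans (ler_norm_sum _ _ _) _.
  apply: ler_sum => m _; rewrite normrM; apply: ler_wpM2l => //.
  rewrite normr_prod (mdegE m) -prodrXr; apply: ler_prod => i _; rewrite normr_ge0 normrX /=.
  rewrite lerXn2r ?nnegrE // /pt normr_nat ler_nat mdegE (bigD1 i) //= addnCA leq_addr //.
rewrite !big_seq; apply: ler_sum => m mP; rewrite -mulrA -exprSr; apply: ler_wpM2l => //.
by apply: ler_weXn2l; [rewrite ler1n | apply: msize_mdeg_lt].
Qed.

End PolyGrowth.

Section EvPoly.
Variable e : nat.
Local Notation idx := 'X_{1..e.+1}.
Implicit Types (f g : idx -> rat) (P Q : {mpoly rat[e.+1]}) (n m v : idx) (D : nat).

(** Eventually a polynomial of total degree below D; for D = 0, eventually zero. *)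
Definition evP D f := exists P B, (msize P <= D)%N /\
  forall n, (forall i, (B <= n i)%N) -> f n = P.@[pt n].

Definition eventually (p : idx -> Prop) := exists B, forall n, (forall i, (B <= n i)%N) -> p n.

Lemma eventually_and (p q : idx -> Prop) : eventually p -> eventually q ->
  eventually (fun n => p n /\ q n).
Proof.
move=> [B hB] [C hC]; exists (maxn B C) => n hn; split; [apply: hB | apply: hC] => i;
  apply: leq_trans (hn i); [exact: leq_maxl | exact: leq_maxr].
Qed.

Lemma eventually_imp (p q : idx -> Prop) : (forall n, p n -> q n) -> eventually p -> eventually q.
Proof. by move=> pq [B hB]; exists B => n /hB /pq. Qed.

Lemma eventually_true (p : idx -> Prop) : (forall n, p n) -> eventually p.
Proof. by exists 0%N. Qed.

Lemma growthP D f : growth D f <->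
  exists C, eventually (fun n => `|f n| * (1 + mdeg n)%:R <= C * (1 + mdeg n)%:R ^+ D).
Proof. by split=> -[C [B h]]; exists C; exists B. Qed.

Lemma growth_dom D f g : growth D g -> eventually (fun n => `|f n| <= `|g n|) -> growth D f.
Proof.
move=> /growthP [C hC] hfg; apply/growthP; exists C.
apply: eventually_imp (eventually_and hC hfg) => n [h1 h2].
by apply: le_trans h1; apply: ler_wpM2r.
Qed.

Lemma growth_le D D' f : (D <= D')%N -> growth D f -> growth D' f.
Proof.
move=> le_D [C [B h]]; exists `|C|, B => n /h hn; apply: le_trans hn _.
apply: (@le_trans _ _ (`|C| * (1 + mdeg n)%:R ^+ D)).
  by apply: ler_wpM2r (ler_norm C); apply: exprn_ge0.
by apply: ler_wpM2l => //; apply: ler_weXn2l; rewrite // ler1n.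
Qed.

Lemma evP_growth D f : evP D f -> growth D f.
Proof.
move=> [P [B [szP hP]]]; apply: growth_dom (growth_le szP (growth_mpoly P)) _.
by exists B => n /hP ->.
Qed.

Lemma growth_msize D f P : growth D f -> eventually (fun n => f n = P.@[pt n]) -> (msize P <= D)%N.
Proof.
move=> gf hP; apply: msize_growth; apply: growth_dom gf _.
by apply: eventually_imp hP => n ->.
Qed.

Lemma qpoly_evP D f : qpoly f -> growth D f -> evP D f.
Proof.
move=> /qpoly_mpoly [P [B hP]] gf; exists P, B; split=> //.
by apply: growth_msize gf _; exists B.
Qed.

Lemma qpoly_evP_ex f : qpoly f -> exists D, evP D f.
Proof. by move=> /qpoly_mpoly [P [B hP]]; exists (msize P), P, B. Qed.

Lemma evP_le D D' f : (D <= D')%N -> evP D f -> evP D' f.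
Proof. by move=> le_D [P [B [szP hP]]]; exists P, B; split=> //; apply: leq_trans le_D. Qed.

Lemma evPD D f g : evP D f -> evP D g -> evP D (fun n => f n + g n).
Proof.
move=> [P [B [szP hP]]] [Q [C [szQ hQ]]]; exists (P + Q), (maxn B C); split.
  by apply: leq_trans (mmeasureD_le _ _ _) _; rewrite geq_max szP.
move=> n hn; rewrite mevalD hP ?hQ // => i; apply: leq_trans (hn i);
  [exact: leq_maxr | exact: leq_maxl].
Qed.

Lemma evPZ D c f : evP D f -> evP D (fun n => c * f n).
Proof.
move=> [P [B [szP hP]]]; exists (c *: P), B; split=> [|n /hP ->]; last by rewrite mevalZ.
by apply: leq_trans (mmeasureZ_le _ _ _) szP.
Qed.

Lemma evP_ext D f g : eventually (fun n => f n = g n) -> evP D f -> evP D g.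
Proof.
move=> hfg [P [B [szP hP]]].
have [C hC] := eventually_and hfg (ex_intro _ B hP : eventually (fun n => f n = P.@[pt n])).
by exists P, C; split=> // n /hC [<-].
Qed.

Lemma evPB D f g : evP D f -> evP D g -> evP D (fun n => f n - g n).
Proof.
move=> ef /(evPZ (-1)) eg; apply: evP_ext (evPD ef eg).
by apply: eventually_true => n; rewrite mulN1r.
Qed.

Lemma evP0 D : evP D (fun _ => 0).
Proof. by exists 0, 0%N; split=> [|n _]; rewrite ?mmeasure0 // meval0. Qed.

Lemma msize_mulX P i : (msize ('X_i * P) <= (msize P).+1)%N.
Proof.
have [->|P0] := eqVneq P 0; first by rewrite mulr0 mmeasure0.
have X0 : 'X_i != 0 :> {mpoly rat[e.+1]} by rewrite -msize_poly_eq0 msizeX.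
by rewrite msizeM // msizeX mdeg1.
Qed.

Lemma mpoly_difference P v :
  exists Q, (msize Q <= (msize P).-1)%N /\ forall n, Q.@[pt n] = P.@[pt (n + v)%MM] - P.@[pt n].
Proof.
have mono m : exists Q, (msize Q <= mdeg m)%N /\
    forall n, Q.@[pt n] = 'X_[m].@[pt (n + v)%MM] - 'X_[m].@[pt n].
  have [k] := ubnP (mdeg m); elim: k m => // k IH m; rewrite ltnS => hm.
  have [m0|m0] := eqVneq m 0%MM.
    by exists 0; rewrite mmeasure0; split=> // n; rewrite m0 mpolyX0 !meval1 meval0 subrr.
  have /existsP [i mi] : [exists i, m i != 0%N].
    apply: contraNT m0; rewrite negb_exists => /forallP h.
    by apply/eqP/mnmP => i; rewrite mnm0E; apply/eqP/negPn.
  move: mi; rewrite -lep1mP => /submK em; set m' := (m - U_(i))%MM in em.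
  have dm : mdeg m = (mdeg m').+1 by rewrite -em mdegD mdeg1 addn1.
  have [|Q [szQ hQ]] := IH m'; first by rewrite -dm.
  (* Product rule for the difference operator: d(X_i g) = X_i dg + v_i (dg + g). *)
  exists ('X_i * Q + (v i)%:R *: (Q + 'X_[m'])); split.
    rewrite dm; apply: leq_trans (mmeasureD_le _ _ _) _; rewrite geq_max.
    rewrite (leq_trans (msize_mulX _ _)) // (leq_trans (mmeasureZ_le _ _ _)) //.
    by apply: leq_trans (mmeasureD_le _ _ _) _; rewrite geq_max msizeX (leq_trans szQ) /=.
  move=> n; rewrite -em mpolyXD !(mevalD, mevalM, mevalZ) hQ !mevalXU /pt mnmDE natrD.
  by ring.
have mono' m := constructive_indefinite_description _ (mono m).
exists (\sum_(m <- msupp P) P@_m *: sval (mono' m)); split.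
  apply: leq_trans (mmeasure_sum _ _ _ _) _; apply/bigmax_leqP_seq => m mP _.
  case: (mono' m) => /= Q [szQ _]; apply: leq_trans (mmeasureZ_le _ _ _) _.
  apply: leq_trans szQ _; have := msize_mdeg_lt mP; by case: (msize P).
have mE w : P.@[w] = \sum_(m <- msupp P) P@_m * 'X_[m].@[w].
  by rewrite {1}(mpolyE P) raddf_sum; apply: eq_bigr => m _; rewrite /= mevalZ.
move=> n; rewrite raddf_sum /= !mE -sumrB; apply: eq_bigr => m _.
by rewrite mevalZ -mulrBr; case: (mono' m) => /= Q [_ ->].
Qed.

Lemma evP_diff D f v : evP D.+1 f -> evP D (fun n => f (n + v)%MM - f n).
Proof.
move=> [P [B [szP hP]]]; have [Q [szQ hQ]] := mpoly_difference P v.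
exists Q, B; split; first by apply: leq_trans szQ _; move: szP; case: (msize P).
move=> n hn; rewrite hQ !hP // => i; rewrite mnmDE; apply: leq_trans (hn i) (leq_addr _ _).
Qed.

Lemma evP_shift D f v : evP D f -> evP D (fun n => f (n + v)%MM).
Proof.
case: D => [|D] ef; last first.
  apply: evP_ext (evPD ef (evP_le (leqnSn _) (evP_diff v ef))).
  by apply: eventually_true => n; rewrite addrC subrK.
case: ef => P [B [szP hP]]; exists P, B; split=> // n hn.
have P0 : P = 0 by apply/eqP; rewrite -msize_poly_eq0 -leqn0.
rewrite hP ?P0 ?meval0 // => i; rewrite mnmDE; apply: leq_trans (hn i) (leq_addr _ _).
Qed.

End EvPoly.

(** * Hilbert-Samuel functions and dimension *)

Section HilbertSamuel.
Variables (R : comUnitRingType) (mm J : R -> Prop).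
Hypotheses (Rnoeth : noetherian R) (Hloc : local_with mm) (HJ : primary_to mm J).
Implicit Types (p q S : R^o -> Prop).
Local Notation submod := (@submod R R^o).
Local Notation full := (@modfull R R^o).

Lemma strict_trans_incl X (A B C : X -> Prop) : strict A B -> incl B C -> strict A C.
Proof. by move=> [sAB [x [Bx nAx]]] sBC; split; [apply: incl_trans sBC | exists x; split=> //; apply: sBC]. Qed.

Lemma prime_chain_cons (p q : R -> Prop) k : prime_ideal p -> strict p q ->
  prime_chain q k -> prime_chain p k.+1.
Proof.
move=> pp ltpq [P [hP sP]]; exists (fun i => if i is j.+1 then P j else p); split.
  move=> [|i] hi; first by split.
  have [pi sqi] := hP i hi; split=> //.
  by apply: incl_trans sqi; case: ltpq.
move=> [|i] hi; last exact: sP.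
by have [_ sq0] := hP 0%N (leq0n _); apply: strict_trans_incl sq0.
Qed.

Lemma prime_chain0 p : prime_ideal p -> prime_chain p 0.
Proof. by move=> pp; exists (fun _ => p); split=> [i _|i]; [split|]. Qed.

Lemma prime_chain_incl (p q : R -> Prop) k : incl p q -> prime_chain q k -> prime_chain p k.
Proof.
move=> spq [P [hP sP]]; exists P; split=> // i /hP [pi sqi]; split=> //; exact: incl_trans sqi.
Qed.

Definition powadd S k := modadd (idpow J k : R^o -> Prop) S.

Lemma submod_powadd S k : submod S -> submod (powadd S k).
Proof. by move=> sS; apply: submod_add => //; apply: ideal_idpow. Qed.

Lemma finlen_powadd S k : submod S -> finlen submod (powadd S k) full.
Proof.
move=> sS; apply: (finlen_killed Rnoeth Hloc HJ (fin_gen_regular R) (k := k)) => //.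
  exact: submod_powadd.
move=> a x Ja _; apply: incl_addl => //.
by have [_ _ h] := ideal_idpow J k; rewrite -[_ *: _]/(a * x) mulrC; apply: h.
Qed.

Definition colength S k := len submod (powadd S k) full.

Lemma colength_le S S' k : submod S -> submod S' -> incl S S' ->
  (colength S' k <= colength S k)%N.
Proof.
move=> sS sS' sSS'; apply: (proj2 (finlen_sub (finlen_powadd k sS) _ _ _ _ _)) => //.
- exact: submod_powadd.
- by apply: modadd_mono.
Qed.

Lemma colength0 S : submod S -> colength S 0 = 0%N.
Proof.
move=> sS; rewrite /colength [powadd _ _](_ : _ = full).
  exact/lenE/is_length_refl.
by apply: pred_ext => // x _; apply: incl_addl.
Qed.

(** In R / (S + J^k) the submodule generated by y is cyclic with annihilator containing
    [powadd q l], and the quotient by it is R / (S + (y) + J^k). *)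
Lemma colength_adj S y k l q : submod S -> submod q ->
  (forall r, powadd q l r -> powadd S k (r * y)) ->
  (colength S k <= colength q l + colength (adj S y) k)%N.
Proof.
move=> sS sq h; have sSk := submod_powadd k sS.
have e1 : powadd (adj S y) k = modadd (image (line y) full) (powadd S k).
  apply: pred_ext => _ [a [b [ha hb ->]]].
    case: hb => [b' [s [Ib Ss ->]]]; exists b', (a + s); rewrite addrCA; split=> //.
    by exists a, s.
  case: hb => [b' [s [Ib Ss ->]]]; exists b', (a + s); rewrite addrCA; split=> //.
  by exists a, s.
have sadj := submod_adj y sS.
rewrite [colength S k]/colength.
have [||_ _ ->] := len_add_le (finlen_powadd k sS) (submod_powadd k sadj).
- by apply: modadd_mono => //; apply: adj_incl.
- by [].
rewrite -/(colength (adj S y) k) leq_add2r e1 -len_transport // meet_idr //.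
apply: (proj2 (finlen_sub (finlen_powadd l sq) _ _ _ _ _)) => //.
exact: submod_preimage.
Qed.

Lemma prime_mm_maximal p : prime_ideal p -> p = mm \/ strict p mm.
Proof.
by case=> ip np1 _; apply: eq_or_strict; apply: (proper_sub_mm Hloc).
Qed.

(** Take x in J outside p. As x J^k lies in J^(k+1), passing from k to k + 1 costs at most the
    colength of p + (x), whose filtration factors belong to primes strictly above p and fall under
    the induction. Summing over k raises the exponent by one. *)
Lemma colength_bound D p : prime_ideal p -> (forall k, prime_chain p k -> (k <= D)%N) ->
  exists C, forall k, (colength p k <= C * k.+1 ^ D)%N.
Proof.
elim: D p => [|D IH] p pp dp; have [ip np1 pM] := pp.
  have e : p = mm.
    case: (prime_mm_maximal pp) => // ltp.
    by have := dp 1%N (prime_chain_cons pp ltp (prime_chain0 (prime_mm Hloc))).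
  exists (len submod mm full) => k; rewrite muln1.
  apply: (proj2 (finlen_sub (finlen_mm Hloc) _ _ _ _ _)) => //; first exact: submod_powadd.
  by rewrite e; apply: incl_addr; apply: ideal_idpow.
have aux ys S : submod S -> strict p S -> pfilt S ys ->
    exists C, forall k, (colength S k <= C * k.+1 ^ D)%N.
  elim: ys S => [|y ys IHy] S sS ltpS /=.
    move=> ->; exists 0%N => k; rewrite /colength [powadd _ _](_ : _ = full).
      by rewrite (lenE (is_length_refl _)).
    by apply: pred_ext => // x _; apply: incl_addr => //; apply: ideal_idpow.
  move=> [pq fys]; have sq : incl S (colon S y).
    by move=> s Ss; rewrite /colon -[_ *: _]/(s * y) mulrC; apply: (submodZ sS).
  have ltpq := strict_trans_incl ltpS sq.
  have [|C1 h1] := IH _ pq.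
    by move=> k ck; rewrite -ltnS; apply: dp; apply: prime_chain_cons ck.
  have [|C2 h2] := IHy _ (submod_adj y sS) _ fys.
    by apply: strict_trans_incl ltpS _; apply: adj_incl.
  exists (C1 + C2)%N => k; rewrite mulnDl.
  apply: leq_trans (leq_add (h1 k) (h2 k)); apply: (colength_adj (q := colon S y)) => //.
    by case: pq.
  move=> _ [a [b [Ja Sb ->]]]; rewrite mulrDl; exists (a * y), (b * y); split=> //.
  by rewrite mulrC; have [_ _ h] := ideal_idpow J k; apply: h.
have [e|[x [Jx npx]]] : p = mm \/ exists x, J x /\ ~ p x.
  case: (classic (incl J p)) => [sJp|nJp]; [left; exact: (prime_over_J Hloc HJ) | right].
  by apply: NNPP => h; apply: nJp => x Jx; apply: NNPP => npx; apply: h; exists x.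
- exists (len submod mm full) => k; apply: (@leq_trans (len submod mm full)); last first.
    by rewrite leq_pmulr // expn_gt0.
  apply: (proj2 (finlen_sub (finlen_mm Hloc) _ _ _ _ _)) => //; first exact: submod_powadd.
  by rewrite e; apply: incl_addr; apply: ideal_idpow.
have [ys fys] := pfilt_exists Rnoeth (fin_gen_regular R) (@submod_adj R R^o p x ip).
have ltp : strict p (@adj R R^o p x) by split; [apply: adj_incl | exists x; split=> //; apply: (@adj_mem R R^o)].
have [C hC] := aux ys _ (@submod_adj R R^o p x ip) ltp fys.
exists C => k; suff : (colength p k <= C * k * k.+1 ^ D)%N.
  move=> h; apply: leq_trans h _; rewrite expnS mulnA leq_mul2r; apply/orP; right.
  by rewrite leq_mul2l leqnSn orbT.
elim: k => [|k IHk]; first by rewrite colength0.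
apply: (@leq_trans (colength p k + colength (adj p x) k.+1)).
  apply: colength_adj => // _ [a [b [Ja pb ->]]]; rewrite mulrDl; exists (a * x), (b * x).
  split=> //; first by rewrite mulrC idpowS; apply: idmul_in.
  by rewrite mulrC; apply: (submodZ ip).
apply: leq_trans (leq_add IHk (hC k.+1)) _; rewrite [(C * k.+1)%N]mulnSr mulnDl leq_add2r.
by rewrite leq_mul2l; apply/orP; right; case: (D) => // D'; rewrite leq_exp2r.
Qed.

End HilbertSamuel.

(** * Filtrations of prime quotients *)

Section ColonFamilies.
Variables (R : comUnitRingType) (mm J : R -> Prop).
Hypotheses (Rnoeth : noetherian R) (Hloc : local_with mm) (HJ : primary_to mm J).
Variables (d : nat) (Js : 'I_d.+1 -> R -> Prop).
Hypotheses (iJs : forall i, ideal (Js i)) (J0 : Js ord0 = J).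
Local Notation idx := 'X_{1..d.+1}.
Local Notation U0 := (U_(@ord0 d))%MM.
Local Notation setc0 n := (setc n (@ord0 d) 0).
Implicit Types (n m u v : idx).

Lemma setc0_U0 n k : setc0 (n + U0 *+ k)%MM = setc0 n.
Proof.
apply/mnmP => i; rewrite !setcE; case: eqP => // /eqP ni.
by rewrite mnmDE mulmnE mnm1E eq_sym (negPf ni) addn0.
Qed.

Lemma setc0_U n i : i != ord0 -> setc0 (n + U_(i))%MM = (setc0 n + U_(i))%MM.
Proof.
move=> ni; apply/mnmP => j; rewrite !(mnmDE, setcE, mnm1E); case: (eqVneq j ord0) => // ->.
by rewrite (negPf ni).
Qed.

Lemma setc0_id n : n ord0 = 0%N -> setc0 n = n.
Proof. by move=> n0; rewrite -{2}(setc_id n ord0) n0. Qed.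

Lemma mnm_U00 n k : (n + U0 *+ k)%MM ord0 = (n ord0 + k)%N.
Proof. by rewrite mnmDE mulmnE mnm1E eqxx mul1n. Qed.

Section OneModule.
Variables (N : lmodType R) (Nfg : fin_gen N).
Local Notation fam := (idx -> N -> Prop).
Local Notation submod := (@submod R N).
Implicit Types (F : fam) (T : N -> Prop).

Definition decreasing F := forall n, incl (F (n + U0)%MM) (F n).
Definition hf F n := len submod (F (n + U0)%MM) (F n).
(** For a decreasing family, the sum of [hf] over first coordinates below that of n, written as a
    single length. *)
Definition Hf F n := len submod (F n) (F (setc0 n)).

Lemma decreasing_add F n k : decreasing F -> incl (F (n + U0 *+ k)%MM) (F n).
Proof.
move=> dF; elim: k => [|k IH]; first by rewrite mulm0n addm0.
by rewrite mulmSr addmA; apply: incl_trans IH; apply: dF.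
Qed.

Lemma finlen_add F n k : subfam F -> jstable Js F -> decreasing F ->
  finlen submod (F (n + U0 *+ k)%MM) (F n).
Proof.
move=> sF jF dF; apply: (finlen_killed Rnoeth Hloc HJ Nfg (k := k)) => //.
  exact: decreasing_add.
move=> a x Ja Fx; rewrite addmC; apply: (pw_jstable (Js := Js)) => //.
by rewrite pwUn J0.
Qed.

Lemma finlen_hf F n : subfam F -> jstable Js F -> decreasing F ->
  finlen submod (F (n + U0)%MM) (F n).
Proof. by move=> sF jF dF; rewrite -[U0]mulm1n; apply: finlen_add. Qed.

Lemma finlen_Hf F n : subfam F -> jstable Js F -> decreasing F ->
  finlen submod (F n) (F (setc0 n)).
Proof. by move=> sF jF dF; rewrite {1}(setc_add n ord0); apply: finlen_add. Qed.

Lemma Hf_add F n k : subfam F -> jstable Js F -> decreasing F ->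
  Hf F (n + U0 *+ k)%MM = (len submod (F (n + U0 *+ k)%MM) (F n) + Hf F n)%N.
Proof.
move=> sF jF dF; rewrite /Hf setc0_U0; apply: len_add; first exact: finlen_add.
exact: finlen_Hf.
Qed.

Lemma Hf_succ F n : subfam F -> jstable Js F -> decreasing F ->
  (Hf F (n + U0)%MM)%:R - (Hf F n)%:R = (hf F n)%:R :> rat.
Proof.
by move=> sF jF dF; rewrite /hf -[U0]mulm1n Hf_add // natrD addrK.
Qed.

Lemma Hf_qpoly F : subfam F -> jstable Js F -> decreasing F ->
  qpoly (fun n => (hf F n)%:R) -> qpoly (fun n => (Hf F n)%:R).
Proof.
move=> sF jF dF qh; apply: (@qpoly_antidiff _ _ (fun n => (hf F n)%:R) ord0) => //.
  apply: qpoly_ext (qpoly_const _ 0) => n.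
  by rewrite /Hf setc_setc (lenE (is_length_refl _)).
by move=> n; apply: Hf_succ.
Qed.

Lemma hf_qpoly F S : subfam F -> jstable Js F -> decreasing F -> submod S ->
  (forall n, incl S (F n)) -> lef F (PN Js S) -> qpoly (fun n => (hf F n)%:R).
Proof.
move=> sF jF dF sS SF FP; have [xs gxs] := gens_exists iJs Rnoeth.
have [sA stA SA A0] := ambientP sS xs.
have jA : jstable Js (ambient S xs) by apply/(jstable_gens gxs).
apply: (hilbert_qpoly (xs := xs) (A := F) (B := fun n => F (n + U0)%MM)) => //.
- exact/(jstable_gens gxs).
- apply/(jstable_gens gxs) => // i r n y Jr Fy; rewrite addmAC; exact: jF.
- move=> G gG; apply: (gacc_ambient sS (acc_mod Rnoeth Nfg) (xs := xs)) => k.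
  have [sG stG FG GF] := gG k; split=> //.
    by move=> n; apply: incl_trans (FG n).
  move=> n; apply: incl_trans (GF n) _; apply: incl_trans (FP n) _.
  by apply: PN_sub => // r y pr; rewrite -[n]addm0; apply: (pw_jstable (Js := Js)).
- by move=> n; apply: finlen_hf.
Qed.

Lemma decreasing_PN T : submod T -> decreasing (PN Js T).
Proof. by move=> sT n; apply: PN_le => //; apply: lem_addr. Qed.

(** One ideal factor at a time: Artin-Rees in the J direction, applied to M(n) = PN(n) meet PN(n' +
    U_i) with n' the vector n with first coordinate 0, loses a constant c i. Peeling off the factors
    of I^n loses at most max c i for each. *)
Lemma linear_artin_rees T : submod T -> exists c, forall n k, n ord0 = 0%N ->
  incl (meet (PN Js T (U0 *+ (k + c * mdeg n))%MM) (PN Js T n)) (PN Js T (n + U0 *+ k)%MM).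
Proof.
move=> sT.
have h i : exists c, forall n k, n ord0 = 0%N ->
    incl (meet (PN Js T (n + U0 *+ (k + c))%MM) (PN Js T (n + U_(i))%MM))
         (PN Js T (n + U_(i) + U0 *+ k)%MM).
  pose M n := meet (PN Js T n) (PN Js T (setc0 n + U_(i))%MM).
  have [||||c hc] := @artin_rees R N _ Js iJs T M sT _ _ _ _ Rnoeth Nfg.
  - by move=> n; apply: submod_meet; apply: submod_PN.
  - move=> j r n y Jr [P1 P2]; split; first exact: jstable_PN.
    case: (eqVneq j ord0) => [->|nj].
      by rewrite -[U0]mulm1n setc0_U0; apply: submodZ => //; apply: submod_PN.
    by rewrite setc0_U // addmAC; apply: jstable_PN.
  - by move=> n z Tz; split; apply: PN_incl.
  - by move=> n z [].
  exists c => n k n0 z [P1 P2].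
  have [||a [b [Ha Tb ->]]] := hc (U0 *+ k)%MM (n + U0 *+ c)%MM _ z.
  - move=> j; case: (eqVneq j ord0) => [->|nj]; [right|left].
      by rewrite mnm_U00 leq_addl.
    by rewrite mulmnE mnm1E eq_sym (negPf nj).
  - have e1 : (U0 *+ k + (n + U0 *+ c) = n + U0 *+ (k + c))%MM.
      by apply/mnmP => j; rewrite !mnmDE !mulmnE mulnDr; lia.
    by rewrite e1; split=> //; rewrite setc0_U0 setc0_id.
  apply: submodD; [exact: submod_PN | | exact: PN_incl].
  move: a Ha; apply: modmul_sub; first exact: submod_PN.
  move=> r a pr [_ Pa]; rewrite addmC; apply: (pw_jstable (Js := Js)) => //.
  - by move=> ?; apply: submod_PN.
  - exact: jstable_PN.
  - by move: Pa; rewrite setc0_U0 setc0_id.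
pose c i := proj1_sig (constructive_indefinite_description _ (h i)).
exists (\max_i c i)%N => n; have [D] := ubnP (mdeg n); elim: D n => // D IH n; rewrite ltnS => dn k n0.
have [en|nn] := eqVneq n 0%MM.
  by rewrite en mdeg0 muln0 addn0 add0m => z [].
have /existsP [i ni] : [exists i, n i != 0%N].
  apply: contraNT nn; rewrite negb_exists => /forallP h0.
  by apply/eqP/mnmP => i; rewrite mnm0E; apply/eqP/negPn.
have nio : i != ord0 by apply: contraNneq ni => ->; rewrite n0.
move: ni; rewrite -lep1mP => /submK en; set n' := (n - U_(i))%MM in en.
have n'0 : n' ord0 = 0%N by rewrite mnmBE n0.
rewrite -en mdegD mdeg1 addn1 mulnS => z [P1 P2].
have P3 : PN Js T (n' + U0 *+ (k + \max_i c i))%MM z.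
  apply: IH => //; first by apply: leq_trans dn; rewrite -en mdegD mdeg1 addn1.
  split; first by rewrite -addnA.
  by apply: PN_le P2 => //; apply: lem_addr.
have := proj2_sig (constructive_indefinite_description _ (h i)); apply=> //; split=> //.
apply: PN_le P3 => //; apply/mnm_lepP => j; rewrite !mnmDE !mulmnE leq_add2l leq_mul2l.
by rewrite leq_add2l (leq_bigmax i) orbT.
Qed.

End OneModule.
End ColonFamilies.

Lemma lineZ (R : comUnitRingType) (N : lmodType R) (y : N) (r : R) (a : R^o) :
  line y (r *: a) = r *: line y a.
Proof. exact: (esym (scalerA r a y)). Qed.

Lemma len_meet_le (R : comUnitRingType) (M : lmodType R) (A X Y : M -> Prop) :
  submod A -> submod X -> finlen (@submod R M) Y X -> incl A X ->
  finlen (@submod R M) (meet A Y) A /\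
  (len (@submod R M) (meet A Y) A <= len (@submod R M) Y X)%N.
Proof.
move=> sA sX fYX sAX; have sY := finlen_Subl fYX; have YX := finlen_incl fYX.
have [h1 h2] : finlen (@submod R M) Y (modadd (image idfun A) Y) /\
    (len (@submod R M) Y (modadd (image idfun A) Y) <= len (@submod R M) Y X)%N.
  apply: finlen_sub => //.
  - by apply: submod_add => //; apply: submod_image.
  - by apply: incl_addr; apply: submod_image.
  - by apply: incl_add => // _ [z Az ->]; apply: sAX.
by split; [apply/(finlen_transport idfun sA sY) | rewrite (len_transport idfun sA sY)].
Qed.

Lemma growth_linear e (f : 'X_{1..e.+1} -> rat) C c D :
  (forall n, `|f n| <= C * (c * (1 + mdeg n)%:R) ^+ D) -> growth D.+1 f.
Proof.
move=> h; exists (C * c ^+ D), 0%N => n _; rewrite exprSr mulrA; apply: ler_wpM2r => //.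
by apply: le_trans (h n) _; rewrite exprMn mulrA.
Qed.

Section Colons.
Variables (R : comUnitRingType) (mm J : R -> Prop).
Hypotheses (Rnoeth : noetherian R) (Hloc : local_with mm) (HJ : primary_to mm J).
Variables (d : nat) (Js : 'I_d.+1 -> R -> Prop).
Hypotheses (iJs : forall i, ideal (Js i)) (J0 : Js ord0 = J).
Local Notation idx := 'X_{1..d.+1}.
Local Notation U0 := (U_(@ord0 d))%MM.
Local Notation setc0 n := (setc n (@ord0 d) 0).
Implicit Types (n m u v : idx).

Section Colon.
Variables (N : lmodType R) (Nfg : fin_gen N) (T : N -> Prop) (y : N).
Hypotheses (sT : submod T).

(** The filtration induced on R by that of N / T along r -> r y. It may differ from the powers of
    the ideals modulo (T : y), and Artin-Rees measures by how much. *)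
Definition col n : R^o -> Prop := preimage (line y) (PN Js T n).

Lemma subfam_col : subfam col.
Proof. by move=> n; apply/submod_preimage/submod_PN. Qed.

Lemma jstable_col : jstable Js col.
Proof.
move=> i r n a Jr ca; rewrite /col /preimage linearZ; apply: jstable_PN => //.
Qed.

Lemma decreasing_col : decreasing col.
Proof. by move=> n a; apply: decreasing_PN. Qed.

Lemma colon_col n : incl (colon T y) (col n).
Proof. by move=> a Ta; apply: PN_incl. Qed.

(** The counterpart of [col] inside N. [hf_qpoly] asks for a family between a fixed submodule and
    its [PN]; this is immediate here, whereas [col] has no evident such bound in R. *)
Let colmod n : N -> Prop := meet (adj T y) (PN Js T n).

Let subfam_colmod : subfam colmod.
Proof. by move=> n; apply: submod_meet; [apply: submod_adj | apply: submod_PN]. Qed.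

Let jstable_colmod : jstable Js colmod.
Proof.
move=> i r n a Jr [h1 h2]; split; last exact: jstable_PN.
by apply: submodZ => //; apply: submod_adj.
Qed.

Let colmod_ge n : incl T (colmod n).
Proof. by move=> z Tz; split; [apply: adj_incl | apply: PN_incl]. Qed.

Let colmod_le : lef colmod (PN Js T).
Proof. by move=> n z []. Qed.

Lemma col_qpoly : qpoly (fun n => (hf col n)%:R).
Proof.
have dc : decreasing colmod by move=> n z [h1 h2]; split=> //; apply: decreasing_PN h2.
apply: qpoly_ext (hf_qpoly Rnoeth Hloc HJ iJs J0 Nfg subfam_colmod jstable_colmod dc sT colmod_ge colmod_le) => n.
congr (_%:R); rewrite /hf; have := len_transport (line y) (subfam_col n) (subfam_colmod (n + U0)%MM).
have -> : meet (col n) (preimage (line y) (colmod (n + U0)%MM)) = col (n + U0)%MM.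
  apply: pred_ext => a; first by case=> _ [].
  move=> ca; split; first exact: decreasing_col.
  by split=> //; apply: incl_addl => //; exists a.
have -> // : modadd (image (line y) (col n)) (colmod (n + U0)%MM) = colmod n.
apply: pred_ext.
  apply: incl_add => //.
  by move=> _ [a ca ->]; split=> //; apply: incl_addl => //; exists a.
move=> z [[_ [t [[a _ ->] Tt ->]]] Pz]; exists (line y a), t; split=> //; last exact: colmod_ge.
exists a => //; have : PN Js T n (line y a + t - t).
  by apply: submodB => //; [apply: submod_PN | apply: PN_incl].
by rewrite addrK.
Qed.

Lemma col_Hf_qpoly : qpoly (fun n => (Hf col n)%:R).
Proof.
by apply: (Hf_qpoly Rnoeth Hloc HJ J0 (fin_gen_regular R) subfam_col jstable_col decreasing_col); apply: col_qpoly.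
Qed.

(** By linear Artin-Rees, elements of [col m] (m with first coordinate 0) lying in J^K + (T : y) are
    in [col n], where K is linear in |n|. So [Hf col n] is at most the colength of (T : y) at K, of
    order K^D. *)
Lemma col_growth D : prime_ideal (colon T y) ->
  (forall k, prime_chain (colon T y) k -> (k <= D)%N) ->
  growth D.+1 (fun n => (Hf col n)%:R).
Proof.
move=> pp dp; have [C hC] := colength_bound Rnoeth Hloc HJ pp dp.
have [c hc] := linear_artin_rees Rnoeth iJs Nfg sT.
have [ip _ _] := pp.
apply: (@growth_linear _ _ C%:R c.+1%:R) => n; rewrite ger0_norm // -natrM -natrX -natrM ler_nat.
set m := setc0 n; set k := n ord0; have en : n = (m + U0 *+ k)%MM by apply: setc_add.
have m0 : m ord0 = 0%N by rewrite setcE eqxx.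
set K := (k + c * mdeg m)%N.
have sub : incl (meet (col m) (powadd J (colon T y) K)) (col n).
  move=> a [ca [b [t [Jb Tt ea]]]]; rewrite en; apply: hc => //; split=> //.
  rewrite -/K ea linearD; apply: submodD; [exact: submod_PN | | exact: PN_incl].
  by apply: PN_in => //; rewrite pwUn J0.
have [f1 le1] := len_meet_le (subfam_col m) (@submod_full R R^o) (finlen_powadd Rnoeth Hloc HJ K ip) (fun _ _ => I).
have cn : incl (col n) (col m) by rewrite en; apply: decreasing_add; apply: decreasing_col.
have [_ le2] := finlen_sub f1 (subfam_col n) (subfam_col m) sub cn (@incl_refl _ _).
apply: leq_trans le2 (leq_trans le1 (leq_trans (hC K) _)).
rewrite leq_mul2l; apply/orP; right; case: D {dp hC} => // D; rewrite leq_exp2r // /K.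
have -> : mdeg n = (mdeg m + k)%N by rewrite en mdegD mdegMn mdeg1 mul1n.
nia.
Qed.

(** Artin-Rees in the J direction for the submodules x y col(m), m with first coordinate 0: such an
    element, if it also lies c steps deeper than J^k I^m N, belongs to J^k x y col(m), hence to x y
    col(n), modulo T. Then x cancels because (T : y) is prime. *)
Lemma col_colon x : prime_ideal (colon T y) -> ~ colon T y x ->
  exists c, forall n a, col (setc0 n) a -> col (n + U0 *+ c)%MM (x *: a) -> col n a.
Proof.
move=> pp npx; have [ip _ pM] := pp.
pose M n := meet (PN Js T n) (modadd (image (line (x *: y)) (col (setc0 n))) T).
have [||||c hc] := @artin_rees R N _ Js iJs T M sT _ _ _ _ Rnoeth Nfg.
- move=> n; apply: submod_meet; first exact: submod_PN.
  by apply: submod_add => //; apply: submod_image; apply: subfam_col.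
- move=> j r n z Jr [P1 [_ [t [[a ca ->] Tt ez]]]]; split; first exact: jstable_PN.
  exists (line (x *: y) (r *: a)), (r *: t); split; [|exact: submodZ|].
    exists (r *: a) => //; case: (eqVneq j ord0) => [->|nj].
      by rewrite -[U0]mulm1n setc0_U0; apply: submodZ => //; apply: subfam_col.
    by rewrite setc0_U //; apply: jstable_col.
  by rewrite ez scalerDr lineZ.
- move=> n z Tz; split; first exact: PN_incl.
  by apply: incl_addr => //; apply: submod_image; apply: subfam_col.
- by move=> n z [].
exists c => n a ca cxa; set m := setc0 n; set k := n ord0.
have en : n = (m + U0 *+ k)%MM by apply: setc_add.
have exa : line y (x *: a) = line (x *: y) a by rewrite /line !scalerA mulrC.
have [||b [t [Hb Tt eb]]] := hc (U0 *+ k)%MM (m + U0 *+ c)%MM _ (line y (x *: a)).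
- move=> j; case: (eqVneq j ord0) => [->|nj]; [right|left].
    by rewrite mnm_U00 leq_addl.
  by rewrite mulmnE mnm1E eq_sym (negPf nj).
- have -> : (U0 *+ k + (m + U0 *+ c) = n + U0 *+ c)%MM by rewrite en addmA (addmC _ m).
  by split=> //; rewrite exa setc0_U0; apply: incl_addl => //; exists a.
have [a' [t' [[a'' ca'' ea''] Tt' eb']]] : modadd (image (line (x *: y)) (col n)) T b.
  move: b Hb {eb}; apply: modmul_sub.
    by apply: submod_add => //; apply: submod_image; apply: subfam_col.
  move=> r z pr [_ [_ [t'' [[a'' ca'' ->] Tt'' ->]]]]; rewrite scalerDr.
  exists (line (x *: y) (r *: a'')), (r *: t''); split; [|exact: submodZ|by rewrite lineZ].
  exists (r *: a'') => //; rewrite en addmC; apply: (pw_jstable (Js := Js)) => //.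
  - exact: subfam_col.
  - exact: jstable_col.
  - by move: ca''; rewrite setc0_U0 setc_setc.
have : T (line y (x *: a) - line y (x *: a'')).
  have -> : line y (x *: a'') = line (x *: y) a'' by rewrite /line !scalerA mulrC.
  by rewrite eb eb' ea'' addrAC [_ + t' + _]addrAC subrr add0r; apply: submodD.
rewrite -linearB -scalerBr => h; have : colon T y (x * (a - a'')) by exact: h.
case/pM => // Taa; rewrite -(subrK a'' a); apply: submodD => //; first exact: subfam_col.
exact: colon_col.
Qed.

End Colon.
End Colons.

Lemma growth_evP e D D' (f : 'X_{1..e.+1} -> rat) : evP D' f -> growth D f -> evP D f.
Proof.
move=> [P [B [szP hP]]] gf; exists P, B; split=> //.
by apply: growth_msize gf _; exists B.
Qed.

(** f is its shift minus its difference along v, and the difference has smaller degree than f;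
    iterating brings the degree bound of f down to that of the shift. *)
Lemma evP_unshift e D D' v (f : 'X_{1..e.+1} -> rat) :
  evP D' f -> evP D (fun n => f (n + v)%MM) -> evP D f.
Proof.
elim: D' => [|D' IH] ef sf; first exact: evP_le ef.
case: (ltnP D' D) => [lt_D|le_D]; first exact: evP_le ef.
apply: IH => //; apply: evP_ext (evPB (evP_le le_D sf) (evP_diff v ef)).
by apply: eventually_true => n; rewrite opprB addrC subrK.
Qed.

(** * Filtrations that agree up to a shift *)

Section Compare.
Variables (R : comUnitRingType) (mm J : R -> Prop).
Hypotheses (Rnoeth : noetherian R) (Hloc : local_with mm) (HJ : primary_to mm J).
Variables (d : nat) (Js : 'I_d.+1 -> R -> Prop).
Hypotheses (iJs : forall i, ideal (Js i)) (J0 : Js ord0 = J).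
Local Notation idx := 'X_{1..d.+1}.
Local Notation U0 := (U_(@ord0 d))%MM.
Local Notation setc0 n := (setc n (@ord0 d) 0).
Local Notation submod := (@submod R R^o).
Implicit Types (n m u v : idx).

(** Multiplication by x, whose kernel modulo B(n + v) lies in A(n), gives Hf A n <= Hf B (n + v).
    The inclusion of B in A gives the reverse bound. A shift changes a function of degree at most D
    only in degree below D. *)
Lemma compare_Hf (A B : idx -> R^o -> Prop) (x : R) c1 c2 D :
  subfam A -> jstable Js A -> decreasing A -> subfam B -> jstable Js B -> decreasing B ->
  lef B A -> (forall n a, A n a -> B n (x *: a)) ->
  (forall n a, A (setc0 n) a -> A (n + U0 *+ c1)%MM (x *: a) -> A n a) ->
  (forall n a, B (setc0 n) a -> B (n + U0 *+ c2)%MM (x *: a) -> B n a) ->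
  evP D.+1 (fun n => (Hf A n)%:R) -> evP D.+1 (fun n => (Hf B n)%:R) ->
  evP D (fun n => (Hf A n)%:R - (Hf B n)%:R).
Proof.
move=> sA jA dA sB jB dB BA xAB cA cB eA eB.
set c := maxn c1 c2; set v := (U0 *+ c)%MM.
have leA n : incl (A (n + v)%MM) (A (n + U0 *+ c1)%MM).
  have -> : v = (U0 *+ c1 + U0 *+ (c - c1))%MM.
    by apply/mnmP => i; rewrite mnmDE !mulmnE -mulnDr subnKC // leq_maxl.
  by rewrite addmA; apply: decreasing_add.
have leB n : incl (B (n + v)%MM) (B (n + U0 *+ c2)%MM).
  have -> : v = (U0 *+ c2 + U0 *+ (c - c2))%MM.
    by apply/mnmP => i; rewrite mnmDE !mulmnE -mulnDr subnKC // leq_maxr.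
  by rewrite addmA; apply: decreasing_add.
have finA n := finlen_Hf Rnoeth Hloc HJ J0 (fin_gen_regular R) n sA jA dA.
have finB n := finlen_Hf Rnoeth Hloc HJ J0 (fin_gen_regular R) n sB jB dB.
have leAB n : (Hf A n <= Hf B (n + v)%MM)%N.
  have fI := finB (n + v)%MM; rewrite setc0_U0 in fI.
  have sI : submod (modadd (image (homothety x) (A (setc0 n))) (B (n + v)%MM)).
    by apply: submod_add => //; apply: submod_image.
  have [||f1 le1] := finlen_sub fI (sB (n + v)%MM) sI (@incl_refl _ _).
  - by apply: incl_addr; apply: submod_image.
  - by apply: incl_add => [|_ [a Aa ->]|]; [| apply: xAB | apply: finlen_incl fI].
  move: f1 le1 => /(finlen_transport (homothety x) (sA _) (sB _)) f1.
  rewrite -(len_transport (homothety x) (sA _) (sB _)) => le1.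
  rewrite /Hf setc0_U0; apply: leq_trans le1.
  apply: (proj2 (finlen_sub f1 _ _ _ _ _)) => //.
  - by move=> a [A0 Bx]; apply: cA => //; apply: leA; apply: BA.
  - exact: finlen_incl (finA n).
have leBA n : (Hf B n <= Hf A (n + v)%MM)%N.
  have fA := finA (n + v)%MM; rewrite setc0_U0 in fA.
  have [f1 le1] := len_meet_le (sB (setc0 n)) (sA (setc0 n)) fA (BA _).
  rewrite /Hf setc0_U0; apply: leq_trans le1.
  apply: (proj2 (finlen_sub f1 _ _ _ _ _)) => //.
  - by move=> a [B0 Aa]; apply: cB => //; apply: leB; apply: xAB.
  - exact: finlen_incl (finB n).
(* After shifting by v, the two inequalities bound the difference by the sum of the increments of Hf
   A and Hf B along v. *)
apply: (@evP_unshift _ _ D.+1 v); first exact: evPB.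
apply: (@growth_evP _ _ D.+1); first exact: (evP_shift v (evPB eA eB)).
apply: growth_dom (evP_growth (evPD (evP_diff v eA) (evP_diff v eB))) _.
apply: eventually_true => n.
have : ((Hf A n)%:R <= (Hf B (n + v)%MM)%:R :> rat) by rewrite ler_nat.
have : ((Hf B n)%:R <= (Hf A (n + v)%MM)%:R :> rat) by rewrite ler_nat.
have : ((Hf A n)%:R <= (Hf A (n + v)%MM)%:R :> rat).
  by rewrite ler_nat (Hf_add Rnoeth Hloc HJ J0 (fin_gen_regular R)) // leq_addl.
have : ((Hf B n)%:R <= (Hf B (n + v)%MM)%:R :> rat).
  by rewrite ler_nat (Hf_add Rnoeth Hloc HJ J0 (fin_gen_regular R)) // leq_addl.
move=> h1 h2 h3 h4; rewrite [X in _ <= X]ger0_norm; last by lra.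
by rewrite ler_norml; apply/andP; split; lra.
Qed.

Lemma prime_idprods (p : R -> Prop) e (Ks : 'I_e -> R -> Prop) s (k : 'I_e -> nat) :
  prime_ideal p -> incl (idprods Ks s k) p -> exists i, incl (Ks i) p.
Proof.
move=> pp; elim: s => [/(_ 1 I)|i s IH /=]; first by case: pp => _ np1 _ /np1.
by move=> /(prime_idmul pp) [/(prime_idpow pp)|//]; exists i.
Qed.

Lemma prime_pw (p : R -> Prop) n : prime_ideal p -> (forall i, ~ incl (Js i) p) ->
  exists x, pw Js n x /\ ~ p x.
Proof.
move=> pp hp; apply: NNPP => h; have [|i] := @prime_idprods p _ Js (enum 'I_d.+1) n pp; last exact: hp.
by move=> x px; apply: NNPP => npx; apply: h; exists x.
Qed.

Lemma col_regular (p : R^o -> Prop) : submod p -> col Js p (1 : R^o) = PN Js p.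
Proof.
move=> sp; apply: functional_extensionality => n.
by apply: pred_ext => a h; [rewrite -[a]mulr1 | apply: (eq_ind_r (PN Js p n) h (mulr1 (a : R)))].
Qed.

Lemma colon_regular (p : R^o -> Prop) : colon p (1 : R^o) = p.
Proof.
have e1 (a : R) : a *: (1 : R^o) = a by apply: mulr1.
by apply: pred_ext => a; rewrite /colon e1.
Qed.

Section WithModule.
Variables (N : lmodType R) (Nfg : fin_gen N) (T : N -> Prop) (y : N).
Hypotheses (sT : @Defs.submod R N T) (pp : prime_ideal (colon T y)).
Local Notation p := (colon T y).

(** Artin-Rees in all directions at once for R y + T with the filtration induced from N. The
    subtraction is truncated, so coordinates with n i <= c force u i = 0, where [artin_rees] asks
    nothing of v i. *)
Lemma col_sub_regular : exists c, forall n u, (forall i, u i <= n i - c)%N ->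
  incl (col Js T y n) (PN Js (N := R^o) p u).
Proof.
pose M n := meet (adj T y) (PN Js T n).
have [||||c hc] := @artin_rees R N _ Js iJs T M sT _ _ _ _ Rnoeth Nfg.
- by move=> n; apply: submod_meet; [apply: submod_adj | apply: submod_PN].
- move=> i r n a Jr [h1 h2]; split; last exact: jstable_PN.
  by apply: submodZ => //; apply: submod_adj.
- by move=> n z Tz; split; [apply: adj_incl | apply: PN_incl].
- by move=> n z [].
exists c => n u hu a ca.
have le_un : (u <= n)%MM by apply/mnm_lepP => i; apply: leq_trans (hu i) (leq_subr _ _).
have [||b [t [Hb Tt eb]]] := hc u (n - u)%MM _ (line y a).
- move=> i; have [|h] := posnP (u i); [by left | right].
  by rewrite mnmBE; have := hu i; lia.
- rewrite addmC submK //; split=> //; by apply: incl_addl => //; exists a.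
have [_ [t' [[b' pb' ->] Tt' eb']]] : modadd (image (line y) (pw Js u)) T b.
  have ipw : submod (pw Js u) by apply: ideal_pw.
  move: b Hb {eb}; apply: modmul_sub; first by apply: submod_add => //; apply: submod_image.
  move=> r z pr [[_ [t' [[b' _ ->] Tt' ->]]] _]; rewrite scalerDr.
  exists (line y (r *: b')), (r *: t'); split; [|exact: submodZ|by rewrite lineZ].
  exists (r *: b') => //; rewrite -[_ *: _]/(r * b') mulrC.
  by have [_ _ h] := ideal_pw Js u; apply: h.
have Tab : p (a - b').
  have : T (line y a - line y b').
    by rewrite eb eb' addrAC [_ + t' + _]addrAC subrr add0r; apply: submodD.
  by rewrite -linearB.
exists b', (a - b'); split=> //; last by rewrite addrC subrK.
by have := @modmul_in R R^o _ (@modfull R R^o) b' 1 pb' I; rewrite -[_ *: _]/(b' * 1) mulr1.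
Qed.

Lemma compare_regular D : (forall k, prime_chain p k -> (k <= D.+1)%N) ->
  (forall i, ~ incl (Js i) p) ->
  evP D (fun n => (hf (col Js T y) n)%:R - (hf (PN Js (N := R^o) p) n)%:R).
Proof.
move=> dp hp; have [ip _ _] := pp.
have sp : submod p by exact: ip.
have [c hc] := col_sub_regular.
(* x is taken in the product of the c-th powers of all the ideals, which makes up for the loss of c
   in [col_sub_regular]; it exists outside p because p contains none of the ideals. *)
have [x [px npx]] := prime_pw [multinom c | i < d.+1] pp hp.
have e1 := colon_regular p; have e2 := col_regular sp.
have pp1 : prime_ideal (colon (p : R^o -> Prop) (1 : R^o)) by rewrite e1.
have sP : subfam (PN Js (N := R^o) p) by move=> n; apply: submod_PN.
have jP : jstable Js (PN Js (N := R^o) p) by apply: jstable_PN.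
have dP : decreasing (PN Js (N := R^o) p) by apply: decreasing_PN.
have sC : subfam (col Js T y) by apply: subfam_col.
have jC : jstable Js (col Js T y) by apply: jstable_col.
have dC : decreasing (col Js T y) by apply: decreasing_col.
have [c1 hc1] := col_colon Rnoeth iJs Nfg sT pp npx.
have [c2 hc2] : exists c, forall n a, PN Js (N := R^o) p (setc0 n) a ->
    PN Js (N := R^o) p (n + U0 *+ c)%MM (x *: a) -> PN Js (N := R^o) p n a.
  rewrite -e2; apply: (col_colon Rnoeth iJs (fin_gen_regular R) sp pp1).
  by rewrite e1.
have eA : evP D.+2 (fun n => (Hf (col Js T y) n)%:R).
  by apply: qpoly_evP (col_growth Rnoeth Hloc HJ iJs J0 Nfg sT pp dp); apply: (col_Hf_qpoly Rnoeth Hloc HJ).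
have eB : evP D.+2 (fun n => (Hf (PN Js (N := R^o) p) n)%:R).
  rewrite -e2; apply: qpoly_evP; first by apply: (col_Hf_qpoly Rnoeth Hloc HJ iJs J0 (fin_gen_regular R)).
  by apply: (col_growth Rnoeth Hloc HJ iJs J0 (fin_gen_regular R) sp pp1); rewrite e1.
have := compare_Hf (x := x) sC jC dC sP jP dP _ _ hc1 hc2 eA eB.
case=> [||P [B [szP hP]]].
- move=> n; apply: PN_sub; [exact: subfam_col | exact: colon_col |].
  move=> r z pr; have -> : r *: z = z *: (r : R^o) by apply: mulrC.
  by apply: submodZ; [apply: sC | apply: PN_in].
- move=> n a ca; have := hc n [multinom (n i - c)%N | i < d.+1] _ a ca; case.
    by move=> i; rewrite mnmE.
  move=> b [t [Hb pt ->]]; rewrite scalerDr; apply: submodD => //; last first.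
    by apply: PN_incl; apply: (submodZ sp).
  move: b Hb; apply: modmul_sub; first exact: (submod_colon x (sP n)).
  move=> r z pr _; rewrite scalerA; apply: (@PN_in R R^o) => //.
  apply: (@pw_le _ _ Js n ([multinom c | i < d.+1] + [multinom (n i - c)%N | i < d.+1])%MM).
    by apply/mnm_lepP => i; rewrite mnmDE !mnmE; lia.
  by rewrite pwD; apply: idmul_in.
have eF : evP D.+1 (fun n => (Hf (col Js T y) n)%:R - (Hf (PN Js (N := R^o) p) n)%:R : rat).
  by exists P, B.
(* Taking the difference along J turns [Hf] into [hf] and lowers the degree by one. *)
apply: evP_ext (evP_diff U0 eF); apply: eventually_true => n.
rewrite -(Hf_succ Rnoeth Hloc HJ J0 (fin_gen_regular R) n sC jC dC).
rewrite -(Hf_succ Rnoeth Hloc HJ J0 (fin_gen_regular R) n sP jP dP).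
ring.
Qed.

End WithModule.
End Compare.

(** * Finiteness of the Krull dimension *)

Section Dimension.
Variables (R : comUnitRingType) (mm J : R -> Prop).
Hypotheses (Rnoeth : noetherian R) (Hloc : local_with mm) (HJ : primary_to mm J).
Implicit Types (p q S : R^o -> Prop).
Local Notation submod := (@submod R R^o).
Local Notation full := (@modfull R R^o).

(** The Hilbert-Samuel function is the case of the single ideal J, so the results on [col] apply to
    it. *)
Let Js (i : 'I_1) := J.
Let iJs (i : 'I_1) : ideal (Js i). Proof. by case: HJ. Qed.

Definition samuel S (n : 'X_{1..1}) : rat := (colength J S (n ord0))%:R.

Lemma PN_powadd S n : submod S -> PN Js S n = powadd J S (n ord0).
Proof.
move=> sS; have -> : n = (U_(ord0) *+ n ord0)%MM.
  by apply/mnmP => i; rewrite ord1 mulmnE mnm1E eqxx mul1n.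
rewrite /PN pwUn mulmnE mnm1E eqxx mul1n; congr modadd.
rewrite -[LHS]/(idmul (idpow J (n ord0)) (@idfull R)) idmulC idmul1 //.
exact: ideal_idpow.
Qed.

Lemma samuel_Hf S : submod S -> samuel S =1 fun n => (Hf (PN Js (N := R^o) S) n)%:R.
Proof.
move=> sS n; rewrite /samuel /Hf /colength !PN_powadd // setcE eqxx.
congr (_%:R); congr len; apply: pred_ext => // x _; apply: incl_addl => //.
Qed.

Lemma samuel_qpoly S : submod S -> qpoly (samuel S).
Proof.
move=> sS; apply: qpoly_ext (fun n => esym (samuel_Hf sS n)) _; rewrite -(col_regular Js sS).
by apply: (col_Hf_qpoly Rnoeth Hloc HJ iJs erefl (fin_gen_regular R)).
Qed.

(** Take x in q outside p. By [col_colon], the ideal generated by x in R / (p + J^(k+c)) has length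
    at least the colength of p at k, and its cokernel maps onto R / (q + J^(k+c)). So the Samuel
    function of q is bounded by a difference of that of p. *)
Lemma samuel_drop D p q : prime_ideal p -> submod q -> strict p q ->
  evP D.+1 (samuel p) -> evP D (samuel q).
Proof.
move=> pp sq [spq [x [qx npx]]] ep; have [ip _ _] := pp; have sp : submod p := ip.
have pp1 : prime_ideal (colon (p : R^o -> Prop) (1 : R^o)) by rewrite colon_regular.
have [c hc] : exists c, forall n a, PN Js (N := R^o) p (setc n ord0 0) a ->
    PN Js (N := R^o) p (n + U_(ord0) *+ c)%MM (x *: a) -> PN Js (N := R^o) p n a.
  rewrite -(col_regular Js sp); apply: (col_colon Rnoeth iJs (fin_gen_regular R) sp pp1).
  by rewrite colon_regular.
set v := (U_(ord0) *+ c : 'X_{1..1})%MM.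
have vk n : (n + v)%MM ord0 = (n ord0 + c)%N by rewrite /v mnm_U00.
have key k : (colength J p k + colength J q (k + c) <= colength J p (k + c))%N.
  rewrite [colength J p (k + c)]/colength.
  have sY := submod_powadd J (k + c) sp.
  have [||_ fZ ->] := len_add_le (finlen_powadd Rnoeth Hloc HJ (k + c) sp) (submod_adj (x : R^o) sY).
  - exact: adj_incl.
  - by [].
  apply: leq_add.
    rewrite /adj -len_transport // meet_idr //.
    have f1 : finlen submod (preimage (line (x : R^o)) (powadd J p (k + c))) full.
      have := finlen_powadd Rnoeth Hloc HJ (k + c) sp.
      move=> f; apply: (proj1 (finlen_sub f _ _ _ _ _)) => //; first exact: submod_preimage.
      move=> a /(submodZ sY x); have -> // : x *: a = line (x : R^o) a by apply: mulrC.
    apply: (proj2 (finlen_sub f1 _ _ _ _ _)) => //; first exact: submod_powadd.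
    move=> a Ya; have := hc [multinom k | _ < 1] a.
    rewrite !PN_powadd // mnmE mnm_U00 mnmE setcE eqxx; apply.
      by apply: incl_addl.
    by have -> : x *: a = a *: (x : R^o) by apply: mulrC.
  apply: (proj2 (finlen_sub fZ _ _ _ _ _)) => //; first exact: submod_powadd.
  apply: adj_sub; first exact: submod_powadd.
    by apply: modadd_mono.
  by apply: incl_addr => //; apply: ideal_idpow.
have [D' eq] := qpoly_evP_ex (samuel_qpoly sq).
apply: evP_unshift eq (growth_evP (evP_shift v eq) _).
apply: growth_dom (evP_growth (evP_diff v ep)) _; apply: eventually_true => n.
rewrite /samuel !vk -natrB; last by apply: leq_trans (key _); apply: leq_addr.
by rewrite !normr_nat ler_nat leq_subRL; [apply: key | apply: leq_trans (key _); apply: leq_addr].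
Qed.

Lemma colength_gt0 p k : ideal p -> ~ p 1 -> (0 < colength J p k.+1)%N.
Proof.
move=> ip np1; have [im nm1 _] := Hloc.
apply: len_gt0; first exact: (finlen_powadd Rnoeth Hloc HJ k.+1 (ip : submod p)).
split; first by move=> x _.
exists 1; split; [by [] | case=> a [b [Ja pb e1]]]; apply: nm1; rewrite e1.
have pm := proper_sub_mm Hloc ip np1.
case: im => _ mD _; apply: mD; last exact: pm.
have aJ : J a by have := idpow_le (A := J) (m := 1) (n := k.+1) isT Ja; rewrite idpow1 //; case: HJ.
by case: HJ => _ /(_ a) [h _]; apply: h; exists 1%N; rewrite expr1.
Qed.

(** Each strict inclusion lowers the degree by one, and the Samuel function of a proper ideal is not
    eventually zero. *)
Lemma samuel_chain k D (P : nat -> R -> Prop) : (forall i, (i <= k)%N -> prime_ideal (P i)) ->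
  (forall i, (i < k)%N -> strict (P i) (P i.+1)) -> evP D (samuel (P 0%N)) -> (k < D)%N.
Proof.
elim: k D P => [|k IH] D P hP sP e0; have [ip np1 _] := hP 0%N (leq0n _).
  case: D e0 => // -[Q [B [szQ hQ]]]; have Q0 : Q = 0 by apply/eqP; rewrite -msize_poly_eq0 -leqn0.
  have := hQ [multinom B.+1 | _ < 1]; rewrite Q0 meval0 /samuel mnmE => h.
  have /eqP : (colength J (P 0%N) B.+1)%:R = 0 :> rat by apply: h => i; rewrite mnmE.
  by rewrite pnatr_eq0; have := colength_gt0 B ip np1; case: colength.
case: D e0 => [|D] e0.
  by have := IH 0%N P (fun i h => hP i (leqW h)) (fun i h => sP i (leqW h)) e0.
rewrite ltnS; apply: (IH _ (fun i => P i.+1)).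
- by move=> i hi; apply: hP.
- by move=> i hi; apply: sP.
- by apply: samuel_drop (sP 0%N _) e0 => //; [apply: hP | case: (hP 1%N)].
Qed.

(** The Samuel function of R dominates that of every prime, so one degree bounds all chains; this
    makes [krull_dim] a true maximum. *)
Lemma prime_chain_bounded : exists D, forall (A : R -> Prop) k, prime_chain A k -> (k < D)%N.
Proof.
have s0 : submod (@modzero R R^o) by apply: submod_zero.
have [D e0] := qpoly_evP_ex (samuel_qpoly s0).
exists D => A k [P [hP sP]]; apply: (samuel_chain (P := P)) => //.
  by move=> i /hP [].
have [[ip _ _] _] := hP 0%N (leq0n _).
have [D' e1] := qpoly_evP_ex (samuel_qpoly (ip : submod (P 0%N))).
apply: growth_evP e1 _; apply: growth_dom (evP_growth e0) _.
apply: eventually_true => n; rewrite /samuel !normr_nat ler_nat; apply: (colength_le Rnoeth Hloc HJ) => //.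
by move=> _ ->; apply: (submod0 (ip : submod _)).
Qed.

Lemma krull_dimP (A p : R -> Prop) : prime_ideal p -> incl A p -> is_dim A (krull_dim A).
Proof.
move=> pp sAp; have [D hD] := prime_chain_bounded.
have c0 : prime_chain A 0 by apply: prime_chain_incl sAp _; apply: prime_chain0.
apply: (epsilon_spec (inhabits 0%N) (is_dim A)).
apply: NNPP => h; suff H k : exists2 l, (k <= l)%N & prime_chain A l.
  by have [l le_Dl /hD] := H D; rewrite ltnNge le_Dl.
elim: k => [|k [l le_kl cl]]; first by exists 0%N.
apply: NNPP => h'; apply: h; exists l; split=> // m cm; rewrite leqNgt; apply/negP => lt_lm.
by apply: h'; exists m => //; apply: leq_ltn_trans lt_lm.
Qed.

End Dimension.

(** * Length of a localization *)

Section Localization.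
Variables (R : comUnitRingType) (N : lmodType R) (p : R -> Prop).
Hypothesis pp : prime_ideal p.
Implicit Types (S T : N -> Prop) (L : N * R -> Prop).
Local Notation submod := (@submod R N).
Local Notation loc_submod := (@loc_submod R N p).

Definition ind (P : Prop) : nat := if excluded_middle_informative P then 1 else 0.

Lemma indT P : P -> ind P = 1%N.
Proof. by rewrite /ind; case: excluded_middle_informative. Qed.

Lemma indF P : ~ P -> ind P = 0%N.
Proof. by rewrite /ind; case: excluded_middle_informative. Qed.

Lemma ind_le P Q : (P -> Q) -> (ind P <= ind Q)%N.
Proof.
move=> PQ; rewrite {1}/ind; case: excluded_middle_informative => // hP.
by rewrite indT //; apply: PQ.
Qed.

Fixpoint pcount S (ys : seq N) : nat :=
  if ys is y :: ys' then (ind (colon S y = p) + pcount (adj S y) ys')%N else 0%N.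

Lemma np1 : ~ p 1. Proof. by case: pp. Qed.

Lemma npM u v : ~ p u -> ~ p v -> ~ p (u * v).
Proof. by case: pp => _ _ h nu nv /h []. Qed.

Definition localize S : N * R -> Prop :=
  fun z => ~ p z.2 /\ exists u, ~ p u /\ S (u *: z.1).

Lemma loc_submod_localize S : submod S -> loc_submod (localize S).
Proof.
move=> sS; split.
- by move=> z [].
- move=> [x s] [y t] /= [ns [u [nu Su]]] nt [v [nv /= ev]]; split=> //=.
  exists (v * u * s); split; first by apply: npM => //; apply: npM.
  have -> : v * u * s *: y = (v * t) *: (u *: x).
    have : u *: (v *: (t *: x - s *: y)) = 0 by rewrite ev scaler0.
    rewrite !scalerBr !scalerA => /eqP; rewrite subr_eq0 => /eqP e1.
    rewrite (_ : v * u * s = u * v * s); last by rewrite (mulrC v).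
    by rewrite -e1; congr (_ *: _); ring.
  exact: submodZ.
- split=> /=; first exact: np1.
  by exists 1; split; [apply: np1 | rewrite scaler0; apply: submod0].
- move=> [x s] [y t] /= [ns [u [nu Su]]] [nt [v [nv Sv]]]; split=> /=; first exact: npM.
  exists (u * v); split; first exact: npM.
  rewrite scalerDr; apply: submodD => //.
    have -> : (u * v) *: (t *: x) = (v * t) *: (u *: x) by rewrite !scalerA; congr (_ *: _); ring.
    exact: submodZ.
  have -> : (u * v) *: (s *: y) = (u * s) *: (v *: y) by rewrite !scalerA; congr (_ *: _); ring.
  exact: submodZ.
- move=> r u [x s] /= nu [ns [v [nv Sv]]]; split=> /=; first exact: npM.
  exists v; split=> //; have -> : v *: (r *: x) = r *: (v *: x) by rewrite !scalerA mulrC.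
  exact: submodZ.
Qed.

(** Through [contraction], submodules of N_p become saturated submodules of N, where the prime
    filtration lives. *)
Definition saturated T := forall u x, ~ p u -> T (u *: x) -> T x.

Definition contraction L : N -> Prop := fun x => L (x, 1).

Lemma loc_submodE L x s : loc_submod L -> (L (x, s) <-> ~ p s /\ contraction L x).
Proof.
case=> L2 Leq L0 LD LZ; split=> [Lxs|[ns Lx]].
  have ns := L2 _ Lxs; split=> //; have := LZ s 1 _ np1 Lxs; rewrite /= mul1r => Ls.
  apply: (Leq _ (x, 1) Ls np1); exists 1; split; first exact: np1.
  by rewrite /= !scale1r subrr.
by have := LZ 1 s _ ns Lx; rewrite /= scale1r mulr1.
Qed.

Lemma submod_contraction L : loc_submod L -> submod (contraction L).
Proof.
case=> L2 Leq L0 LD LZ; split=> //.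
  by move=> x y Lx Ly; have := LD _ _ Lx Ly; rewrite /= !scale1r mulr1.
by move=> r x Lx; have := LZ r 1 _ np1 Lx; rewrite /= mulr1.
Qed.

Lemma saturated_contraction L : loc_submod L -> saturated (contraction L).
Proof.
move=> lL u x nu Lux; have /(loc_submodE _ _ lL) Luxu : ~ p u /\ contraction L (u *: x) by [].
have [_ Leq _ _ _] := lL; apply: (Leq _ (x, 1) Luxu np1); exists 1; split; first exact: np1.
by rewrite /= !scale1r subrr.
Qed.

Lemma contraction_incl L L' : loc_submod L -> loc_submod L' ->
  incl (contraction L) (contraction L') -> incl L L'.
Proof.
move=> lL lL' h [x s] /(loc_submodE _ _ lL) [ns Lx].
by apply/(loc_submodE _ _ lL'); split=> //; apply: h.
Qed.

(** Counts the factors R / p that T reaches after localization. It serves as a length for submodules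
    of N_p and bounds their chains without an additivity theorem for [loc_submod]. *)
Fixpoint rank T S (ys : seq N) : nat :=
  if ys is y :: ys' then
    (ind (colon S y = p /\ exists r, ~ p r /\ modadd T S (r *: y)) + rank T (adj S y) ys')%N
  else 0%N.

Lemma rank_le T S ys : (rank T S ys <= pcount S ys)%N.
Proof. by elim: ys S => //= y ys IH S; rewrite leq_add // ind_le // => -[]. Qed.

Lemma rank_mono T T' S ys : incl T T' -> (rank T S ys <= rank T' S ys)%N.
Proof.
move=> sTT'; elim: ys S => //= y ys IH S; rewrite leq_add // ind_le // => -[e [r [nr h]]].
by split=> //; exists r; split=> //; apply: modadd_mono h.
Qed.

Variable (A : R -> Prop).
Hypothesis minA : forall q, prime_ideal q -> incl A q -> incl q p -> q = p.

(** Contrapositive form of strict growth of [rank]: the inclusion of T' meet S in T is propagated up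
    the filtration until S is all of N. *)
Lemma rank_strict T T' S ys : submod T -> submod T' -> saturated T -> incl T T' ->
  submod S -> incl A (annq S) -> pfilt S ys ->
  incl (meet T' S) T -> (rank T' S ys <= rank T S ys)%N -> incl T' T.
Proof.
move=> sT sT' satT TT'; elim: ys S => [|y ys IH] S sS AS /=.
  by move=> -> h _; move: h; rewrite meet_idl // => x _.
move=> [pq fys] hS hr.
have Aadj : incl A (annq (adj S y)) by move=> a Aa x; apply: adj_incl; apply: AS.
have hm := rank_mono (adj S y) ys TT'.
set b := ind _ in hr; set b' := ind _ in hr.
have le_b : (b' <= b)%N.
  apply: ind_le => -[e [r [nr h]]]; split=> //; exists r; split=> //; exact: modadd_mono h.
have eb : b = b' by lia.
have hr' : (rank T' (adj S y) ys <= rank T (adj S y) ys)%N by lia.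
apply: IH Aadj fys _ hr'; first exact: submod_adj.
move=> z [T'z [_ [t [[r _ ->] St ez]]]].
have ry : line y r = z - t by rewrite ez addrK.
case: (classic (colon S y r)) => [Sr|nSr].
  by apply: hS; split=> //; rewrite ez; apply: submodD.
case: (classic (incl (colon S y) p)) => [sqp|nsqp]; last first.
  have [s [Ss nps]] : exists s, colon S y s /\ ~ p s.
    by apply: NNPP => h; apply: nsqp => s Ss; apply: NNPP => nps; apply: h; exists s.
  apply: (satT s) => //; apply: hS; split; first exact: submodZ.
  rewrite ez scalerDr; apply: submodD => //; last exact: submodZ.
  have -> : s *: line y r = r *: (s *: y) by rewrite /line !scalerA mulrC.
  exact: submodZ.
have e : colon S y = p.
  by apply: minA => //; move=> a Aa; apply: AS.
have b1 : b = 1%N.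
  apply: indT; split=> //; exists r; split; first by rewrite -e.
  exists z, (- t); split=> //; exact: submodN.
have : b' = 1%N by rewrite -eb.
rewrite /b' /ind; case: excluded_middle_informative => // -[_ [r' [nr' [w [t' [Tw St' ew]]]]]] _.
have npr : ~ p r by rewrite -e.
(* Modulo S, z is r y and w is r' y, so cross-multiplication cancels y; the result is in T' meet S,
   hence in T. *)
have hz : T (r' *: z - r *: w).
  apply: hS; split.
    by apply: submodB => //; apply: submodZ => //; apply: TT'.
  have -> : r' *: z - r *: w = r *: t' + r' *: t.
    have e1 : r' *: (z - t) = r *: (w + t') by rewrite -ry -ew /line !scalerA mulrC.
    move: e1; rewrite scalerBr scalerDr => /eqP; rewrite subr_eq => /eqP ->.
    by rewrite addrAC (addrAC (r *: w)) subrr add0r.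
  by apply: submodD => //; apply: submodZ.
apply: (satT r') => //; rewrite -(subrK (r *: w) (r' *: z)).
by apply: submodD => //; apply: submodZ.
Qed.

(** A factor R / p gives a strict step; any other factor belongs to a prime not contained in p, by
    minimality of p, and vanishes in the localization. *)
Lemma chain_localize S ys : submod S -> incl A (annq S) -> pfilt S ys ->
  chain_between loc_submod (localize S) (localize (@modfull R N)) (pcount S ys).
Proof.
elim: ys S => [|y ys IH] S sS AS /=.
  by move=> ->; apply: chain_nil; apply: loc_submod_localize.
move=> [pq fys]; have sadj := submod_adj y sS.
have Aadj : incl A (annq (adj S y)) by move=> a Aa x; apply: adj_incl; apply: AS.
apply: chain_cat (IH _ sadj Aadj fys).
have sub : incl (localize S) (localize (adj S y)).
  move=> z [nz [u [nu Su]]]; split=> //; exists u; split=> //; exact: adj_incl.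
have [e|ne] := classic (colon S y = p).
  rewrite indT //; apply: chain_rcons (chain_nil _) _ _; try exact: loc_submod_localize.
  split=> //; exists (y, 1); split.
    split=> /=; first exact: np1.
    by exists 1; split; [apply: np1 | rewrite scale1r; apply: adj_mem].
  by move=> [_ [u [nu /= Su]]]; apply: nu; rewrite -e.
rewrite indF //; have [s [Ss nps]] : exists s, colon S y s /\ ~ p s.
  apply: NNPP => h; apply: ne; apply: minA => //; first by move=> a Aa; apply: AS.
  by move=> s Ss; apply: NNPP => nps; apply: h; exists s.
have -> : localize (adj S y) = localize S.
  apply: pred_ext => // z [nz [u [nu [_ [t [[r _ ->] St eu]]]]]]; split=> //.
  exists (s * u); split; first exact: npM.
  rewrite -scalerA eu scalerDr; apply: submodD => //; last exact: submodZ.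
  have -> : s *: line y r = r *: (s *: y) by rewrite /line !scalerA mulrC.
  exact: submodZ.
by apply: chain_nil; apply: loc_submod_localize.
Qed.

(** W vanishes in N_p, being killed by an element outside p, so a filtration of N / W computes the
    length of N_p: [chain_localize] bounds it below, [rank] above. *)
Lemma loc_length_pcount W ys : submod W -> incl A (annq W) -> pfilt W ys ->
  (exists u, ~ p u /\ forall w, W w -> u *: w = 0) -> loc_length N p = pcount W ys.
Proof.
move=> sW AW fys [u0 [nu0 hu0]]; apply: lenE.
have eF : (fun z : N * R => ~ p z.2) = localize (@modfull R N).
  apply: pred_ext => [z nz|z []] //; split=> //; exists 1; split=> //; exact: np1.
have eZ : (fun z : N * R => ~ p z.2 /\ loc_equiv p z (0, 1)) = localize W.
  apply: pred_ext => [[x s] [ns [u [nu /= eu]]]|[x s] [ns [u [nu /= Wu]]]]; split=> //.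
    exists u; split=> //=; move: eu; rewrite scale1r scaler0 subr0 => ->; exact: submod0.
  exists (u0 * u); split; first exact: npM.
  by rewrite /= scale1r scaler0 subr0 -scalerA hu0.
rewrite eF eZ; split; first exact: chain_localize.
move=> m cm.
suff H l B : chain_between loc_submod (localize W) B l -> (l <= rank (contraction B) W ys)%N.
  exact: leq_trans (H _ _ cm) (rank_le _ _ _).
elim: l B => // l IH B /chainS [C [cC lB ltCB]].
have lC := chain_Subr cC; apply: leq_ltn_trans (IH _ cC) _; rewrite ltnNge; apply/negP => hr.
have [sCB _] := ltCB.
apply: (strict_nincl ltCB); apply: contraction_incl => //.
apply: (rank_strict (S := W) (ys := ys)) => //.
- exact: submod_contraction.
- exact: submod_contraction.
- exact: saturated_contraction.
- by move=> x; apply: sCB.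
- move=> x [_ Wx]; apply: (saturated_contraction lC nu0); rewrite hu0 //.
  exact: submod0 (submod_contraction lC).
Qed.

End Localization.

(** * Additivity of mixed multiplicities *)

Section Decomposition.
Variables (R : comUnitRingType) (mm J : R -> Prop).
Hypotheses (Rnoeth : noetherian R) (Hloc : local_with mm) (HJ : primary_to mm J).
Variables (d : nat) (Js : 'I_d.+1 -> R -> Prop).
Hypotheses (iJs : forall i, ideal (Js i)) (J0 : Js ord0 = J).
Variables (N : lmodType R) (Nfg : fin_gen N).
Local Notation idx := 'X_{1..d.+1}.
Local Notation U0 := (U_(@ord0 d))%MM.
Local Notation submod := (@submod R N).
Implicit Types (S T W : N -> Prop) (n : idx).

Lemma PN_adj S y n : PN Js (adj S y) n = adj (PN Js S n) y.
Proof.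
by apply: pred_ext => _ [a [b [ha [b' [s [hb hs ->]]] ->]]]; exists b', (a + s);
rewrite addrCA; split=> //; exists a, s.
Qed.

(** Additivity holds exactly because the submodule generated by y carries the induced filtration
    [col]; all errors are deferred to the comparison of [col] with the powers of the ideals. *)
Lemma hf_PN_adj S y n : submod S ->
  hf (PN Js S) n = (hf (col Js S y) n + hf (PN Js (adj S y)) n)%N.
Proof.
move=> sS; rewrite /hf !PN_adj.
have sX := submod_PN Js n sS; have sX' := submod_PN Js (n + U0)%MM sS.
have fX : finlen submod (PN Js S (n + U0)%MM) (PN Js S n).
  apply: (finlen_hf Rnoeth Hloc HJ J0 Nfg); first by move=> ?; apply: submod_PN.
    exact: jstable_PN.
  exact: decreasing_PN.
have XX' := finlen_incl fX.
have sA' := submod_adj y sX'.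
have sM := submod_meet sX sA'.
have [||_ _ ->] := len_add_le fX sM.
- by move=> z Xz; split; [apply: XX' | apply: adj_incl].
- by move=> z [].
have sC : @Defs.submod R R^o (col Js S y n) by apply: subfam_col.
congr (_ + _)%N.
  have := len_transport (line y) sC sX'.
  have -> : meet (col Js S y n) (preimage (line y) (PN Js S (n + U0)%MM)) = col Js S y (n + U0)%MM.
    by apply: meet_idr; apply: decreasing_col.
  move=> ->; congr len; apply: pred_ext; last first.
    apply: incl_add => //; last by move=> z Xz; split; [apply: XX' | apply: adj_incl].
    by move=> _ [a ca ->]; split=> //; apply: incl_addl => //; exists a.
  move=> z [Xz [_ [t [[a _ ->] Xt ez]]]]; exists (line y a), t; split=> //.
  exists a => //; have : PN Js S n (line y a + t - t) by rewrite -ez; apply: submodB => //; apply: XX'.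
  by rewrite addrK.
have := len_transport idfun sX sA'.
rewrite -[meet _ (preimage idfun _)]/(meet (PN Js S n) (adj (PN Js S (n + U0)%MM) y)) => ->.
congr len; apply: pred_ext.
  apply: incl_add; first exact: submod_adj.
    by move=> _ [z Xz ->]; apply: adj_incl.
  by apply: modadd_mono.
move=> _ [a [b [ha Xb ->]]]; exists b, a; split; [by exists b | by apply: incl_addl | by rewrite addrC].
Qed.

Fixpoint hsum S (ys : seq N) n : nat :=
  if ys is y :: ys' then (hf (col Js S y) n + hsum (adj S y) ys' n)%N else 0%N.

Lemma hf_hsum S ys n : submod S -> pfilt S ys -> hf (PN Js S) n = hsum S ys n.
Proof.
elim: ys S => [|y ys IH] S sS /=; last first.
  by case=> _ fys; rewrite (hf_PN_adj y) // IH //; apply: submod_adj.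
move=> eS; rewrite /hf; have e m : PN Js S m = @modfull R N.
  by rewrite eS; apply: pred_ext => // z _; apply: PN_incl.
by rewrite !e (lenE (is_length_refl _)).
Qed.

Lemma hf_col_evP S y D : submod S -> prime_ideal (colon S y) ->
  (forall k, prime_chain (colon S y) k -> (k <= D)%N) ->
  evP D (fun n => (hf (col Js S y) n)%:R).
Proof.
move=> sS pp dp.
have eA : evP D.+1 (fun n => (Hf (col Js S y) n)%:R).
  by apply: qpoly_evP (col_growth Rnoeth Hloc HJ iJs J0 Nfg sS pp dp); apply: (col_Hf_qpoly Rnoeth Hloc HJ).
apply: evP_ext (evP_diff U0 eA); apply: eventually_true => n.
apply: (Hf_succ Rnoeth Hloc HJ J0 (fin_gen_regular R)).
- exact: subfam_col.
- exact: jstable_col.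
- exact: decreasing_col.
Qed.

End Decomposition.

(** * The Hilbert polynomial of the statement, with J as ideal number 0 *)

Section HilbertPolynomial.
Variables (R : comUnitRingType) (J : R -> Prop) (d : nat) (Is : 'I_d -> R -> Prop).

Definition extend (i : 'I_d.+1) : R -> Prop := if unlift ord0 i is Some j then Is j else J.

Lemma extend0 : extend ord0 = J.
Proof. by rewrite /extend unlift_none. Qed.

Lemma extend_lift j : extend (lift ord0 j) = Is j.
Proof. by rewrite /extend liftK. Qed.

Lemma expvec0 n0 (n : 'I_d -> nat) : expvec n0 n ord0 = n0 :> nat.
Proof. by rewrite mnmE unlift_none. Qed.

Lemma expvec_lift n0 (n : 'I_d -> nat) j : expvec n0 n (lift ord0 j) = n j.
Proof. by rewrite mnmE liftK. Qed.

Lemma expvec_succ n0 (n : 'I_d -> nat) : expvec n0.+1 n = (expvec n0 n + U_(ord0))%MM.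
Proof.
apply/mnmP => i; rewrite mnmDE mnm1E; have [j ->|->] := unliftP ord0 i.
  by rewrite !expvec_lift eq_liftF addn0.
by rewrite !expvec0 eqxx addn1.
Qed.

Lemma expvecE (m : 'X_{1..d.+1}) : m = expvec (m ord0) (fun j => m (lift ord0 j)).
Proof.
by apply/mnmP => i; have [j ->|->] := unliftP ord0 i; rewrite ?expvec_lift ?expvec0.
Qed.

Lemma ptvec_expvec n0 (n : 'I_d -> nat) : ptvec n0 n = pt (expvec n0 n).
Proof. by apply: functional_extensionality => i; rewrite /ptvec /pt mnmE. Qed.

Lemma pw_extend n0 (n : 'I_d -> nat) :
  pw extend (expvec n0 n) = idmul (idpow J n0) (idprod Is n).
Proof.
rewrite /pw /idprod enum_ordSl /= extend0 expvec0; congr idmul.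
rewrite foldr_map; congr foldr; apply: functional_extensionality => j.
by rewrite extend_lift expvec_lift.
Qed.

Variables (N : lmodType R) (S : N -> Prop).

Lemma hilb_fun_hf n0 (n : 'I_d -> nat) :
  hilb_fun S J Is n0 n = hf (PN extend S) (expvec n0 n).
Proof. by rewrite /hf /PN -expvec_succ !pw_extend. Qed.

Lemma hilb_polyP : evP (qL S Is) (fun n => (hf (PN extend S) n)%:R) ->
  (msize (hilb_poly S J Is) <= qL S Is)%N /\
  eventually (fun n => (hf (PN extend S) n)%:R = (hilb_poly S J Is).@[pt n]).
Proof.
move=> [P [B [szP hP]]].
have : is_hilb_poly S J Is (hilb_poly S J Is).
  apply: (epsilon_spec (inhabits 0) (is_hilb_poly S J Is)); exists P; split=> //.
  exists B => n0 n hn0 hn; rewrite hilb_fun_hf ptvec_expvec; apply: hP => i.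
  by have [j ->|->] := unliftP ord0 i; rewrite ?expvec_lift ?expvec0.
case=> sz [C hC]; split=> //; exists C => n hn.
by rewrite (expvecE n) -hilb_fun_hf -ptvec_expvec; apply: hC.
Qed.

End HilbertPolynomial.

(** * The submodule killed by powers of I *)

Section Torsion.
Variables (R : comUnitRingType) (N : lmodType R) (I : R -> Prop).
Hypotheses (Rnoeth : noetherian R) (Nfg : fin_gen N).
Local Notation W := (colon_inf I (@modzero R N)).

Lemma submod_killed (A : R -> Prop) : submod (fun x : N => forall a, A a -> a *: x = 0).
Proof.
split=> [a _|x y hx hy a Aa|r x hx a Aa]; first exact: scaler0.
  by rewrite scalerDr hx // hy // addr0.
by rewrite scalerA mulrC -scalerA hx // scaler0.
Qed.

Lemma torsion_exponent : exists m, W = fun x : N => forall a, idpow I m a -> a *: x = 0.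
Proof.
have [m hm] : exists m, forall l, (m <= l)%N ->
    incl (fun x : N => forall a, idpow I l a -> a *: x = 0)
         (fun x : N => forall a, idpow I m a -> a *: x = 0).
  apply: (acc_mod Rnoeth Nfg (F := fun l x => forall a, idpow I l a -> a *: x = 0)).
    by move=> l; apply: submod_killed.
  by move=> l x hx a /(idpow_le (leqnSn l)); apply: hx.
exists m; apply: pred_ext => x; last by move=> hx; exists m.
case=> l hl; apply: (hm (maxn m l)); first exact: leq_maxl.
by move=> a /(idpow_le (leq_maxr m l)); apply: hl.
Qed.

Lemma submod_torsion : submod W.
Proof. by have [m ->] := torsion_exponent; apply: submod_killed. Qed.

(** N / W has no I-torsion: a single power of I kills W, and exponents add up. *)
Lemma torsion_closed t x : (forall a, idpow I t a -> W (a *: x)) -> W x.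
Proof.
have [m eW] := torsion_exponent; rewrite {1}eW => h; exists (m + t)%N.
rewrite idpowD; apply: idmul_sub; first by apply: ideal_colon; apply: submod_zero.
by move=> b a Ib Ia; rewrite /modzero -scalerA; apply: h.
Qed.

Lemma idpow_mono (A B : R -> Prop) t : incl A B -> incl (idpow A t) (idpow B t).
Proof.
move=> sAB; elim: t => // t IH; rewrite !idpowS; apply: idmul_sub; first exact: ideal_idmul.
by move=> a b Aa Ab; apply: idmul_in; [apply: sAB | apply: IH].
Qed.

(* Outside [p] only the filtration factors isomorphic to [R/p] survive. *)
Lemma pfilt_prime_power p S ys (A : R -> Prop) : prime_ideal p ->
  (forall q, prime_ideal q -> incl A q -> incl q p -> q = p) ->
  submod S -> incl A (annq S) -> pfilt S ys ->
  exists s t, ~ p s /\ forall a (x : N), idpow p t a -> S ((s * a) *: x).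
Proof.
move=> pp minA; elim: ys S => [|y ys IH] S sS AS /=.
  by move=> ->; exists 1, 0%N; split=> //; case: pp.
move=> [pq fys]; have sadj := submod_adj y sS.
have Aadj : incl A (annq (adj S y)) by move=> a Aa x; apply: adj_incl; apply: AS.
have [s [t [nps hs]]] := IH _ sadj Aadj fys.
have [e|ne] := classic (colon S y = p).
  exists s, t.+1; split=> // a x; rewrite idpowS; move: a; apply: idmul_sub.
    have -> : (fun a => S ((s * a) *: x)) = (fun a => S (a *: (s *: x))).
      by apply: functional_extensionality => a; rewrite scalerA mulrC.
    exact: ideal_colon.
  move=> b a pb pa; have [_ [z [[r _ ->] Sz ez]]] := hs a x pa.
  have -> : (s * (b * a)) *: x = b *: ((s * a) *: x) by rewrite scalerA; congr (_ *: _); ring.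
  rewrite ez scalerDr; apply: submodD => //; last exact: submodZ.
  have -> : b *: line y r = r *: (b *: y) by rewrite /line !scalerA mulrC.
  by apply: submodZ => //; rewrite -e in pb.
have [s' [Ss nps']] : exists s, colon S y s /\ ~ p s.
  apply: NNPP => h; apply: ne; apply: minA => //; first by move=> a Aa; apply: AS.
  by move=> r Sr; apply: NNPP => npr; apply: h; exists r.
exists (s' * s), t; split; first by case: pp => _ _ pM /pM [].
move=> a x pa; have [_ [z [[r _ ->] Sz ez]]] := hs a x pa.
rewrite -mulrA -scalerA ez scalerDr; apply: submodD => //; last exact: submodZ.
have -> : s' *: line y r = r *: (s' *: y) by rewrite /line !scalerA mulrC.
exact: submodZ.
Qed.

(** Some s outside p has s p^t N inside W. If I were contained in p, then s I^t N and hence s N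
    would lie in W, so s would be in Ann(N / W) and thus in p. *)
Lemma minimal_prime_not_incl p : minimal_prime_over (annq W) p -> ~ incl I p.
Proof.
move=> [pp Ap minp] sIp; have sW := submod_torsion.
have [ys fys] := pfilt_exists Rnoeth Nfg sW.
have minA q : prime_ideal q -> incl (annq W) q -> incl q p -> q = p.
  by move=> pq Aq sqp; apply: pred_ext => //; apply: minp.
have [s [t [nps hs]]] := pfilt_prime_power pp minA sW (@incl_refl _ _) fys.
apply: nps; apply: Ap => x; apply: (torsion_closed (t := t)) => a Ia.
by rewrite scalerA mulrC; apply: hs; apply: idpow_mono Ia.
Qed.

End Torsion.

Section Torsionless.
Variables (R : comUnitRingType) (mm J : R -> Prop).
Hypotheses (Rnoeth : noetherian R) (Hloc : local_with mm) (HJ : primary_to mm J).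
Variables (d : nat) (Is : 'I_d -> R -> Prop).
Hypothesis iIs : forall i, ideal (Is i).
Variables (N : lmodType R) (Nfg : fin_gen N).
Local Notation Js := (extend J Is).
Local Notation U0 := (U_(@ord0 d))%MM.
Local Notation submod := (@submod R N).
Local Notation W := (colon_inf (Iall Is) (@modzero R N)).

Lemma ideal_extend i : ideal (Js i).
Proof. by rewrite /extend; case: unlift => [j|] //; case: HJ. Qed.

Lemma idpow_Iall m : idpow (Iall Is) m = idprod Is (fun _ => m).
Proof.
elim: m => [|m IH]; first by symmetry; apply: idprods0.
by rewrite idpowS IH; symmetry; apply: (idprodsD Is (enum 'I_d) (fun _ => 1%N) (fun _ => m)).
Qed.

Lemma Iall_incl j : incl (Iall Is) (Is j).
Proof.
rewrite -[X in incl _ X](pwU (iIs j)).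
have -> : Iall Is = pw Is [multinom 1%N | _ < d].
  by rewrite /Iall /pw; congr idprod; apply: functional_extensionality => i; rewrite mnmE.
by apply: pw_le => //; apply/mnm_lepP => i; rewrite mnm1E mnmE leq_b1.
Qed.

(** By Artin-Rees an element of the intersection lies in a large product of the ideals times W, and
    a fixed power of I kills W. *)
Lemma PN_meet_torsion : eventually (fun n => incl (meet (PN Js (@modzero R N) n) W) (@modzero R N)).
Proof.
have s0 := @submod_zero R N; have sW := submod_torsion (Iall Is) Rnoeth Nfg.
have [m eW] := torsion_exponent (Iall Is) Rnoeth Nfg.
pose M n := meet (PN Js (@modzero R N) n) W.
have [||||c hc] := @artin_rees R N _ Js ideal_extend (@modzero R N) M s0 _ _ _ _ Rnoeth Nfg.
- by move=> n; apply: submod_meet => //; apply: submod_PN.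
- move=> i r n y Jr [Py Wy]; split; [by apply: jstable_PN => //; apply: ideal_extend | exact: submodZ].
- by move=> n _ ->; apply: submod0; apply: submod_meet => //; apply: submod_PN.
- by move=> n y [].
(* m is the power of I that kills W, c the Artin-Rees constant. *)
exists (m + c)%N => n hn y My; pose v : 'X_{1..d.+1} := [multinom c | _ < d.+1].
have le_v : (v <= n)%MM.
  by apply/mnm_lepP => i; rewrite mnmE; apply: leq_trans (leq_addl _ _) (hn i).
have [||z [_ [Mz -> ->]]] := hc (n - v)%MM v _ y.
- by move=> i; right; rewrite mnmE.
- by rewrite submK.
rewrite addr0; move: z Mz; apply: modmul_sub => // r z pr [_ Wz].
move: Wz; rewrite eW; apply; rewrite idpow_Iall.
have : pw Js (expvec 0 (fun _ => m)) r.
  apply: pw_le pr; apply/mnm_lepP => i; rewrite mnmBE [v i]mnmE; have := hn i.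
  have [j ->|->] := unliftP ord0 i; rewrite ?expvec_lift ?expvec0 //; lia.
by rewrite pw_extend idmul1 //; apply: idprods_ideal.
Qed.

(** Adding W to two nested submodules changes no length once the larger one meets W in 0. *)
Lemma hf_torsion : eventually (fun n =>
  hf (PN Js (@modzero R N)) n = hf (PN Js W) n).
Proof.
have s0 := @submod_zero R N; have sW := submod_torsion (Iall Is) Rnoeth Nfg.
apply: eventually_imp PN_meet_torsion => n h; rewrite /hf.
set X := PN Js (@modzero R N) n; set X' := PN Js (@modzero R N) (n + U0)%MM.
have sX : submod X by apply: submod_PN.
have sX' : submod X' by apply: submod_PN.
have XX' : incl X' X.
  by apply: decreasing_PN.
have eP m : PN Js W m = modadd (PN Js (@modzero R N) m) W.
  apply: pred_ext => [_ [a [w [ha hw ->]]]|_ [_ [w [[a [_ [ha -> ->]]] hw ->]]]].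
    by exists a, w; split=> //; apply: incl_addl.
  by exists a, w; rewrite addr0.
rewrite !eP -/X -/X'.
have sY : submod (modadd X' W) by apply: submod_add.
have := len_transport idfun sX sY.
have -> : meet X (preimage idfun (modadd X' W)) = X'.
  apply: pred_ext => [z [Xz [x' [w [hx' hw ez]]]]|z X'z]; last first.
    by split; [apply: XX' | apply: incl_addl].
  have {}ez : z = x' + w := ez.
  have w0 : w = 0.
    apply: h; split=> //; have -> : w = z - x' by rewrite ez addrAC subrr add0r.
    by apply: submodB => //; apply: XX'.
  by rewrite ez w0 addr0.
move=> ->; congr len; apply: pred_ext.
  apply: incl_add; first exact: submod_add.
    by move=> _ [z Xz ->]; apply: incl_addl.
  by apply: modadd_mono.
move=> _ [z [w [Xz hw ->]]]; exists z, w; split=> //; first by exists z.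
by apply: incl_addr.
Qed.

End Torsionless.

(** * Summation over the primes of maximal dimension *)

Section Main.
Variables (R : comUnitRingType) (mm J : R -> Prop).
Hypotheses (Rnoeth : noetherian R) (Hloc : local_with mm) (HJ : primary_to mm J).
Variables (d : nat) (Is : 'I_d -> R -> Prop).
Hypothesis iIs : forall i, ideal (Is i).
Variables (N : lmodType R) (Nfg : fin_gen N).
Local Notation Js := (extend J Is).
Local Notation submod := (@submod R N).
Local Notation W := (colon_inf (Iall Is) (@modzero R N)).
Local Notation dimN := (mdim W).
Hypothesis HI : ~ incl (Iall Is) (radical (annq (@modzero R N))).

Let iJs := @ideal_extend R mm J HJ d Is iIs.
Let J0 := @extend0 R J d Is.
Let sW := submod_torsion (Iall Is) Rnoeth Nfg.

Lemma ideal_annq (S : N -> Prop) : submod S -> ideal (annq S).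
Proof.
move=> sS; split=> [x|a b ha hb x|r a ha x]; first by rewrite scale0r; apply: submod0.
  by rewrite scalerDl; apply: submodD.
by rewrite -scalerA; apply: submodZ.
Qed.

Lemma annq_torsion_proper : incl (annq W) mm.
Proof.
apply: (proper_sub_mm Hloc); first exact: ideal_annq.
move=> h1; apply: HI => a Ia; have [m eW] := torsion_exponent (Iall Is) Rnoeth Nfg.
exists m => x; have := h1 x; rewrite scale1r eW; apply.
elim: m {eW} => // m IH; rewrite exprS idpowS; exact: idmul_in.
Qed.

Lemma is_dim_torsion : is_dim (annq W) dimN.
Proof. exact: (krull_dimP Rnoeth Hloc HJ (prime_mm Hloc) annq_torsion_proper). Qed.

(** A prime properly below p and above Ann(N / W) would extend the given chain beyond the
    dimension. *)
Lemma big_prime_minimal p : prime_ideal p -> incl (annq W) p -> prime_chain p dimN ->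
  minimal_prime_over (annq W) p /\ krull_dim p = dimN.
Proof.
move=> pp Ap cp; have [_ hd] := is_dim_torsion; split.
  split=> // p' pp' Ap' sp'p.
  have [->//|ltp] := eq_or_strict sp'p.
  have := hd _ (prime_chain_incl Ap' (prime_chain_cons pp' ltp cp)).
  by rewrite ltnn.
have [c1 h1] := krull_dimP Rnoeth Hloc HJ pp (@incl_refl _ p).
by apply/eqP; rewrite eqn_leq h1 // andbT hd //; apply: prime_chain_incl c1.
Qed.

Variables (D : nat).
Hypothesis dimD : dimN = D.+1.

(** p contains no I_j since it does not contain their product; containing J would make p maximal,
    leaving no room for a chain of length D + 1. *)
Lemma big_prime_not_extend p : minimal_prime_over (annq W) p -> krull_dim p = dimN ->
  forall i, ~ incl (Js i) p.
Proof.
move=> mp dp i; have [pp _ _] := mp; have [j ->|->] := unliftP ord0 i.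
  rewrite extend_lift => h; apply: (minimal_prime_not_incl Rnoeth Nfg mp).
  by apply: incl_trans h; apply: Iall_incl.
rewrite extend0 => h; have pm := prime_over_J Hloc HJ pp h.
have [cp _] := krull_dimP Rnoeth Hloc HJ pp (@incl_refl _ p).
move: cp; rewrite dp dimD => -[P [hP sP]].
have [[iP1 nP1 _] _] := hP 1%N isT; have [_ sP0] := hP 0%N isT.
apply: (strict_nincl (sP 0%N isT)); apply: incl_trans sP0; rewrite pm.
exact: (proper_sub_mm Hloc).
Qed.

Variable Pi : seq (R -> Prop).
Local Notation pi i := (nth (fun _ => False) Pi i).
Hypothesis HPi1 : forall i, (i < size Pi)%N ->
  minimal_prime_over (annq W) (pi i) /\ krull_dim (pi i) = dimN.
Hypothesis HPi2 : forall p : R -> Prop, minimal_prime_over (annq W) p ->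
  krull_dim p = dimN -> exists2 i, (i < size Pi)%N & seteq (pi i) p.
Hypothesis HPi3 : forall i j, (i < size Pi)%N -> (j < size Pi)%N ->
  seteq (pi i) (pi j) -> i = j.

Lemma chain_pi i : (i < size Pi)%N -> prime_ideal (pi i) /\ is_dim (pi i) D.+1.
Proof.
move=> /HPi1 [[pp _ _] dp]; split=> //; rewrite -dimD -dp.
exact: (krull_dimP Rnoeth Hloc HJ pp (@incl_refl _ _)).
Qed.

Lemma hf_pi_evP i : (i < size Pi)%N -> evP D.+1 (fun n => (hf (PN Js (N := R^o) (pi i)) n)%:R).
Proof.
move=> /chain_pi [pp [_ hd]]; have [ip _ _] := pp.
have := @hf_col_evP R mm J Rnoeth Hloc HJ d Js iJs J0 R^o (fin_gen_regular R) (pi i) 1 D.+1 ip.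
by rewrite colon_regular col_regular //; apply.
Qed.

Lemma hsum_evP S ys : submod S -> incl (annq W) (annq S) -> pfilt S ys ->
  evP D.+1 (fun n => (hsum Js S ys n)%:R) /\
  evP D (fun n => (hsum Js S ys n)%:R -
    \sum_(i < size Pi) (pcount (pi i) S ys)%:R * (hf (PN Js (N := R^o) (pi i)) n)%:R).
Proof.
have [_ hd] := is_dim_torsion.
elim: ys S => [|y ys IH] S sS AS /=.
  move=> _; split; first exact: evP0.
  apply: evP_ext (evP0 _ D); apply: eventually_true => n.
  by rewrite big1 ?subrr // => i _; rewrite mul0r.
move=> [pq fys]; have sadj := submod_adj y sS.
have Aadj : incl (annq W) (annq (adj S y)) by move=> a Aa x; apply: adj_incl; apply: AS.
have [e1 e2] := IH _ sadj Aadj fys.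
have Aq : incl (annq W) (colon S y) by move=> a Aa; apply: AS.
have bq k : prime_chain (colon S y) k -> (k <= D.+1)%N.
  by move=> /(prime_chain_incl Aq) /hd; rewrite dimD.
have e3 := hf_col_evP Rnoeth Hloc HJ iJs J0 Nfg sS pq bq.
split; first by apply: evP_ext (evPD e3 e1); apply: eventually_true => n; rewrite natrD.
suff e4 : evP D (fun n => (hf (col Js S y) n)%:R -
    \sum_(i < size Pi) (ind (colon S y = pi i))%:R * (hf (PN Js (N := R^o) (pi i)) n)%:R).
  apply: evP_ext (evPD e4 e2); apply: eventually_true => n.
  rewrite addrACA -opprD -big_split natrD; congr (_ - _); apply: eq_bigr => i _.
  by rewrite natrD mulrDl.
(* A chain of length D + 1 puts the colon ideal in [Pi], and distinctness of the entries leaves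
   exactly one nonzero indicator. Otherwise the factor has dimension at most D and is itself an
   error term, while all indicators vanish. *)
have [c|nc] := classic (prime_chain (colon S y) D.+1).
  have [mq dq] : minimal_prime_over (annq W) (colon S y) /\ krull_dim (colon S y) = dimN.
    by apply: big_prime_minimal => //; rewrite dimD.
  have [i0 lt_i0 /seteq_eq ei0] := HPi2 mq dq.
  have := compare_regular Rnoeth Hloc HJ iJs J0 Nfg sS pq bq (big_prime_not_extend mq dq).
  apply: evP_ext; apply: eventually_true => n; congr (_ - _).
  rewrite (bigD1 (Ordinal lt_i0)) //= indT // mul1r ei0 big1 ?addr0 // => i ni.
  rewrite indF ?mul0r // => ei; case/eqP: ni; apply: val_inj => /=.
  by apply: HPi3 => [|//|x]; [apply: ltn_ord | rewrite ei0 -ei].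
have e5 : evP D (fun n => (hf (col Js S y) n)%:R).
  apply: (hf_col_evP Rnoeth Hloc HJ iJs J0 Nfg sS pq) => k ck.
  have := bq k ck; rewrite leq_eqVlt => /orP [/eqP ek|//].
  by case: nc; rewrite -ek.
apply: evP_ext e5; apply: eventually_true => n; rewrite big1 ?subr0 // => i _.
rewrite indF ?mul0r // => ei; apply: nc; rewrite ei.
by have [_ []] := chain_pi (ltn_ord i).
Qed.

(** R / p has no I-torsion since I is not inside p, so its Hilbert polynomial is chosen under the
    same degree bound q as that of N. *)
Lemma qL_pi i : (i < size Pi)%N -> qL (N := R^o) (pi i) Is = D.+1.
Proof.
move=> lti; have [mp dp] := HPi1 lti; have [pp _ _] := mp; have [[iD _ _]] := pp.
have e1 : colon_inf (N := R^o) (Iall Is) (pi i) = pi i.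
  apply: pred_ext => x; last first.
    move=> px; exists 0%N => a _; rewrite -[_ *: _]/(a * x); by have [[_ _ h] _ _] := pp; apply: h.
  case=> m h; apply: NNPP => npx; apply: (minimal_prime_not_incl Rnoeth Nfg mp).
  apply: (prime_idpow (n := m) pp) => a Ia.
  by have [_ _ pM] := pp; case: (pM a x (h a Ia)).
have e2 : annq (N := R^o) (pi i) = pi i.
  apply: pred_ext => a; first by move=> h; rewrite -[a]mulr1; apply: h.
  move=> pa x; rewrite -[_ *: _]/(a * x) mulrC; by have [[_ _ h] _ _] := pp; apply: h.
by rewrite /qL e1 /mdim e2 dp.
Qed.

Lemma loc_length_pi i ys : (i < size Pi)%N -> pfilt W ys ->
  loc_length N (pi i) = pcount (pi i) W ys.
Proof.
move=> lti fys; have [mp dp] := HPi1 lti; have [pp _ minp] := mp.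
apply: (loc_length_pcount pp (A := annq W)) => //.
  by move=> q pq Aq sqp; apply: pred_ext => //; apply: minp.
have [m eW] := torsion_exponent (Iall Is) Rnoeth Nfg.
have [u [Iu npu]] : exists u, idpow (Iall Is) m u /\ ~ pi i u.
  apply: NNPP => h; apply: (minimal_prime_not_incl Rnoeth Nfg mp).
  by apply: (prime_idpow (n := m) pp) => a Ia; apply: NNPP => npa; apply: h; exists a.
by exists u; split=> // w; rewrite eW; apply.
Qed.

Lemma hilb_coef_additive (m : 'X_{1..d.+1}) : mdeg m = D ->
  (hilb_poly (@modzero R N) J Is)@_m =
  \sum_(i < size Pi) (loc_length N (pi i))%:R * (hilb_poly (N := R^o) (pi i) J Is)@_m.
Proof.
move=> dm; have [ys fys] := pfilt_exists Rnoeth Nfg sW.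
have [e1 e2] := hsum_evP sW (@incl_refl _ _) fys.
have hN : eventually (fun n => hf (PN Js (@modzero R N)) n = hsum Js W ys n).
  apply: eventually_imp (hf_torsion Rnoeth HJ iIs Nfg) => n ->.
  exact: (hf_hsum Rnoeth Hloc HJ iJs J0 Nfg).
have [_ hP] : (msize (hilb_poly (@modzero R N) J Is) <= qL (@modzero R N) Is)%N /\
   eventually (fun n => (hf (PN Js (@modzero R N)) n)%:R = (hilb_poly (@modzero R N) J Is).@[pt n]).
  apply: hilb_polyP; rewrite /qL dimD; apply: evP_ext e1.
  by apply: eventually_imp hN => n ->.
have hPi i : (i < size Pi)%N -> eventually (fun n => (hf (PN Js (N := R^o) (pi i)) n)%:R
    = (hilb_poly (N := R^o) (pi i) J Is).@[pt n]).
  by move=> lti; apply: (proj2 (hilb_polyP _)); rewrite qL_pi //; apply: hf_pi_evP.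
have hall : eventually (fun n => forall i : 'I_(size Pi), (hf (PN Js (N := R^o) (pi i)) n)%:R
    = (hilb_poly (N := R^o) (pi i) J Is).@[pt n]).
  have hB (i : 'I_(size Pi)) := hPi i (ltn_ord i).
  pose B i := proj1_sig (constructive_indefinite_description _ (hB i)).
  exists (\max_i B i)%N => n hn i.
  have := proj2_sig (constructive_indefinite_description _ (hB i)); apply => j.
  by apply: leq_trans (hn j); apply: (leq_bigmax i).
pose P := hilb_poly (@modzero R N) J Is -
  \sum_(i < size Pi) (loc_length N (pi i))%:R *: hilb_poly (N := R^o) (pi i) J Is.
have szP : (msize P <= D)%N.
  apply: growth_msize (evP_growth e2) _.
  apply: eventually_imp (eventually_and hN (eventually_and hP hall)) => n [en [en2 en3]].
  rewrite /P mevalB -en2 en; congr (_ - _); rewrite (raddf_sum (meval (pt n))) /=; apply: eq_bigr => i _.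
  by rewrite mevalZ -en3 (loc_length_pi _ fys).
(* [msize P <= D] says that every monomial of P has degree below D, whereas m has degree D. *)
have : P@_m = 0 by apply: memN_msupp_eq0; apply: msize_mdeg_ge; rewrite dm.
rewrite /P mcoeffB raddf_sum /= => /eqP; rewrite subr_eq0 => /eqP ->.
by apply: eq_bigr => i _; rewrite mcoeffZ.
Qed.

End Main.

Theorem theorem3p2
  (R : comUnitRingType) (mm : R -> Prop)
  (Hnoeth : noetherian R) (Hloc : local_with mm) (Hinf : infinite_residue mm)
  (d : nat) (Is : 'I_d -> R -> Prop) (HIs : forall i, ideal (Is i))
  (J : R -> Prop) (HJ : primary_to mm J)
  (N : lmodType R) (HN : fin_gen N)
  (HI : ~ incl (Iall Is) (radical (annq (@modzero R N))))
  (* Nbar = N / (0_N : I^oo),  q = dim Nbar *)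
  (Pi : seq (R -> Prop))
  (HPi1 : forall i, (i < size Pi)%N ->
     minimal_prime_over (annq (colon_inf (Iall Is) (@modzero R N))) (nth (fun _ => False) Pi i)
     /\ krull_dim (nth (fun _ => False) Pi i) = mdim (colon_inf (Iall Is) (@modzero R N)))
  (HPi2 : forall p : R -> Prop,
     minimal_prime_over (annq (colon_inf (Iall Is) (@modzero R N))) p ->
     krull_dim p = mdim (colon_inf (Iall Is) (@modzero R N)) ->
     exists2 i, (i < size Pi)%N & seteq (nth (fun _ => False) Pi i) p)
  (HPi3 : forall i j, (i < size Pi)%N -> (j < size Pi)%N ->
     seteq (nth (fun _ => False) Pi i) (nth (fun _ => False) Pi j) -> i = j)
  (k0 : nat) (k : 'I_d -> nat)
  (Hk : (k0 + \sum_(i < d) k i).+1 = mdim (colon_inf (Iall Is) (@modzero R N))) :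
  mixed_mult (@modzero R N) J Is k0 k =
  \sum_(i < size Pi)
     (loc_length N (nth (fun _ => False) Pi i))%:R *
     mixed_mult (N := R^o) (nth (fun _ => False) Pi i) J Is k0 k.
Proof.
rewrite /mixed_mult (hilb_coef_additive Hnoeth Hloc HJ HIs HN HI (esym Hk) HPi1 HPi2 HPi3).
  by rewrite mulr_suml; apply: eq_bigr => i _; rewrite mulrA.
by rewrite mdegE big_ord_recl expvec0; congr (_ + _)%N; apply: eq_bigr => i _; rewrite expvec_lift.
Qed.
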